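(* Let $S:\Omega\to\mathbf C$ be a function defined on a subset $\Omega$ of the open unit disk $\mathbf D$ (no regularity assumed), and let $\kappa$ be a nonnegative integer. Set $$K(\zeta,z)=\frac{1-S(z)\overline{S(\zeta)}}{1-z\bar\zeta},\qquad \zeta,z\in\Omega.$$ (1) If $K$ has $\kappa$ negative squares, then there is a pair $(f,B)$ with $f\in\mathbf S_0$ and $B$ a Blaschke product of degree $\kappa$ such that $f(z)=B(z)S(z)$ for all $z\in\Omega$. (2) If there is a pair $(f,B)$ with $f\in\mathbf S_0$ and $B$ a Blaschke product of degree $\kappa$ such that $f(z)=B(z)S(z)$ for all $z\in\Omega$, then $K$ has $\kappa'$ negative squares for some $\kappa'\le\kappa$.
   Context: $\mathbf S_0$ is the Schur class: holomorphic functions on $\mathbf D$ bounded by one in modulus. A Blaschke product of degree $\kappa$ is a function $B(z)=\gamma\prod_{j=1}^\kappa \frac{z-a_j}{1-z\bar a_j}$ with $|\gamma|=1$ and $a_1,\dots,a_\kappa\in\mathbf D$ not necessarily distinct (for $\kappa=0$, a constant of modulus one). A kernel $K(\zeta,z)=\overline{K(z,\zeta)}$ on $\Omega\times\Omega$ has $\kappa$ negative squares if every selfadjoint matrix $(K(\zeta_j,\zeta_i))_{i,j=1}^n$, with $\zeta_1,\dots,\zeta_n\in\Omega$, $n\ge1$, has at most $\kappa$ negative eigenvalues (counting multiplicity) and at least one such matrix has exactly $\kappa$. *)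

(* Defs.v *)
From HB Require Import structures.
From mathcomp Require Import all_boot all_order all_algebra.
From mathcomp Require Import complex.
From mathcomp Require Import all_classical all_reals all_analysis.

Set Implicit Arguments.
Unset Strict Implicit.
Unset Printing Implicit Defensive.

Import Order.TTheory GRing.Theory Num.Theory.
Import numFieldNormedType.Exports.

Local Open Scope classical_set_scope.
Local Open Scope ring_scope.

(* Functions on a subset of the plane are represented by total functions
   [R[i] -> R[i]]; every notion below only looks at their values on the
   relevant subset. *)

Definition unit_disk (R : realType) : set R[i] := [set z | `|z| < 1].
Arguments unit_disk : clear implicits.

(* The increments in [derivable] range over the scalar field R[i], so this is
   complex differentiability. *)
Definition holomorphic_on (R : realType) (D : set R[i]) (f : R[i] -> R[i]) :
    Prop :=
  forall z, D z -> derivable (f : R[i]^o -> R[i]^o) z 1.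

Definition schur_class (R : realType) : set (R[i] -> R[i]) :=
  [set f | holomorphic_on (unit_disk R) f /\
           forall z, unit_disk R z -> `|f z| <= 1].

Definition blaschke_product (R : realType) (kappa : nat) :
    set (R[i] -> R[i]) :=
  [set B | exists (gamma : R[i]) (a : 'I_kappa -> R[i]),
    [/\ `|gamma| = 1,
        forall j, unit_disk R (a j)
      & forall z, unit_disk R z ->
          B z = gamma * \prod_(j < kappa) ((z - a j) / (1 - z * (a j)^*))]].

Definition eigenvalues (R : realType) (n : nat) (A : 'M[R[i]]_n) : seq R[i] :=
  sval (closed_field_poly_normal (char_poly A)).

(* On R[i], [x < 0] means that x is real and negative. *)
Definition num_neg_eigenvalues (R : realType) (n : nat) (A : 'M[R[i]]_n) :
    nat :=
  count (fun x => x < 0) (eigenvalues A).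

Definition kernel_mx (R : realType) (K : R[i] -> R[i] -> R[i]) (n : nat)
    (zeta : 'I_n -> R[i]) : 'M[R[i]]_n :=
  \matrix_(i, j) K (zeta j) (zeta i).

Definition hermitian_kernel (R : realType) (Omega : set R[i])
    (K : R[i] -> R[i] -> R[i]) : Prop :=
  forall zeta z, Omega zeta -> Omega z -> K zeta z = (K z zeta)^*.

Definition has_negative_squares (R : realType) (Omega : set R[i])
    (K : R[i] -> R[i] -> R[i]) (kappa : nat) : Prop :=
  [/\ hermitian_kernel Omega K,
      forall (n : nat) (zeta : 'I_n -> R[i]), (1 <= n)%N ->
        (forall i, Omega (zeta i)) ->
        (num_neg_eigenvalues (kernel_mx K zeta) <= kappa)%N
    & exists (n : nat) (zeta : 'I_n -> R[i]),
        [/\ (1 <= n)%N,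
            forall i, Omega (zeta i)
          & num_neg_eigenvalues (kernel_mx K zeta) = kappa]].

Definition schur_kernel (R : realType) (S : R[i] -> R[i]) :
    R[i] -> R[i] -> R[i] :=
  fun zeta z => (1 - S z * (S zeta)^*) / (1 - z * zeta^*).

(* Main.v *)
Require Import Defs.
From HB Require Import structures.
From mathcomp Require Import all_boot all_order all_algebra.
From mathcomp Require Import complex.
From mathcomp Require Import all_classical all_reals all_analysis.
From mathcomp Require Import ring lra.

(* Write K_S for the kernel (1 - S(z) S(w)^* ) / (1 - z w^* ).  Negative squares are
   counted through positivity after adding a Gram kernel of rank kappa.

   (2) Pick's theorem gives K_f >= 0, and dividing out one Blaschke factor of B at a
   time raises the number of negative squares by at most one.

   (1) On a finite set, the values S may be replaced by t S with t < 1 close to 1,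
   which makes the Pick matrix P invertible without creating negative squares.  The
   Nevanlinna-Pick formula then produces polynomials p, q with p = t S q at the nodes
   and |p| <= |q| near the unit circle, such that (|q|^2 - |p|^2) / (1 - |z|^2) is the
   diagonal of the sum of a positive kernel and of one built on P.  Schur complements
   at the zeros of q in the disk, taken one after the other, show that there are at
   most kappa of them.  Moving them to a Blaschke product B leaves f = B p / q
   holomorphic and bounded by one.  An ultrafilter limit over the finite subsets and
   over t -> 1 concludes, because the functions with K_f >= 0 on the whole disk are
   closed under pointwise limits and are exactly the Schur functions.

   Pick's theorem follows from the Schur algorithm and a maximum principle, itself
   derived from Goursat's bisection argument applied to Riemann sums on squares. *)

Set Implicit Arguments.
Unset Strict Implicit.
Unset Printing Implicit Defensive.
Import Order.TTheory GRing.Theory Num.Theory.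
Import numFieldNormedType.Exports.
Local Open Scope classical_set_scope.
Local Open Scope ring_scope.
Local Notation re := (@complex.Re _).
Local Notation im := (@complex.Im _).

(** * Kernels and their negative squares *)

Section Kernels.
Variable C : numClosedFieldType.
Implicit Types (a z w : C) (s : seq C) (K : C -> C -> C) (c g : C -> C).

(** [Omega] may be finite or without accumulation point, so nothing can be continued analytically
    from it: (1) has to be solved on finite sets of nodes and carried over by compactness.
    Holomorphy does not visibly survive a pointwise limit, whereas [0 <= form s (pick g) c] does;
    hence Schur functions are handled through their kernel, and differentiability has to be
    recovered from the kernel alone. Eigenvalue counts behave poorly under rescaling, bordering and
    repetition of nodes, while positivity of [K + gram G] with [k] functions is stable under all of
    these; eigenvalues enter through a single equivalence. The interpolation formula needs the
    inverse of the Pick matrix. For [t S] the determinant is a polynomial in [t^2] whose value at 0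
    is the determinant of a Szego matrix, hence it is nonzero for suitable [t] close to 1. The
    degree can fall below [k] in two ways: the denominator may have too few zeros in the disk, and
    zeros may reach the circle in the limit. Factors [z] make up for both. A difference quotient has
    a conventional value at its own node, so the analytic lemmas allow a finite exceptional set. *)

Definition form s K c := \sum_(z <- s) \sum_(w <- s) c z * (c w)^* * K z w.

Definition psd_kernel (D : C -> Prop) K := forall s c,
  uniq s -> (forall z, z \in s -> D z) -> 0 <= form s K c.

Definition gram k (G : 'I_k -> C -> C) z w := \sum_(l < k) G l z * (G l w)^*.

Definition schur_compl K a z w := K z w - K z a * K a w / K a a.

Definition szego z w : C := (1 - z * w^*)^-1.

(* [schur_kernel S zeta z] is [pick S z zeta]: the conjugated variable comes last. *)
Definition pick g z w := (1 - g z * (g w)^*) / (1 - z * w^*).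

Definition bfactor a z := (z - a) / (1 - z * a^*).

Lemma eq_form s K K' c c' :
  (forall z, z \in s -> c z = c' z) ->
  (forall z w, z \in s -> w \in s -> K z w = K' z w) ->
  form s K c = form s K' c'.
Proof.
move=> ec eK; rewrite /form big_seq [RHS]big_seq; apply: eq_bigr => z zs.
rewrite big_seq [RHS]big_seq; apply: eq_bigr => w ws.
by rewrite !ec// eK.
Qed.

Lemma formD s K K' c :
  form s (fun z w => K z w + K' z w) c = form s K c + form s K' c.
Proof.
rewrite /form -big_split /=; apply: eq_bigr => z _.
by rewrite -big_split /=; apply: eq_bigr => w _; rewrite mulrDr.
Qed.

Lemma formZ s K c (t : C) : form s (fun z w => t * K z w) c = t * form s K c.
Proof.
rewrite /form mulr_sumr; apply: eq_bigr => z _.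
by rewrite mulr_sumr; apply: eq_bigr => w _; rewrite mulrCA.
Qed.

Lemma form_scale s K c g :
  form s (fun z w => g z * (g w)^* * K z w) c = form s K (fun z => c z * g z).
Proof.
apply: eq_bigr => z _; apply: eq_bigr => w _.
by rewrite rmorphM mulrA; congr (_ * _); ring.
Qed.

Lemma form_rank1 s c g :
  form s (fun z w => g z * (g w)^*) c = `|\sum_(z <- s) c z * g z| ^+ 2.
Proof.
rewrite normCK rmorph_sum /= big_distrlr /=; apply: eq_bigr => z _.
by apply: eq_bigr => w _; rewrite rmorphM /=; ring.
Qed.

Lemma form_cons a s K c :
  form (a :: s) K c = c a * (c a)^* * K a a
    + \sum_(w <- s) c a * (c w)^* * K a w
    + \sum_(z <- s) c z * (c a)^* * K z a + form s K c.
Proof.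
rewrite /form !big_cons -!addrA; congr (_ + _); congr (_ + _).
by rewrite -big_split /=; apply: eq_bigr => z _; rewrite big_cons.
Qed.

(** Completing the square in the coefficient of [a]: the Schur complement vanishes on the row and
    the column of [a], so only [s] is left. *)
Lemma form_schur_compl a s K c : K a a != 0 ->
  (forall z, z \in s -> K a z = (K z a)^*) -> K a a = (K a a)^* ->
  form (a :: s) K c = `|\sum_(z <- a :: s) c z * K z a| ^+ 2 / K a a
                      + form s (schur_compl K a) c.
Proof.
move=> Ka0 herm hermaa.
have -> : `|\sum_(z <- a :: s) c z * K z a| ^+ 2 / K a a =
   form (a :: s) (fun z w => (K a a)^-1 * (K z a * K a w)) c.
  rewrite formZ mulrC -form_rank1; congr (_ * _); apply: eq_form => // z w _.
  by rewrite inE => /predU1P[->|/herm ->//]; rewrite -hermaa.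
have -> : form s (schur_compl K a) c = form (a :: s) (schur_compl K a) c.
  have Kz z : schur_compl K a z a = 0 by rewrite /schur_compl mulfK// subrr.
  have Kw w : schur_compl K a a w = 0.
    by rewrite /schur_compl mulrAC mulfV// mul1r subrr.
  rewrite form_cons -[LHS]add0r; congr (_ + _).
  by rewrite Kz mulr0 add0r !big1 ?addr0// => z _; rewrite ?Kz ?Kw mulr0.
rewrite -formD; apply: eq_form => // z w _ _; rewrite /schur_compl.
by rewrite addrC [_^-1 * _]mulrC subrK.
Qed.

(** The coefficient at [a] is chosen to annihilate the completed square. The form of the Schur
    complement is thus itself a value of the form of [K], and inherits its positivity. *)
Lemma form_schur_min a s K c : a \notin s -> K a a != 0 ->
  (forall z, z \in s -> K a z = (K z a)^*) -> K a a = (K a a)^* ->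
  exists2 c', (forall z, z \in s -> c' z = c z) &
    form (a :: s) K c' = form s (schur_compl K a) c.
Proof.
move=> aNs Ka0 herm hermaa.
pose t := - (\sum_(z <- s) c z * K z a) / K a a.
pose c' z := if z == a then t else c z.
have c'E : forall z, z \in s -> c' z = c z.
  by move=> z zs; rewrite /c'; case: eqP zs aNs => // -> ->.
exists c' => //; rewrite form_schur_compl//.
rewrite (eq_form (c' := c) (K' := schur_compl K a))//.
have -> : \sum_(z <- a :: s) c' z * K z a = 0.
  rewrite big_cons {1}/c' eqxx /t mulfVK//.
  rewrite [X in _ + X](eq_big_seq (fun z => c z * K z a)) ?addNr// => z zs.
  by rewrite c'E.
by rewrite normr0 expr0n /= mul0r add0r.
Qed.

Lemma psd_schur_compl D K a s c : psd_kernel D K -> D a ->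
  (forall z, D z -> K a z = (K z a)^*) -> K a a != 0 ->
  uniq s -> (forall z, z \in s -> D z) -> a \notin s ->
  0 <= form s (schur_compl K a) c.
Proof.
move=> psdK Da herm Ka0 us sD aNs.
have [z /sD|| c' _ <-] := form_schur_min c aNs Ka0; [exact: herm|exact: herm|].
apply: psdK => /=; first by rewrite aNs.
by move=> z; rewrite inE => /predU1P[->|/sD].
Qed.

Definition disk (z : C) := `|z| < 1.

Lemma disk_conj_neq1 z w : disk z -> `|w| <= 1 -> 1 - z * w^* != 0.
Proof.
move=> zD wD; rewrite subr_eq0; apply/eqP => /(congr1 Num.norm).
rewrite normr1 normrM norm_conjC => e.
have := ler_wpM2l (normr_ge0 z) wD; rewrite -e mulr1 => /le_lt_trans /(_ zD).
by rewrite ltxx.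
Qed.

Lemma szego_herm z w : szego z w = (szego w z)^*.
Proof. by rewrite /szego fmorphV rmorphB rmorphM /= conjC1 conjCK [w^* * _]mulrC. Qed.

Lemma pick_herm g z w : pick g z w = (pick g w z)^*.
Proof.
rewrite /pick rmorphM fmorphV !rmorphB !rmorphM /= conjC1 !conjCK.
by rewrite [w^* * _]mulrC [(g w)^* * _]mulrC.
Qed.

Lemma pick_gt0 g z : `|g z| < 1 -> disk z -> 0 < pick g z z.
Proof.
by move=> gz zD; apply: divr_gt0; rewrite subr_gt0 -normCK expr_lt1.
Qed.

Lemma szego_gt0 z : disk z -> 0 < szego z z.
Proof. by move=> zD; rewrite invr_gt0 subr_gt0 -normCK expr_lt1. Qed.

(** One step of the Schur algorithm. At [a] the divisor is 0 and the quotient is 0 by convention, so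
    [a] is excluded from then on. *)
Definition mobius_quot g a z :=
  (g z - g a) / (1 - g z * (g a)^*) / bfactor a z.

Lemma bfactor_neq0 a z : disk a -> disk z -> z != a -> bfactor a z != 0.
Proof.
move=> aD zD za; apply: mulf_neq0; first by rewrite subr_eq0.
by rewrite invr_eq0; apply: disk_conj_neq1 => //; apply: ltW.
Qed.

Lemma norm_lt1_neq g z a : `|g z| <= 1 -> `|g a| < 1 -> 1 - g z * (g a)^* != 0.
Proof.
move=> gz ga; rewrite -conjC_eq0 rmorphB rmorphM /= conjC1 conjCK mulrC.
exact: disk_conj_neq1.
Qed.

(** The Schur algorithm is Gaussian elimination on Pick kernels: up to the scaling [u], eliminating
    the node [a] produces the kernel of the next Schur iterate. *)
Lemma schur_compl_pick g a z w : disk a -> disk z -> disk w ->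
  z != a -> w != a -> `|g a| < 1 -> `|g z| <= 1 -> `|g w| <= 1 ->
  let u z := (1 - g z * (g a)^*) * bfactor a z in
  schur_compl (pick g) a z w = 
   (1 - `|g a| ^+ 2)^-1 * (u z * (u w)^* * pick (mobius_quot g a) z w).
Proof.
move=> aD zD wD za wa ga gz gw u.
have n1 := norm_lt1_neq gz ga; have n2 := norm_lt1_neq gw ga.
have n3 := norm_lt1_neq (ltW ga) ga.
have n2' : 1 - (g w)^* * g a != 0.
  by move: n2; rewrite -conjC_eq0 rmorphB rmorphM /= conjC1 conjCK.
have d1 := disk_conj_neq1 zD (ltW aD).
have d2 := disk_conj_neq1 wD (ltW aD).
have d2' : 1 - w^* * a != 0.
  by move: d2; rewrite -conjC_eq0 rmorphB rmorphM /= conjC1 conjCK.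
have d3 := disk_conj_neq1 aD (ltW aD).
have d4 := disk_conj_neq1 zD (ltW wD).
have d2'' : 1 - a * w^* != 0 by rewrite mulrC.
have n2'' : 1 - g a * (g w)^* != 0 by rewrite mulrC.
rewrite normCK /u /mobius_quot /schur_compl /pick /bfactor.
rewrite !(rmorphM, fmorphV, rmorphB, invfM, invrK) /=.
have za' : z - a != 0 by rewrite subr_eq0.
have wa' : w^* - a^* != 0 by rewrite -rmorphB conjC_eq0 subr_eq0.
move: n1 n2' n3 d1 d2' d2'' d3 d4 za' wa' n2'' => *.
rewrite ?conjC1 ?conjCK.
field.
repeat (apply/andP; split=> //).
Qed.

Lemma perm_form s s' K c : perm_eq s s' -> form s K c = form s' K c.
Proof.
move=> p; rewrite /form (perm_big _ p); apply: eq_bigr => z _.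
exact: perm_big.
Qed.

Lemma schur_compl_szego a z w : disk a -> disk z -> disk w ->
  schur_compl szego a z w = bfactor a z * (bfactor a w)^* * szego z w.
Proof.
move=> aD zD wD; have d1 := disk_conj_neq1 zD (ltW aD).
have d2 : 1 - w^* * a != 0.
  rewrite -conjC_eq0 rmorphB rmorphM /= conjC1 conjCK.
  exact: disk_conj_neq1 (ltW aD).
have d3 := disk_conj_neq1 aD (ltW aD); have d4 := disk_conj_neq1 zD (ltW wD).
have d2' : 1 - a * w^* != 0 by rewrite mulrC.
rewrite /schur_compl /szego /bfactor.
rewrite !(rmorphM, fmorphV, rmorphB, invfM, invrK) /= ?conjC1 ?conjCK.
by field; do ?[apply/andP; split].
Qed.

(** Elimination of a node returns the same kernel, with coefficients multiplied by [bfactor a],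
    which is nonzero at the other nodes. Strictness later makes Szego matrices at distinct nodes
    invertible. *)
Lemma form_szego_gt0 s c : uniq s -> (forall z, z \in s -> disk z) ->
  (exists2 z, z \in s & c z != 0) -> 0 < form s szego c.
Proof.
elim: s c => [|a s IH] c /=; first by move=> _ _ [].
move=> /andP[aNs us] sD [z zas cz0].
have aD : disk a by apply: sD; rewrite mem_head.
have sD' w : w \in s -> disk w by move=> ws; apply: sD; rewrite inE ws orbT.
have Ka0 := szego_gt0 aD.
rewrite form_schur_compl ?gt_eqF// -?szego_herm//; last first.
  by move=> w ws; apply: szego_herm.
have -> : form s (schur_compl szego a) c =
    form s szego (fun z => c z * bfactor a z).
  rewrite -form_scale; apply: eq_form => // x y xs ys.
  by rewrite schur_compl_szego// ; apply: sD'.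
have [cs|cs] := boolP (has (fun w => c w != 0) s).
  apply: ltr_wpDl; first by rewrite divr_ge0 ?exprn_ge0// ltW.
  move/hasP: cs => [w ws cw]; apply: IH => //; exists w => //.
  rewrite mulf_neq0// bfactor_neq0//; first exact: sD'.
  by apply: contraNneq aNs => <-.
have {}cs w : w \in s -> c w = 0.
  by move=> ws; apply/eqP; move/hasPn/(_ _ ws): cs; rewrite negbK.
rewrite [X in _ + X](eq_form (c' := fun=> 0) (K' := szego))//; last first.
  by move=> w ws; rewrite cs// mul0r.
rewrite [form _ _ _]big1 ?addr0; last first.
  by move=> *; rewrite big1// => *; rewrite !mul0r.
apply: divr_gt0 => //; rewrite exprn_gt0// normr_gt0 big_cons big1_seq ?addr0.
  move: zas cz0; rewrite inE => /predU1P[->|/cs->]; last by rewrite eqxx.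
  by move=> ca0; rewrite mulf_neq0// gt_eqF.
by move=> w /= ws; rewrite cs// mul0r.
Qed.

Lemma psd_szego : psd_kernel disk szego.
Proof.
move=> s c us sD; have [/hasP[z zs cz]|cs] := boolP (has (fun w => c w != 0) s).
  by rewrite ltW// form_szego_gt0//; exists z.
rewrite (eq_form (c' := fun=> 0) (K' := szego))//; last first.
  by move=> w ws; apply/eqP; move/hasPn/(_ _ ws): cs; rewrite negbK.
by rewrite [form _ _ _]big1// => *; rewrite big1// => *; rewrite !mul0r.
Qed.

(** At most [k] negative eigenvalues, expressed without eigenvalues. The functions [G] may depend on
    the finite set [s], since negative squares are counted on finite sets. *)
Definition neg_squares_le k (D : C -> Prop) K := forall s,
  uniq s -> (forall z, z \in s -> D z) ->
  exists G : 'I_k -> C -> C, forall c, 0 <= form s K c + form s (gram G) c.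

Definition fcons k g (G : 'I_k -> C -> C) (l : 'I_k.+1) :=
  if unlift ord0 l is Some l' then G l' else g.

Lemma gram_fcons k g (G : 'I_k -> C -> C) z w :
  gram (fcons g G) z w = g z * (g w)^* + gram G z w.
Proof.
rewrite /gram big_ord_recl /fcons unlift_none; congr (_ + _).
by apply: eq_bigr => l _; rewrite liftK.
Qed.

Lemma form_gram_fcons k g (G : 'I_k -> C -> C) s c :
  form s (gram (fcons g G)) c =
  form s (fun z w => g z * (g w)^*) c + form s (gram G) c.
Proof. by rewrite -formD; apply: eq_form => // z w _ _; apply: gram_fcons. Qed.

(* The added vector [x] cancels the row and column of [a]. *)
Lemma neg_squares_le_border k K (D : C -> Prop) a :
  (forall z w, D z -> D w -> K z w = (K w z)^*) -> D a ->
  neg_squares_le k (fun z => D z /\ z <> a) K -> neg_squares_le k.+1 D K.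
Proof.
move=> herm Da neg s us sD.
have [as_|aNs] := boolP (a \in s); last first.
  have [|G Gpos] := neg s us.
    by move=> z zs; split; [exact: sD | move=> za; rewrite -za zs in aNs].
  exists (fcons (fun=> 0) G) => c; rewrite form_gram_fcons.
  by rewrite form_rank1 big1 ?normr0 ?expr0n ?add0r// => *; rewrite mulr0.
have [||G Gpos] := neg (rem a s); first exact: rem_uniq.
  move=> z; rewrite (mem_rem_uniq _ us) inE => /andP[/eqP za /sD]; by split.
have aN : a \notin rem a s by rewrite (mem_rem_uniq _ us) inE eqxx.
have Kaa : K a a \is Num.real.
  by rewrite CrealE; apply/eqP; rewrite -(herm a a).
(* From [t >= 1] and [t >= |K a a|] follows [t^2 >= |K a a|], which makes the corner [K a a + t^2]
   nonnegative. *)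
pose t := 1 + `|K a a|.
have t0 : 0 < t by rewrite ltr_pwDl.
have Kt : 0 <= K a a + t * t^*.
  have -> : t^* = t by apply/CrealP; rewrite gtr0_real.
  have /andP[+ _] : - `|K a a| <= K a a <= `|K a a| by rewrite -real_ler_norml.
  move=> h; apply: le_trans (_ : - `|K a a| + t * t <= _); last by rewrite lerD2r.
  rewrite addrC subr_ge0 /t; apply: le_trans (_ : 1 + `|K a a| <= _).
    by rewrite lerDr.
  by rewrite ler_peMr// ?lerDl// ltW.
pose x z := if z == a then t else - K z a / t.
pose G' l z := if z == a then 0 else G l z.
exists (fcons x G') => c.
pose T z w := K z w + (x z * (x w)^* + gram G' z w).
rewrite form_gram_fcons -!formD (eq_form (c' := c) (K' := T))//.
rewrite (perm_form _ _ (perm_to_rem as_)) form_cons.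
have Txa z : z \in rem a s -> T z a = 0 /\ T a z = 0.
  move=> zs; have zNa : (z == a) = false.
    by apply: contraNF aN => /eqP za; rewrite -{1}za.
  have Dz : D z by apply: sD; apply: mem_rem zs.
  rewrite /T /gram /x zNa eqxx (_ : t^* = t); last first.
    by apply/CrealP; rewrite gtr0_real.
  rewrite rmorphM rmorphN /= -(herm a z)// fmorphV /= (_ : t^* = t); last first.
    by apply/CrealP; rewrite gtr0_real.
  split; rewrite big1 ?addr0; try by move=> l _; rewrite /G' eqxx ?conjC0 ?mulr0 ?mul0r.
    by rewrite mulfVK ?gt_eqF// subrr.
  by rewrite mulrC mulfVK ?gt_eqF// subrr.
rewrite [X in _ + X + _ + _]big_seq [X in _ + X + _]big_seq.
rewrite !big1 ?addr0; try by move=> z /Txa[e1 e2]; rewrite ?e1 ?e2 mulr0.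
apply: addr_ge0.
  rewrite mulr_ge0// ?mul_conjC_ge0// /T /gram /x eqxx big1 ?addr0//.
  by move=> l _; rewrite /G' eqxx mul0r.
rewrite (eq_form (c' := c) (K' := fun z w => (K z w + gram G z w) + x z * (x w)^*))//.
  by rewrite formD form_rank1 addr_ge0 ?exprn_ge0// formD.
move=> z w zs ws; rewrite /T.
have Na y : y \in rem a s -> (y == a) = false.
  by move=> ys; apply: contraNF aN => /eqP ya; rewrite -{1}ya.
rewrite (_ : gram G' z w = gram G z w); first by rewrite addrA addrAC.
by apply: eq_bigr => l _; rewrite /G' !Na.
Qed.

Lemma psd_pick_le1 (D : C -> Prop) g z : (forall z, D z -> disk z) ->
  psd_kernel D (pick g) -> D z -> `|g z| <= 1.
Proof.
move=> DD psdg Dz; have : 0 <= form [:: z] (pick g) (fun=> 1).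
  by apply: psdg => // w; rewrite inE => /eqP->.
rewrite /form !big_seq1 conjC1 !mul1r.
rewrite /pick pmulr_lge0 ?invr_gt0 ?subr_gt0 -?normCK ?expr_lt1//; last exact: DD.
by rewrite subr_ge0 expr_le1.
Qed.

(** Only elimination of a node is involved, with coefficients rescaled by [u], which has no zero off
    [a]; hence [D] can be any subset of the disk. *)
Lemma psd_mobius_quot (D : C -> Prop) g a : (forall z, D z -> disk z) ->
  psd_kernel D (pick g) -> D a -> `|g a| < 1 ->
  psd_kernel (fun z => D z /\ z <> a) (pick (mobius_quot g a)).
Proof.
move=> DD psdg Da ga s c us sD.
have aD := DD a Da.
pose u z := (1 - g z * (g a)^*) * bfactor a z.
have gle z : D z -> `|g z| <= 1 by apply: psd_pick_le1.
have un0 z : z \in s -> u z != 0.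
  move=> /sD[Dz /eqP za]; apply: mulf_neq0; last by apply: bfactor_neq0 => //; apply: DD.
  by apply: norm_lt1_neq => //; apply: gle.
have : 0 <= form s (schur_compl (pick g) a) (fun z => c z / u z).
  apply: psd_schur_compl psdg Da _ _ us _ _.
  - by move=> z _; apply: pick_herm.
  - by rewrite gt_eqF// pick_gt0.
  - by move=> z /sD[].
  - by apply/negP => /sD[].
rewrite (eq_form (c' := fun z => c z / u z)
  (K' := fun z w => (1 - `|g a| ^+ 2)^-1 * (u z * (u w)^* * pick (mobius_quot g a) z w)))//.
  rewrite formZ form_scale pmulr_rge0 ?invr_gt0 ?subr_gt0 ?expr_lt1//.
  by rewrite (eq_form (c' := c) (K' := pick (mobius_quot g a)))// => z zs; rewrite mulfVK// un0.
move=> z w /sD[Dz /eqP za] /sD[Dw /eqP wa].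
by rewrite schur_compl_pick//; auto.
Qed.

(* A zero [a] of the product lying in [D] costs one bordered row; otherwise the
   factor [b_a] is absorbed into [S], and [b_a b_a^* K_S] differs from the kernel
   of [b_a S] by the rank one kernel [(1 - |a|^2) / ((1 - z a^* ) (1 - a w^* ))]. *)
Lemma neg_squares_le_blaschke (zs : seq C) (D : C -> Prop) f S gamma :
  (forall z, D z -> disk z) -> (forall a, a \in zs -> disk a) -> `|gamma| = 1 ->
  psd_kernel D (pick f) ->
  (forall z, D z -> f z = gamma * \prod_(a <- zs) bfactor a z * S z) ->
  neg_squares_le (size zs) D (pick S).
Proof.
elim: zs D f S => [|a zs IH] D f S DD zsD g1 psdf fBS.
  move=> s us sD; exists (fun _ _ => 0) => c.
  rewrite [X in _ + X]big1 ?addr0; last first.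
    by move=> *; rewrite big1// => *; rewrite /gram big_ord0 mulr0.
  rewrite (eq_form (c' := c) (K' := pick f)) => //; first exact: psdf.
  move=> z w /sD Dz /sD Dw; rewrite /pick !fBS// !big_nil !mulr1 rmorphM mulrACA.
  by rewrite -normCK g1 expr1n mul1r.
have aD : disk a by apply: zsD; rewrite mem_head.
have zsD' b : b \in zs -> disk b by move=> bz; apply: zsD; rewrite inE bz orbT.
(* At a zero [a] in [D] the equation yields [f a = 0] and leaves [S a] arbitrary, so this row is
   bordered away; off [a], the Schur step on [f] is then plain division by [bfactor a]. *)
have [Da|Da] := EM (D a).
  have fa : f a = 0 by rewrite fBS// big_cons /bfactor subrr !(mul0r, mulr0).
  apply: (neg_squares_le_border _ Da) => [z w _ _|]; first exact: pick_herm.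
  apply: (IH _ (mobius_quot f a)) => //; first by move=> z [/DD].
    by apply: (psd_mobius_quot DD psdf Da); rewrite fa normr0 ltr01.
  move=> z [Dz /eqP za]; rewrite /mobius_quot fa conjC0 mulr0 !subr0 divr1.
  rewrite fBS// big_cons; have b0 := bfactor_neq0 aD (DD _ Dz) za.
  by field.
have neg : neg_squares_le (size zs) D (pick (fun z => bfactor a z * S z)).
  by apply: (IH _ f) => // z Dz; rewrite fBS// big_cons; ring.
move=> s us sD; have [G Gpos] := neg s us sD.
have b0 z : z \in s -> bfactor a z != 0.
  move=> /sD Dz; apply: bfactor_neq0 => //; first exact: DD.
  by apply/eqP => za; rewrite za in Dz.
(* The vector of the rank one kernel, divided by [bfactor a]; the square root splits [1 - |a|^2]
   between the two variables. *)
pose e z := sqrtC (1 - `|a| ^+ 2) / (1 - z * a^*) / bfactor a z.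
exists (fcons e (fun l z => G l z / bfactor a z)) => c.
rewrite form_gram_fcons addrA -formD.
rewrite (eq_form (c' := c) (K' := fun z w => (bfactor a z)^-1 *
  ((bfactor a w)^-1)^* * pick (fun z => bfactor a z * S z) z w)) //; last first.
  move=> z w zs' ws'; rewrite /e.
  have zD := DD z (sD z zs'); have wD := DD w (sD w ws').
  have d1 := disk_conj_neq1 zD (ltW aD).
  have d2 : 1 - w^* * a != 0.
    rewrite -conjC_eq0 rmorphB rmorphM /= conjC1 conjCK.
    exact: disk_conj_neq1 (ltW aD).
  have d4 := disk_conj_neq1 zD (ltW wD).
  have za : z - a != 0.
    by move: (b0 z zs'); apply: contraNneq; rewrite /bfactor => ->; rewrite mul0r.
  have wa : w^* - a^* != 0.
    rewrite -rmorphB conjC_eq0; move: (b0 w ws'); apply: contraNneq.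
    by rewrite /bfactor => ->; rewrite mul0r.
  pose q := sqrtC (1 - `|a| ^+ 2).
  have qq : q * q^* = 1 - a * a^*.
    by rewrite -normCK ger0_norm ?sqrtCK ?normCK// sqrtC_ge0 subr_ge0 expr_le1// ltW.
  rewrite -/q !(rmorphM, fmorphV, rmorphB) /= ?conjC1 ?conjCK.
  transitivity ((1 - S z * (S w)^*) / (1 - z * w^*) + q * q^* / (1 - z * a^*) /
    (1 - w^* * a) / bfactor a z / ((w^* - a^*) / (1 - w^* * a))).
    rewrite /pick /bfactor; field; do ?[apply/andP; split=> //].
  rewrite qq /pick /bfactor !(rmorphM, fmorphV, rmorphB) /= ?conjC1 ?conjCK.
  by field; do ?[apply/andP; split=> //].
rewrite (form_scale _ _ _ (fun z => (bfactor a z)^-1)).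
rewrite (_ : form s (gram _) c = form s (gram G) (fun z => c z / bfactor a z)).
  exact: Gpos.
rewrite -form_scale; apply: eq_form => // z w _ _.
rewrite /gram mulr_sumr; apply: eq_bigr => l _.
by rewrite rmorphM /=; ring.
Qed.

End Kernels.

(** * Negative eigenvalues *)

Section HermitianMatrices.
Local Open Scope sesquilinear_scope.
Variable C : numClosedFieldType.

Definition psdmx n (A : 'M[C]_n) := forall x : 'rV_n, 0 <= (x *m A *m x^t*) 0 0.

Lemma trmxC_mul m n p (A : 'M[C]_(m, n)) (B : 'M[C]_(n, p)) :
  (A *m B)^t* = B^t* *m A^t*.
Proof. by rewrite trmx_mul map_mxM. Qed.

Lemma diag_formE n (d y : 'rV[C]_n) :
  (y *m diag_mx d *m y^t*) 0 0 = \sum_i d 0 i * `|y 0 i| ^+ 2.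
Proof.
rewrite mxE; apply: eq_bigr => i _; rewrite !mxE (bigD1 i)//= !mxE eqxx mulr1n.
rewrite big1 ?addr0 ?normCK; first by rewrite [y 0 i * _]mulrC mulrA.
by move=> j ji; rewrite !mxE (negbTE ji) mulr0n mulr0.
Qed.

Lemma char_poly_conj n (P A : 'M[C]_n) : P \in unitmx ->
  char_poly (invmx P *m A *m P) = char_poly A.
Proof.
move=> Pu; rewrite /char_poly /char_poly_mx.
have Pp : map_mx polyC P \in unitmx by rewrite map_unitmx.
rewrite !map_mxM map_invmx; set Q := map_mx _ P in Pp *.
have XE : 'X%:M = invmx Q *m 'X%:M *m Q.
  by rewrite -mulmxA -scalar_mxC mulmxA mulVmx// mul1mx.
rewrite [in LHS]XE -mulmxBl -mulmxBr !det_mulmx mulrAC -det_mulmx.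
by rewrite mulVmx// det1 mul1r.
Qed.

(** Forward: in an orthonormal eigenbasis, square roots of the moduli of the negative eigenvalues,
    one per column, cancel the negative part. Backward: the span of more than [k] eigenvectors with
    negative eigenvalues contains a nonzero vector annihilated by [G], on which the form is
    negative. *)
Lemma count_neg_eigenvaluesP (n k : nat) (A : 'M[C]_n) (eigs : seq C) : A \is hermsymmx ->
  char_poly A = \prod_(x <- eigs) ('X - x%:P) ->
  (count (fun x => (x < 0)%R) eigs <= k)%N <->
    exists G : 'M[C]_(n, k), psdmx (A + G *m G^t*).
Proof.
move=> Ah Aeig.
have An := hermitian_normalmx Ah.
have dreal := hermitian_spectral_diag_real Ah.
move/orthomx_spectralP: (An).
set U := spectralmx A; set d := spectral_diag A => AE.
have Uu : U \is unitarymx := spectral_unitarymx A.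
have UU : U *m U^t* = 1%:M by apply/unitarymxP.
have dR i : d 0 i \is Num.real by move/mxOverP: dreal; apply.
have -> : count (fun x => x < 0) eigs = #|[pred i | d 0 i < 0]|.
  have : perm_eq eigs [seq d 0 i | i <- enum 'I_n].
    apply: prod_XsubC_eq; rewrite -Aeig AE char_poly_conj ?spectral_unit//.
    rewrite char_poly_trig ?diag_mx_is_trig// big_map big_enum /=.
    by apply: eq_bigr => i _; rewrite !mxE eqxx mulr1n.
  by move/permP => ->; rewrite count_map cardE -size_filter enumT.
move: AE; rewrite invmx_unitary// => AE; split.
- move=> nk; set I := enum [pred i | d 0 i < 0].
  pose E : 'M[C]_(n, k) := \matrix_(i, l)
    if (d 0 i < 0) && (index i I == l) then sqrtC (- d 0 i) else 0.
  exists (U^t* *m E) => x.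
  have -> : A + U^t* *m E *m (U^t* *m E)^t* =
     U^t* *m diag_mx (\row_i if d 0 i < 0 then 0 else d 0 i) *m U.
    rewrite AE trmxC_mul trmxCK !mulmxA -mulmxDl -(mulmxA _ E) -mulmxDr.
    congr (_ *m _ *m _); apply/matrixP => i j; rewrite !mxE.
    have [<-|ij] := eqVneq i j; last first.
      rewrite !mulr0n add0r big1// => l _; rewrite !mxE.
      case: ifP => [/andP[di /eqP il]|]; last by rewrite mul0r.
      case: ifP => [/andP[dj /eqP jl]|]; last by rewrite conjC0 mulr0.
      move/eqP: ij; case; rewrite -(nth_index i (s := I) (x := i)) ?mem_enum//.
      by rewrite il -jl nth_index ?mem_enum.
    rewrite !mulr1n; case: ifPn => di; last first.
      rewrite big1 ?addr0// => l _; rewrite !mxE (negbTE di) /= mul0r//.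
    have li : (index i I < k)%N.
      by apply: leq_trans nk; rewrite cardE index_mem mem_enum.
    rewrite (bigD1 (Ordinal li))//= big1 ?addr0; last first.
      move=> l ll; rewrite !mxE di /= [_ == _ :> nat]negbTE ?mul0r//.
      by apply: contraNneq ll => h; apply/eqP/val_inj.
    rewrite !mxE di eqxx /= -normCK ger0_norm ?sqrtC_ge0 ?oppr_ge0 ?ltW//.
    by rewrite sqrtCK subrr.
  rewrite (_ : _ *m _ *m _ = (x *m U^t*) *m
     diag_mx (\row_i (if d 0 i < 0 then 0 else d 0 i)) *m (x *m U^t*)^t*).
    rewrite diag_formE sumr_ge0// => i _; rewrite mulr_ge0 ?exprn_ge0// mxE.
    by case: ifPn => // ; rewrite -real_leNgt.
  by rewrite trmxC_mul trmxCK !mulmxA.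
- case=> G Gpos; rewrite leqNgt; apply/negP => nk.
  pose f := @enum_val _ [pred i | d 0 i < 0].
  pose V : 'M[C]_(#|[pred i | d 0 i < 0]|, n) := rowsub f 1%:M.
  have : kermx (V *m U *m G) != 0.
    rewrite kermx_eq0 -row_leq_rank -ltnNge.
    by apply: leq_ltn_trans (rank_leq_col _) nk.
  case/rowV0Pn => y /sub_kermxP yG y0.
  have := Gpos (y *m V *m U).
  rewrite mulmxDr mulmxDl mxE.
  rewrite [_ *m (G *m _)]mulmxA -[y *m V *m U]mulmxA -[y *m (V *m U) *m G]mulmxA yG.
  rewrite mul0mx mul0mx [X in _ + X]mxE addr0 AE.
  rewrite (_ : _ *m _ *m _ = (y *m V) *m diag_mx d *m (y *m V)^t*); last first.
    rewrite !trmxC_mul !mulmxA -(mulmxA _ U) UU mulmx1.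
    by rewrite -(mulmxA _ U) UU mulmx1.
  rewrite diag_formE.
  have yV i : (y *m V) 0 i = \sum_l y 0 l * (f l == i)%:R.
    by rewrite mxE; apply: eq_bigr => l _; rewrite !mxE.
  have yf l : (y *m V) 0 (f l) = y 0 l.
    rewrite yV (bigD1 l)//= eqxx mulr1 big1 ?addr0// => j jl.
    by rewrite (inj_eq enum_val_inj) (negbTE jl) mulr0.
  case/rV0Pn: y0 => l yl; apply/negP; rewrite -real_ltNge ?real0//; last first.
    by apply: rpred_sum => i _; rewrite rpredM// rpredX// normr_real.
  rewrite (bigD1 (f l))//= yf -[ltRHS]addr0 ltr_leD//.
    rewrite nmulr_rlt0 ?exprn_gt0 ?normr_gt0//.
    by have := enum_valP l; rewrite inE.
  apply: sumr_le0 => i _; have [di|di] := boolP (d 0 i < 0).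
    by rewrite mulr_le0_ge0 ?exprn_ge0// ltW.
  rewrite yV big1 ?normr0 ?expr0n ?mulr0// => j _.
  case: eqP => [fi|]; last by rewrite mulr0.
  by have := enum_valP j; rewrite -/(f j) fi inE (negbTE di).
Qed.

End HermitianMatrices.

(** * The maximum modulus principle *)

Section SquareSums.
Variable R : realType.
Implicit Types (x y l u v : R).

Lemma exists_half_lt l (d : R) : 0 < d -> exists k, l / 2 ^+ k < d.
Proof.
move=> d0; exists (Num.truncn (`|l| / d)).+1.
rewrite ltr_pdivrMr ?exprn_gt0// mulrC -ltr_pdivrMr//.
apply: le_lt_trans (_ : `|l| / d < _); first by rewrite ler_pM2r ?invr_gt0// ler_norm.
apply: lt_le_trans (truncnS_gt _) _.
by rewrite -natrX ler_nat ltnW// ltn_expl.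
Qed.

(** Nested squares: if [P] fails on a square it fails on a quarter of it, and the failing squares
    shrink to a point near which [P] holds. [P] stays abstract because its later instance is an
    existential statement about refinement levels. *)
Lemma cousin (P : R -> R -> R -> Prop) x y l : 0 < l ->
  (forall x y l, 0 < l ->
    P x y (l / 2) -> P (x + l / 2) y (l / 2) -> P x (y + l / 2) (l / 2) ->
    P (x + l / 2) (y + l / 2) (l / 2) -> P x y l) ->
  (forall u v, x <= u <= x + l -> y <= v <= y + l ->
    exists2 d, 0 < d & forall x' y' l', 0 < l' -> l' < d ->
      x <= x' -> x' + l' <= x + l -> y <= y' -> y' + l' <= y + l ->
      x' <= u <= x' + l' -> y' <= v <= y' + l' -> P x' y' l') ->
  P x y l.
Proof.
move=> l0 Pquad Ploc; apply: contrapT => NP.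
have step (p : R * R * R) : exists q : R * R * R, 0 < p.2 -> ~ P p.1.1 p.1.2 p.2 ->
    [/\ ~ P q.1.1 q.1.2 q.2, q.2 = p.2 / 2,
      p.1.1 <= q.1.1 /\ q.1.1 + q.2 <= p.1.1 + p.2 &
      p.1.2 <= q.1.2 /\ q.1.2 + q.2 <= p.1.2 + p.2].
  have [p0|p0] := ltP 0 p.2; last by exists p.
  have [NPp|NPp] := EM (P p.1.1 p.1.2 p.2); first by exists p.
  case: p p0 NPp => -[a b] m /= m0 NPp.
  have [h1|h1] := EM (P a b (m / 2)); last first.
    by exists (a, b, m / 2) => _ _ /=; split=> //; lra.
  have [h2|h2] := EM (P (a + m / 2) b (m / 2)); last first.
    by exists (a + m / 2, b, m / 2) => _ _ /=; split=> //; lra.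
  have [h3|h3] := EM (P a (b + m / 2) (m / 2)); last first.
    by exists (a, b + m / 2, m / 2) => _ _ /=; split=> //; lra.
  have [h4|h4] := EM (P (a + m / 2) (b + m / 2) (m / 2)); last first.
    by exists (a + m / 2, b + m / 2, m / 2) => _ _ /=; split=> //; lra.
  by case: NPp; apply: Pquad.
have [g gP] := choice step.
pose s k := iter k g (x, y, l).
have sl k : 0 < (s k).2 /\ ~ P (s k).1.1 (s k).1.2 (s k).2.
  elim: k => [|k [IH1 IH2]]//=.
  by have [h1 h2 _ _] := gP _ IH1 IH2; split=> //; rewrite h2 divr_gt0.
have sS k : [/\ (s k.+1).2 = (s k).2 / 2,
      (s k).1.1 <= (s k.+1).1.1 /\ (s k.+1).1.1 + (s k.+1).2 <= (s k).1.1 + (s k).2 &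
      (s k).1.2 <= (s k.+1).1.2 /\ (s k.+1).1.2 + (s k.+1).2 <= (s k).1.2 + (s k).2].
  by have [h1 h2] := sl k; have [] := gP _ h1 h2.
have s2 k : (s k).2 = l / 2 ^+ k.
  elim: k => [|k IH]; first by rewrite expr0 divr1.
  by have [-> _ _] := sS k; rewrite IH exprSr invfM mulrA.
have mono k j : [/\ (s k).1.1 <= (s (j + k)%N).1.1,
   (s (j + k)%N).1.1 + (s (j + k)%N).2 <= (s k).1.1 + (s k).2,
   (s k).1.2 <= (s (j + k)%N).1.2 &
   (s (j + k)%N).1.2 + (s (j + k)%N).2 <= (s k).1.2 + (s k).2].
  elim: j => [|j [h1 h2 h3 h4]]; first by rewrite add0n.
  rewrite addSn; have [_ [e1 e2] [e3 e4]] := sS (j + k)%N.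
  split; [exact: le_trans e1|exact: le_trans h2|exact: le_trans e3|exact: le_trans h4].
have crossx k j : (s k).1.1 <= (s j).1.1 + (s j).2.
  have [h1 _ _ _] := mono k j; have [_ h2 _ _] := mono j k.
  rewrite addnC in h2; have := (sl (j + k)%N).1; lra.
have crossy k j : (s k).1.2 <= (s j).1.2 + (s j).2.
  have [_ _ h1 _] := mono k j; have [_ _ _ h2] := mono j k.
  rewrite addnC in h2; have := (sl (j + k)%N).1; lra.
(* Every left or lower end lies below every right or upper end, so these suprema give a point common
   to all the squares. *)
pose u := sup (range (fun k => (s k).1.1)).
pose v := sup (range (fun k => (s k).1.2)).
have uP k : (s k).1.1 <= u <= (s k).1.1 + (s k).2.
  apply/andP; split.
    apply: ub_le_sup; last by exists k.
    by exists ((s 0).1.1 + (s 0).2) => _ [j _ <-]; exact: crossx.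
  apply: ge_sup; first by exists (s 0).1.1; exists 0%N.
  by move=> _ [j _ <-]; exact: crossx.
have vP k : (s k).1.2 <= v <= (s k).1.2 + (s k).2.
  apply/andP; split.
    apply: ub_le_sup; last by exists k.
    by exists ((s 0).1.2 + (s 0).2) => _ [j _ <-]; exact: crossy.
  apply: ge_sup; first by exists (s 0).1.2; exists 0%N.
  by move=> _ [j _ <-]; exact: crossy.
have [d d0 dP] := Ploc u v (uP 0%N) (vP 0%N).
have [k kd] := exists_half_lt l d0.
have [h1 h2] := sl k; have [m1 m2 m3 m4] := mono 0%N k; rewrite addn0 in m1 m2 m3 m4.
by apply: h2; apply: dP => //; rewrite s2.
Qed.

Variable f : R[i] -> R[i].
Local Notation C := R[i].

(* Riemann sums for [f dz] on the boundary of a square with lower left corner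
   [x + iy] and side [l].  Opposite sides are sampled at facing points, so that
   the sums are exactly additive under bisection and vanish on affine functions. *)
Definition hsum n x y l : C :=
  (l / 2 ^+ n)%:C%C * \sum_(k < 2 ^ n) f (Complex (x + k%:R * (l / 2 ^+ n)) y).
Definition vsum n x y l : C :=
  (l / 2 ^+ n)%:C%C * \sum_(k < 2 ^ n) f (Complex x (y + k%:R * (l / 2 ^+ n))).
Definition sqsum n x y l : C :=
  hsum n x y l - hsum n x (y + l) l + 'i%C * vsum n (x + l) y l - 'i%C * vsum n x y l.

Lemma hsumS n x y l : hsum n.+1 x y l = hsum n x y (l / 2) + hsum n (x + l / 2) y (l / 2).
Proof.
rewrite /hsum exprS invfM mulrA -mulrDr; congr (_ * _).
have -> : (2 ^ n.+1 = 2 ^ n + 2 ^ n)%N by rewrite expnS mul2n addnn.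
rewrite big_split_ord /=; congr (_ + _); apply: eq_bigr => k _ //.
congr (f (Complex _ _)); rewrite natrD natrX mulrDl -addrA addrA.
by rewrite [2 ^+ n * _]mulrC mulfVK ?expf_neq0 ?addrA.
Qed.

Lemma vsumS n x y l : vsum n.+1 x y l = vsum n x y (l / 2) + vsum n x (y + l / 2) (l / 2).
Proof.
rewrite /vsum exprS invfM mulrA -mulrDr; congr (_ * _).
have -> : (2 ^ n.+1 = 2 ^ n + 2 ^ n)%N by rewrite expnS mul2n addnn.
rewrite big_split_ord /=; congr (_ + _); apply: eq_bigr => k _ //.
congr (f (Complex _ _)); rewrite natrD natrX mulrDl -addrA addrA.
by rewrite [2 ^+ n * _]mulrC mulfVK ?expf_neq0 ?addrA.
Qed.

Lemma sqsumS n x y l : sqsum n.+1 x y l =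
  sqsum n x y (l / 2) + sqsum n (x + l / 2) y (l / 2)
  + sqsum n x (y + l / 2) (l / 2) + sqsum n (x + l / 2) (y + l / 2) (l / 2).
Proof.
rewrite /sqsum !hsumS !vsumS -!addrA -!splitr.
ring.
Qed.

End SquareSums.

(** * Goursat's estimate for boundary sums on squares *)

Section GoursatLemma.
Variable R : realType.
Implicit Types (x y l u v : R).
Local Notation C := R[i].
Implicit Types (f g : C -> C) (eps M : C).

Definition insq x y l (z : C) := x <= re z <= x + l /\ y <= im z <= y + l.
Definition bdsq x y l (z : C) := insq x y l z /\
  [\/ re z = x, re z = x + l, im z = y | im z = y + l].

Lemma ler_norm4 (a b c d A B D E : C) :
  `|a| <= A -> `|b| <= B -> `|c| <= D -> `|d| <= E ->
  `|a + b + c + d| <= A + B + D + E.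
Proof.
move=> aA bB cD dE; apply: le_trans (ler_normD _ _) _; apply: lerD dE.
apply: le_trans (ler_normD _ _) _; apply: lerD cD.
by apply: le_trans (ler_normD _ _) _; apply: lerD.
Qed.

Lemma grid_le (n : nat) l (k : 'I_(2 ^ n)) : 0 <= l ->
  0 <= k%:R * (l / 2 ^+ n) <= l.
Proof.
move=> l0; have h : 0 < (2 : R) ^+ n by rewrite exprn_gt0.
rewrite mulr_ge0 ?divr_ge0// ?(ltW h)//= mulrCA ler_piMr//.
by rewrite ler_pdivrMr// mul1r -natrX ler_nat ltnW.
Qed.

Lemma sqsumD f g n x y l :
  sqsum (fun z => f z + g z) n x y l = sqsum f n x y l + sqsum g n x y l.
Proof. by rewrite /sqsum /hsum /vsum !big_split /=; ring. Qed.

Lemma sqsumZ f (c : C) n x y l :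
  sqsum (fun z => c * f z) n x y l = c * sqsum f n x y l.
Proof. by rewrite /sqsum /hsum /vsum -!mulr_sumr; ring. Qed.

Lemma eq_sqsum f g n x y l : 0 < l ->
  (forall z, bdsq x y l z -> f z = g z) -> sqsum f n x y l = sqsum g n x y l.
Proof.
move=> l0 fg; rewrite /sqsum /hsum /vsum.
congr (_ * _ - _ * _ + _ * (_ * _) - _ * (_ * _)); apply: eq_bigr => k _;
  have /andP[h1 h2] := grid_le k (ltW l0); apply: fg; rewrite /bdsq /insq /=.
- by split; [split; lra | apply: Or43].
- by split; [split; lra | apply: Or44].
- by split; [split; lra | apply: Or42].
- by split; [split; lra | apply: Or41].
Qed.

Lemma norm_sqsum f n x y l M : 0 < l ->
  (forall z, bdsq x y l z -> `|f z| <= M) -> `|sqsum f n x y l| <= 4 * l%:C%C * M.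
Proof.
move=> l0 fM; have h : 0 < (2 : R) ^+ n by rewrite exprn_gt0.
have aux (F : 'I_(2 ^ n) -> C) : (forall k, `|F k| <= M) ->
    `|(l / 2 ^+ n)%:C%C * \sum_k F k| <= l%:C%C * M.
  move=> FM; rewrite normrM [`|_%:C%C|]ger0_norm ?ler0c ?divr_ge0 ?(ltW l0) ?(ltW h)//.
  apply: (@le_trans _ _ ((l / 2 ^+ n)%:C%C * (M *+ 2 ^ n))).
    rewrite ler_wpM2l ?ler0c ?divr_ge0 ?(ltW l0) ?(ltW h)//.
    apply: le_trans (ler_norm_sum _ _ _) _.
    apply: le_trans (ler_sum _ (fun k _ => FM k)) _.
    by rewrite sumr_const card_ord.
  have h2 : (2 ^ n)%:R != 0 :> C by rewrite pnatr_eq0 -lt0n expn_gt0.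
  have -> : (l / 2 ^+ n)%:C%C = l%:C%C / (2 ^ n)%:R :> C.
    by rewrite rmorphM fmorphV -natrX rmorph_nat.
  by rewrite -[M *+ _]mulr_natl mulrA mulfVK.
have i1 : `|'i%C : C| = 1 by rewrite normc_def /= expr0n expr1n add0r sqrtr1.
have -> : 4 * l%:C%C * M = l%:C%C * M + l%:C%C * M + l%:C%C * M + l%:C%C * M by ring.
rewrite /sqsum; apply: ler_norm4;
  rewrite ?normrN ?normrM ?i1 ?mul1r -?normrM; apply: aux => k;
  have /andP[h1 h2] := grid_le k (ltW l0); apply: fM; rewrite /bdsq /insq /=.
- by split; [split; lra | apply: Or43].
- by split; [split; lra | apply: Or44].
- by split; [split; lra | apply: Or42].
- by split; [split; lra | apply: Or41].
Qed.

Lemma sqsum_affine (a b : C) n x y l :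
  sqsum (fun z => a + b * z) n x y l = 0.
Proof.
rewrite /sqsum -addrA -mulrBr /hsum /vsum -!mulrBr -!sumrB.
rewrite (eq_bigr (fun=> - (b * l%:C%C * 'i%C))); last first.
  move=> k _; rewrite opprD addrACA subrr add0r -mulrBr -mulrA -mulrN; congr (_ * _).
  by apply/eqP; rewrite eq_complex /=; apply/andP; split; apply/eqP; ring.
rewrite [X in _ + _ * (_ * X)](eq_bigr (fun=> b * l%:C%C)); last first.
  move=> k _; rewrite opprD addrACA subrr add0r -mulrBr; congr (_ * _).
  by apply/eqP; rewrite eq_complex /=; apply/andP; split; apply/eqP; ring.
rewrite !sumr_const card_ord mulNrn -[b * _ * _ *+ _]mulr_natl -[b * _ *+ _]mulr_natl.
by ring.
Qed.

Lemma norm_le_ReIm (z : C) (M1 M2 : R) : `|re z| <= M1 -> `|im z| <= M2 -> `|z| <= (M1 + M2)%:C%C.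
Proof.
case: z => a b /= h1 h2; rewrite (_ : Complex a b = a%:C%C + 'i%C * b%:C%C); last first.
  by apply/eqP; rewrite eq_complex /=; apply/andP; split; apply/eqP; ring.
apply: le_trans (ler_normD _ _) _; rewrite rmorphD; apply: lerD.
  by rewrite normc_def /= expr0n addr0 sqrtr_sqr lecR.
by rewrite normrM !normc_def /= !expr0n expr1n /= add0r sqrtr1 mul1r addr0 sqrtr_sqr lecR.
Qed.

Definition cdiff f (z : C) := exists L : C, forall e : R, 0 < e ->
  exists2 d : R, 0 < d & forall w, `|w - z| < d%:C%C ->
    `|f w - f z - L * (w - z)| <= e%:C%C * `|w - z|.

(** The bound is proportional to the area, hence additive over the four quarters; near a point the
    affine part of [f] has sum 0 and only the remainder counts. An eventual bound over the levels
    replaces a limit, so that no integral has to be constructed. *)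
Lemma goursat f x y l : 0 < l -> (forall z, insq x y l z -> cdiff f z) ->
  forall e : R, 0 < e -> exists m, forall n, (m <= n)%N ->
    `|sqsum f n x y l| <= (e * l ^+ 2)%:C%C.
Proof.
move=> l0 fdiff e e0.
apply: (@cousin _ (fun x y l => exists m, forall n, (m <= n)%N ->
    `|sqsum f n x y l| <= (e * l ^+ 2)%:C%C) x y l l0).
  move=> {fdiff}x {}y {}l {}l0 [m1 h1] [m2 h2] [m3 h3] [m4 h4].
  exists (maxn (maxn m1 m2) (maxn m3 m4)).+1 => -[//|n]; rewrite ltnS !geq_max.
  move=> /andP[/andP[/h1{}h1 /h2{}h2] /andP[/h3{}h3 /h4{}h4]].
  rewrite sqsumS.
  have -> : e * l ^+ 2 = e * (l / 2) ^+ 2 + e * (l / 2) ^+ 2 + e * (l / 2) ^+ 2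
     + e * (l / 2) ^+ 2 by field.
  rewrite !rmorphD /=.
  exact: ler_norm4.
move=> u v hu hv; have [L hL] := fdiff (Complex u v) (conj hu hv).
(* A square of side [l'] containing [(u, v)] lies within [2 l'] of it, hence within [d] when
   [l' < d / 4]; its sum is at most [4 l' * (e / 8) * 2 l' = e l'^2]. *)
have [d d0 dP] := hL (e / 8) (divr_gt0 e0 (ltr0n _ 8)).
exists (d / 4) => [|x' y' l' l'0 l'd h1 h2 h3 h4 h5 h6]; first by rewrite divr_gt0.
exists 0%N => n _.
pose z0 : C := Complex u v.
have zz z : insq x' y' l' z -> `|z - z0| <= (l' + l')%:C%C.
  move=> [/andP[a1 a2] /andP[a3 a4]].
  have /andP[a5 a6] := h5; have /andP[a7 a8] := h6.
  by apply: norm_le_ReIm; case: z a1 a2 a3 a4 => p q /= a1 a2 a3 a4;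
   rewrite ler_norml; apply/andP; split; lra.
have -> : sqsum f n x' y' l' = sqsum (fun w => f w - f z0 - L * (w - z0)) n x' y' l'.
  rewrite [RHS](@eq_sqsum _ (fun w => f w + ((L * z0 - f z0) + (- L) * w)))//.
    by rewrite sqsumD sqsum_affine addr0.
  by move=> z _; ring.
apply: le_trans (@norm_sqsum _ n x' y' l' ((e / 8)%:C%C * (l' + l')%:C%C) l'0 _) _.
  move=> z [zin _]; apply: le_trans (dP z _) _.
    by apply: le_lt_trans (zz _ zin) _; rewrite ltcR; lra.
  by rewrite ler_wpM2l ?zz// ler0c divr_ge0// (ltW e0).
have -> : 4 * l'%:C%C * ((e / 8)%:C%C * (l' + l')%:C%C) = (e * l' ^+ 2)%:C%C :> C.
  rewrite -(rmorph_nat (real_complex R) 4) -!rmorphM /=; by congr (_ %:C)%C; field.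
exact: lexx.
Qed.

End GoursatLemma.

(** * First-order expansions and their calculus *)

Section ComplexDifferentiability.
Variable R : realType.
Local Notation C := R[i].
Implicit Types (f g : C -> C) (z w : C).

Lemma gt0_realC (e : C) : 0 < e -> exists2 d : R, 0 < d & e = d%:C%C.
Proof.
case: e => a b; rewrite ltcE /= => /andP[/eqP -> a0]; by exists a.
Qed.

Lemma derivable_cdiff f z : derivable (f : C^o -> C^o) z 1 -> cdiff f z.
Proof.
move=> /cvg_ex[L /cvgrPdist_le fL]; exists L => e e0.
have e0' : 0 < e%:C%C :> C by rewrite ltcR.
have [d /= d0 dP] := fL _ e0'.
have [r r0 dr] := gt0_realC d0; exists r => // w wz.
have [->|wNz] := eqVneq w z; first by rewrite !subrr normr0 !mulr0 subrr normr0.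
have wz0 : w - z != 0 by rewrite subr_eq0.
have := dP (w - z); rewrite /ball_ /= sub0r normrN dr => /(_ wz wz0).
have -> : (w - z)%:A = w - z :> C^o by exact: mulr1.
rewrite subrK.
move=> h; rewrite -[leLHS]mul1r -(mulfV (_ : `|w - z| != 0)) ?normr_eq0//.
rewrite [leRHS]mulrC -mulrA ler_wpM2l// -normfV -normrM.
apply: le_trans h; rewrite -normrN opprB.
by rewrite mulrBr [_ * (L * _)]mulrCA mulVf// mulr1.
Qed.

Lemma cdiff_derivable f z : cdiff f z -> derivable (f : C^o -> C^o) z 1.
Proof.
move=> [L fL]; apply/cvg_ex; exists L; apply/cvgrPdist_le => e e0.
have [r r0 er] := gt0_realC e0; have [d d0 dP] := fL _ r0.
exists d%:C%C; first by rewrite /= ltcR.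
move=> h; rewrite /ball_ /= sub0r normrN => hd h0.
have -> : h%:A = h :> C^o by exact: mulr1.
have := dP (h + z); rewrite addrK => /(_ hd).
rewrite -er => H; rewrite -normrN opprB.
have -> : h^-1 *: (f (h + z) - f z : C^o) - L = h^-1 * (f (h + z) - f z - L * h) :> C.
  by rewrite [RHS]mulrBr [h^-1 * (L * h)]mulrCA mulVf// mulr1.
by rewrite normrM normfV ler_pdivrMl ?normr_gt0// [leRHS]mulrC.
Qed.

Lemma cdiff_cst (c : C) z : cdiff (fun=> c) z.
Proof. by apply: derivable_cdiff; exact: derivable_cst. Qed.

Lemma cdiff_id z : cdiff id z.
Proof. by apply: derivable_cdiff; exact: derivable_id. Qed.

Lemma cdiffD f g z : cdiff f z -> cdiff g z -> cdiff (fun w => f w + g w) z.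
Proof.
move=> /cdiff_derivable df /cdiff_derivable dg.
by apply: derivable_cdiff; exact: derivableD.
Qed.

Lemma cdiffB f g z : cdiff f z -> cdiff g z -> cdiff (fun w => f w - g w) z.
Proof.
move=> /cdiff_derivable df /cdiff_derivable dg.
by apply: derivable_cdiff; exact: derivableB.
Qed.

Lemma cdiffM f g z : cdiff f z -> cdiff g z -> cdiff (fun w => f w * g w) z.
Proof.
move=> /cdiff_derivable df /cdiff_derivable dg.
by apply: derivable_cdiff; exact: (@derivableM C C^o f g z 1 df dg).
Qed.

Lemma cdiffV f z : f z != 0 -> cdiff f z -> cdiff (fun w => (f w)^-1) z.
Proof.
move=> f0 /cdiff_derivable df.
by apply: derivable_cdiff; exact: (@derivableV C C^o f z 1 f0 df).
Qed.

Lemma cdiff_div f g z : g z != 0 -> cdiff f z -> cdiff g z ->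
  cdiff (fun w => f w / g w) z.
Proof. by move=> g0 df dg; apply: cdiffM => //; apply: cdiffV. Qed.

Lemma cdiffX f n z : cdiff f z -> cdiff (fun w => f w ^+ n) z.
Proof.
move=> df; elim: n => [|n IH]; first exact: cdiff_cst.
rewrite (_ : (fun w => _) = (fun w => f w * f w ^+ n)); first exact: cdiffM.
by apply/funext => w; rewrite exprS.
Qed.

Lemma cdiff_prod (I : Type) (s : seq I) (F : I -> C -> C) z :
  (forall i, cdiff (F i) z) -> cdiff (fun w => \prod_(i <- s) F i w) z.
Proof.
move=> dF; elim: s => [|i s IH].
  rewrite (_ : (fun w => _) = fun=> 1); first exact: cdiff_cst.
  by apply/funext => w; rewrite big_nil.
rewrite (_ : (fun w => _) = (fun w => F i w * \prod_(i <- s) F i w)).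
  exact: cdiffM.
by apply/funext => w; rewrite big_cons.
Qed.

Lemma cdiff_horner (p : {poly C}) z : cdiff (horner p) z.
Proof.
elim/poly_ind: p => [|p c IH].
  by rewrite (_ : horner 0 = fun=> 0); [exact: cdiff_cst|apply/funext => w; rewrite horner0].
rewrite (_ : horner _ = fun w => p.[w] * w + c).
  by apply: cdiffD; [apply: cdiffM => //; exact: cdiff_id|exact: cdiff_cst].
by apply/funext => w; rewrite hornerMXaddC.
Qed.

Definition cnorm z : R := re `|z|.

Lemma cnormE z : (cnorm z)%:C%C = `|z|.
Proof. by rewrite /cnorm RRe_real// normr_real. Qed.

Lemma cnorm_ge0 z : 0 <= cnorm z.
Proof. by rewrite -ler0c cnormE. Qed.

Lemma cdiff_lipschitz f z : cdiff f z -> exists2 K : R, 0 < K &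
  exists2 d : R, 0 < d & forall w, `|w - z| < d%:C%C ->
    `|f w - f z| <= K%:C%C * `|w - z|.
Proof.
move=> [L /(_ 1 ltr01)[d d0 dP]]; exists (1 + cnorm L).
  by rewrite ltr_pwDl// cnorm_ge0.
exists d => // w /dP; rewrite mul1r => h.
have -> : (1 + cnorm L)%:C%C * `|w - z| = `|w - z| + `|L * (w - z)|.
  by rewrite (rmorphD (real_complex R)) rmorph1 mulrDl mul1r /= cnormE normrM.
rewrite -[f w - f z](subrK (L * (w - z))).
by apply: le_trans (ler_normD _ _) _; rewrite lerD2r.
Qed.

Lemma cdiff_continuous f z : cdiff f z -> forall e : R, 0 < e ->
  exists2 d : R, 0 < d & forall w, `|w - z| < d%:C%C -> `|f w - f z| < e%:C%C.
Proof.
move=> /cdiff_lipschitz[K K0 [d d0 dP]] e e0.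
exists (Num.min d (e / K)) => [|w wz]; first by rewrite lt_min d0 divr_gt0.
have wd : `|w - z| < d%:C%C.
  by apply: lt_le_trans wz _; rewrite lecR ge_min lexx.
have we : `|w - z| < (e / K)%:C%C.
  by apply: lt_le_trans wz _; rewrite lecR ge_min lexx orbT.
apply: le_lt_trans (dP _ wd) _.
rewrite -(cnormE (w - z)) -rmorphM ltcR mulrC -ltr_pdivlMr//.
by rewrite -ltcR cnormE.
Qed.

Lemma eq_cdiff f g z (d : R) : 0 < d ->
  (forall w, `|w - z| < d%:C%C -> f w = g w) -> cdiff f z -> cdiff g z.
Proof.
move=> d0 fg [L fL]; exists L => e /fL[r r0 rP].
exists (Num.min d r) => [|w]; first by rewrite lt_min d0.
move=> h; have wd : `|w - z| < d%:C%C.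
  by apply: lt_le_trans h _; rewrite lecR ge_min lexx.
have wr : `|w - z| < r%:C%C.
  by apply: lt_le_trans h _; rewrite lecR ge_min lexx orbT.
by rewrite -!fg ?rP// subrr normr0 ltcR.
Qed.

End ComplexDifferentiability.

(** * A Cauchy estimate at the centre of a square *)

Section MaxModulusSquare.
Variable R : realType.
Local Notation C := R[i].
Implicit Types (f g : C -> C) (z w : C) (x y l m e M : R).

(* The squares of a 4 x 4 subdivision that avoid the centre. *)
Definition rim : seq (nat * nat) :=
  [seq p <- [seq (i, j) | i <- iota 0 4, j <- iota 0 4] |
    ~~ ((0 < p.1 < 3)%N && (0 < p.2 < 3)%N)].

Lemma sqsum_peel f n x y m : sqsum f n.+2 x y (4 * m) =
  sqsum f n.+1 (x + m) (y + m) (2 * m) +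
  \sum_(p <- rim) sqsum f n (x + p.1%:R * m) (y + p.2%:R * m) m.
Proof.
rewrite !big_cons big_nil /=.
have m4 : 4 * m / 2 = 2 * m by field.
have m2 : 2 * m / 2 = m by field.
rewrite !sqsumS m4 m2.
have e0 a : a + 0%:R * m = a by rewrite mul0r addr0.
have e1 a : a + 1%:R * m = a + m by rewrite mul1r.
have e2 a : a + m + m = a + 2 * m by ring.
have e3 a : a + 2 * m + m = a + 3 * m by ring.
rewrite !e0 !e1 !e2 !e3.
ring.
Qed.

Lemma eventually_sum (I : eqType) (s : seq I) (F : nat -> I -> C) (e : C) :
  (forall p, p \in s -> exists k, forall n, (k <= n)%N -> `|F n p| <= e) ->
  exists k, forall n, (k <= n)%N -> `|\sum_(p <- s) F n p| <= e *+ size s.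
Proof.
elim: s => [|p s IH] h.
  by exists 0%N => n _; rewrite big_nil normr0 mulr0n.
have [k1 h1] := h p (mem_head _ _).
have [|k2 h2] := IH; first by move=> q qs; apply: h; rewrite inE qs orbT.
exists (maxn k1 k2) => n; rewrite geq_max => /andP[/h1{}h1 /h2{}h2].
by rewrite big_cons mulrS; apply: le_trans (ler_normD _ _) _; exact: lerD.
Qed.

(** Contour deformation around a singular centre: Goursat's estimate applies to each rim square, and
    the four central squares recombine into one. *)
Lemma sqsum_halve f u v m : 0 < m ->
  (forall z, insq (u - 2 * m) (v - 2 * m) (4 * m) z -> z != Complex u v -> cdiff f z) ->
  forall e, 0 < e -> exists k, forall n, (k <= n)%N ->
  `|sqsum f n.+1 (u - 2 * m) (v - 2 * m) (4 * m) - sqsum f n (u - m) (v - m) (2 * m)| <= e%:C%C.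
Proof.
move=> m0 df e e0.
have [k kP] : exists k, forall n, (k <= n)%N ->
  `|\sum_(p <- rim) sqsum f n (u - 2 * m + p.1%:R * m) (v - 2 * m + p.2%:R * m) m|
   <= (e / 12)%:C%C *+ size rim.
  apply: eventually_sum => p prim.
  have := @goursat _ f (u - 2 * m + p.1%:R * m) (v - 2 * m + p.2%:R * m) m m0.
  (* Goursat's bound is relative to the area [m^2], and the rim consists of 12 squares. *)
  move=> /(_ _ (e / 12 / m ^+ 2)) [||k kP].
  - move=> [a b] [/= h1 h2]; apply: df.
    + move: prim; rewrite mem_filter => /andP[_ /allpairsP[[i j]]] /= [].
      move=> i4 j4 pE; rewrite pE /= in h1 h2.
      have {}i4 : (i < 4)%N by move: i4; rewrite !inE => /or4P[]/eqP->.
      have {}j4 : (j < 4)%N by move: j4; rewrite !inE => /or4P[]/eqP->.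
      have i3 : i%:R <= 3 :> R by rewrite (ler_nat _ _ 3).
      have j3 : j%:R <= 3 :> R by rewrite (ler_nat _ _ 3).
      have i0 : 0 <= i%:R :> R by [].
      have j0 : 0 <= j%:R :> R by [].
      by split => /=; apply/andP; split; nra.
    + move: prim; rewrite mem_filter => /andP[pin _].
      apply: contra pin; rewrite eq_complex /= => /andP[/eqP ae /eqP be]; subst a b.
      have aux (i : nat) t : t - 2 * m + i%:R * m <= t <= t - 2 * m + i%:R * m + m ->
          (0 < i < 3)%N.
        move=> /andP[k1 k2].
        have k3 : (1 : R) <= i%:R by rewrite -(ler_pM2r m0); lra.
        have k4 : i%:R <= (2 : R) by rewrite -(ler_pM2r m0); lra.
        by rewrite (ler_nat _ 1) in k3; rewrite (ler_nat _ _ 2) in k4; rewrite k3.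
      by rewrite (aux _ _ h1) (aux _ _ h2).
  - by rewrite !divr_gt0// exprn_gt0.
  - by exists k => n /kP; rewrite mulfVK// expf_neq0// gt_eqF.
exists k.+1 => -[//|n]; rewrite ltnS => /kP h.
rewrite sqsum_peel (_ : u - 2 * m + m = u - m); last by ring.
rewrite (_ : v - 2 * m + m = v - m); last by ring.
rewrite addrC addKr; apply: le_trans h _.
rewrite (_ : size rim = 12)// -(rmorphMn (real_complex R)) lecR.
by rewrite -[(e / 12) *+ 12]mulr_natr mulfVK// pnatr_eq0.
Qed.

Lemma sqsum_shrink f u v h : 0 < h ->
  (forall z, insq (u - h) (v - h) (2 * h) z -> z != Complex u v -> cdiff f z) ->
  forall j e, 0 < e -> exists k, forall n, (k <= n)%N ->
  `|sqsum f (n + j) (u - h) (v - h) (2 * h) -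
    sqsum f n (u - h / 2 ^+ j) (v - h / 2 ^+ j) (2 * (h / 2 ^+ j))| <= e%:C%C.
Proof.
move=> h0 df; elim=> [|j IH] e e0.
  exists 0%N => n _; rewrite addn0 expr0 divr1 subrr normr0 ler0c ltW//.
have [k1 h1] := IH (e / 2) (divr_gt0 e0 (ltr0n _ 2)).
pose m := h / 2 ^+ j.+1.
have m0 : 0 < m by rewrite divr_gt0 ?exprn_gt0.
have p0 : 2 ^+ j != 0 :> R by rewrite expf_neq0.
have mE : h / 2 ^+ j = 2 * m by rewrite /m exprS; field.
have mh : 2 * m <= h.
  by rewrite -mE ler_pdivrMr ?exprn_gt0// ler_peMr ?(ltW h0)// exprn_ege1// ler1n.
have [|k2 h2] := @sqsum_halve f u v m m0 _ (e / 2) (divr_gt0 e0 (ltr0n _ 2)).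
  move=> z [/andP[a1 a2] /andP[a3 a4]]; apply: df.
  by split; apply/andP; split; lra.
exists (maxn k1 k2) => n; rewrite geq_max => /andP[kn1 kn2].
have := h1 n.+1 (leqW kn1); have := h2 n kn2; rewrite mE => b2 b1.
rewrite addnS -addSn; move: b1.
rewrite (_ : 2 * (2 * m) = 4 * m) => [b1|]; last by ring.
have -> : e = e / 2 + e / 2 by field.
rewrite (rmorphD (real_complex R)).
apply: le_trans (lerD b1 b2); apply: le_trans (ler_normD _ _).
by rewrite addrA subrK.
Qed.

Lemma bdsq_center u v h z : 0 < h -> bdsq (u - h) (v - h) (2 * h) z ->
  h%:C%C <= `|z - Complex u v|.
Proof.
move=> h0; case: z => a b [[/= /andP[a1 a2] /andP[b1 b2]] hz].
rewrite normc_def /= lecR; have [ah|bh] : h <= `|a - u| \/ h <= `|b - v|.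
- case: hz => ->; [left|left|right|right]; rewrite ler_normr; apply/orP; [right|left|right|left]; lra.
- apply: le_trans ah _; rewrite -sqrtr_sqr ler_sqrt ?addr_ge0 ?sqr_ge0//.
  by rewrite lerDl sqr_ge0.
- apply: le_trans bh _; rewrite -sqrtr_sqr ler_sqrt ?addr_ge0 ?sqr_ge0//.
  by rewrite lerDr sqr_ge0.
Qed.

Lemma im_sum (I : Type) (s : seq I) (F : I -> C) :
  im (\sum_(i <- s) F i) = \sum_(i <- s) im (F i).
Proof. exact: (raddf_sum (@complex.Im R : Rcomplex R -> R)). Qed.

Lemma im_realM a (w : C) : im (a%:C%C * w) = a * im w.
Proof. by case: w => p q /=; rewrite mul0r addr0. Qed.

Lemma im_imM (w : C) : im ('i%C * w) = re w.
Proof. by case: w => p q /=; rewrite mul0r mul1r add0r. Qed.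

Lemma re_realM a (w : C) : re (a%:C%C * w) = a * re w.
Proof. by case: w => p q /=; rewrite mul0r subr0. Qed.

Lemma re_sum (I : Type) (s : seq I) (F : I -> C) :
  re (\sum_(i <- s) F i) = \sum_(i <- s) re (F i).
Proof. exact: (raddf_sum (@complex.Re R : Rcomplex R -> R)). Qed.

(** A crude substitute for the value [2 pi i]: along each side, of length [2 h], the imaginary part
    has density [h / (h^2 + a^2) >= 1 / (2 h)] because [|a| <= h]. Each of the four sides
    contributes at least 1, at every level. *)
Lemma cauchy_kernel_lb n u v h : 0 < h ->
  4%:R%:C%C <= `|sqsum (fun w => (w - Complex u v)^-1) n (u - h) (v - h) (2 * h)|.
Proof.
move=> h0.
suff H : 4 <= im (sqsum (fun w => (w - Complex u v)^-1) n (u - h) (v - h) (2 * h)).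
  set s := sqsum _ _ _ _ _ in H *.
  apply: (@le_trans _ _ `|im s|%:C%C).
    by rewrite lecR; apply: le_trans H _; exact: ler_norm.
  by rewrite normc_def lecR -sqrtr_sqr ler_sqrt ?addr_ge0 ?sqr_ge0// lerDr sqr_ge0.
have h2 : 0 < 2 * h by rewrite mulr_gt0.
have P2 : 0 < (2 : R) ^+ n by rewrite exprn_gt0.
have aux (F : 'I_(2 ^ n) -> R) : (forall k, (2 * h)^-1 <= F k) ->
   1 <= 2 * h / 2 ^+ n * \sum_k F k.
  move=> hF; apply: (@le_trans _ _ (2 * h / 2 ^+ n * ((2 * h)^-1 *+ 2 ^ n))).
    rewrite -[_ *+ (2 ^ n)]mulr_natl natrX mulrA mulfVK ?gt_eqF// mulfV ?gt_eqF//.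
  rewrite ler_wpM2l ?divr_ge0 ?(ltW h2) ?(ltW P2)//.
  by rewrite -[X in _ *+ X]card_ord -sumr_const ler_sum.
have ineq (a : R) : - h <= a <= h -> (2 * h)^-1 <= h / (h ^+ 2 + a ^+ 2).
  move=> /andP[a1 a2]; have d0 : 0 < h ^+ 2 + a ^+ 2 by rewrite ltr_pwDl ?exprn_gt0 ?sqr_ge0.
  rewrite ler_pdivlMr// ler_pdivrMl//; nra.
rewrite /sqsum /hsum /vsum.
have imD (p q : C) : im (p + q) = im p + im q by case: p => ? ?; case: q.
have imN (p : C) : im (- p) = - im p by case: p.
rewrite !imD !imN !im_imM !im_realM !re_realM !im_sum !re_sum.
have -> : (4 : R) = 1 + 1 + 1 + 1 by ring.
rewrite -!mulrN -!sumrN; repeat (apply: lerD); apply: aux => k;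
  have /andP[k1 k2] := grid_le k (ltW h2); move: k1 k2; set t := _%:R * _ => k1 k2 /=.

all: have th : - h <= t - h <= h by apply/andP; split; lra.
all: apply: le_trans (ineq _ th) _.
all: have e1 a : a - h - a = - h by ring.
all: have e2 a : a - h + 2 * h - a = h by ring.
all: have e3 a : a - h + t - a = t - h by ring.
all: rewrite ?e1 ?e2 ?e3 ?sqrrN ?mulNr ?opprK//.
all: by rewrite [(t - h) ^+ 2 + _]addrC.
Qed.

Lemma le_of_le_addM (a b : R) (K : R) : 0 < K -> (forall e, 0 < e -> a <= b + K * e) -> a <= b.
Proof.
move=> K0 h; apply/ler_addgt0Pr => e e0.
by have := h (e / K) (divr_gt0 e0 K0); rewrite mulrCA mulfV ?mulr1// gt_eqF.
Qed.

(** Cauchy's formula with crude constants: the large square contributes at most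
    [8 h * (M / h) = 8 M], and a small one is close to [f z0] times a number of modulus at least 4,
    whence [8 / 4]. *)
Lemma weak_max2 f u v h M : 0 < h -> 0 <= M ->
  (forall z, insq (u - h) (v - h) (2 * h) z -> cdiff f z) ->
  (forall z, bdsq (u - h) (v - h) (2 * h) z -> `|f z| <= M%:C%C) ->
  `|f (Complex u v)| <= (2 * M)%:C%C.
Proof.
move=> h0 M0 df fM; set z0 := Complex u v.
pose g w := f w * (w - z0)^-1.
have dg z : insq (u - h) (v - h) (2 * h) z -> z != z0 -> cdiff g z.
  move=> zin zz0; apply: cdiffM; first exact: df.
  by apply: cdiffV; [rewrite subr_eq0|apply: cdiffB; [exact: cdiff_id|exact: cdiff_cst]].
rewrite -cnormE lecR.
(* Of the [9 e], [8 e] comes from freezing [f] at [z0] on the small square and [e] from passing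
   between the squares. *)
suff H : forall e, 0 < e -> 4 * cnorm (f z0) <= 8 * M + 9 * e.
  rewrite -(ler_pM2l (_ : 0 < 4))// mulrA (_ : 4 * 2 = 8); last by ring.
  exact: (le_of_le_addM (K := 9)).
move=> e e0.
have z0in : insq (u - h) (v - h) (2 * h) z0.
  by split; apply/andP; split; rewrite /z0 /=; lra.
have [d d0 dP] := cdiff_continuous (df _ z0in) e0.
have [j jd] := exists_half_lt h (divr_gt0 d0 (ltr0n _ 2)).
have k0 : 0 < h / 2 ^+ j by rewrite divr_gt0// exprn_gt0.
have [n0 /(_ n0 (leqnn _))] := sqsum_shrink h0 dg j e0.
move: (h / 2 ^+ j) jd k0 => k jd k0 hn.
set Sb := sqsum g (n0 + j) _ _ _ in hn; set Ss := sqsum g n0 _ _ _ in hn.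
have h20 : 0 < 2 * h by rewrite mulr_gt0.
have k20 : 0 < 2 * k by rewrite mulr_gt0.
have c4 : (4 : C) = 4%:R%:C%C by rewrite (rmorph_nat (real_complex R)).
have bound w m (B : R) : 0 < m -> `|w| <= B%:C%C -> forall w', m%:C%C <= `|w'| ->
    `|w * w'^-1| <= (B / m)%:C%C.
  move=> m0 wB w' w'm; rewrite normrM normfV -!cnormE -fmorphV -rmorphM lecR.
  move: wB w'm; rewrite -!cnormE !lecR => wB w'm.
  apply: ler_pM => //; rewrite ?invr_ge0 ?cnorm_ge0//.
  by rewrite lef_pV2// posrE (lt_le_trans m0).
have Sb8 : `|Sb| <= (8 * M)%:C%C.
  apply: le_trans (@norm_sqsum _ g (n0 + j) _ _ _ (M / h)%:C%C h20 _) _.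
    move=> z zb; apply: bound => //; first exact: fM.
    exact: bdsq_center.
  rewrite c4 -!rmorphM lecR; rewrite le_eqVlt; apply/orP; left; apply/eqP; field; by rewrite gt_eqF.
have Ssf : `|Ss - f z0 * sqsum (fun w => (w - z0)^-1) n0 (u - k) (v - k) (2 * k)|
    <= (8 * e)%:C%C.
  rewrite -sqsumZ -mulN1r -sqsumZ -sqsumD.
  apply: le_trans (@norm_sqsum _ _ n0 _ _ _ (e / k)%:C%C k20 _) _.
    move=> z zb; rewrite mulN1r /g -mulrBl; apply: bound => //.
      apply/ltW/dP; case: z zb => a b [[/= /andP[a1 a2] /andP[b1 b2]] _].
      apply: le_lt_trans (@norm_le_ReIm _ _ k k _ _) _.
      - by rewrite /z0 /= ler_norml; apply/andP; split; lra.
      - by rewrite /z0 /= ler_norml; apply/andP; split; lra.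
      - by rewrite ltcR [ltRHS](splitr d) ltrD.
    exact: bdsq_center.
  rewrite c4 -!rmorphM lecR; rewrite le_eqVlt; apply/orP; left; apply/eqP; field; by rewrite gt_eqF.
have lb := cauchy_kernel_lb n0 u v k0; rewrite -/z0 in lb.
rewrite -lecR (_ : (4 * cnorm (f z0))%:C%C = 4%:R%:C%C * `|f z0|); last first.
  by rewrite -cnormE -rmorphM.
apply: (@le_trans _ _ `|f z0 * sqsum (fun w => (w - z0)^-1) n0 (u - k) (v - k) (2 * k)|).
  by rewrite normrM [leRHS]mulrC ler_wpM2r.
set T := f z0 * _ in Ssf *.
have -> : T = - (Ss - T) - (Sb - Ss) + Sb by ring.
have -> : 8 * M + 9 * e = 8 * e + e + 8 * M by ring.
rewrite !rmorphD /=; do 2 (apply: le_trans (ler_normD _ _) _; apply: lerD => //).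
  by rewrite normrN.
by rewrite normrN.
Qed.

(** By Bernoulli, the powers of a ratio [a / b > 1] would outgrow [K]. This discards constants from
    estimates valid for all powers. *)
Lemma le_of_expr (a b K : R) : 0 <= a -> 0 <= b ->
  (forall n, a ^+ n <= K * b ^+ n) -> a <= b.
Proof.
move=> a0 b0 h; rewrite leNgt; apply/negP => ba.
have [b_eq0|bN0] := eqVneq b 0.
  by have := h 1%N; rewrite !expr1 b_eq0 mulr0 leNgt -b_eq0 ba.
have bp : 0 < b by rewrite lt_neqAle eq_sym bN0.
pose d := a / b - 1; have d0 : 0 < d by rewrite subr_gt0 ltr_pdivlMr// mul1r.
have bern n : 1 + n%:R * d <= (1 + d) ^+ n.
  elim: n => [|n IH]; first by rewrite mul0r addr0 expr0.
  rewrite exprS; apply: (@le_trans _ _ ((1 + d) * (1 + n%:R * d))).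
    rewrite -natr1; have : 0 <= n%:R * d * d by rewrite !mulr_ge0// ltW.
    by lra.
  by rewrite ler_wpM2l// addr_ge0// ltW.
have hK n : (1 + d) ^+ n <= K.
  by rewrite addrC subrK expr_div_n ler_pdivrMr ?exprn_gt0.
have := truncnS_gt (K / d); rewrite ltr_pdivrMr// => kd.
by have := le_trans (bern _) (hK (Num.truncn (K / d)).+1); lra.
Qed.

(* The constant 2 disappears by applying the previous lemma to powers of [f]. *)
Lemma weak_max f u v h M : 0 < h -> 0 <= M ->
  (forall z, insq (u - h) (v - h) (2 * h) z -> cdiff f z) ->
  (forall z, bdsq (u - h) (v - h) (2 * h) z -> `|f z| <= M%:C%C) ->
  `|f (Complex u v)| <= M%:C%C.
Proof.
move=> h0 M0 df fM; rewrite -cnormE lecR.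
apply: (@le_of_expr _ _ 2) => // [|n]; first exact: cnorm_ge0.
rewrite -lecR rmorphXn /= cnormE -normrX.
apply: (@weak_max2 (fun w => f w ^+ n) u v h (M ^+ n)) => //.
- exact: exprn_ge0.
- by move=> z zin; apply: cdiffX; exact: df.
- move=> z /fM zM; rewrite normrX rmorphXn /=; apply: lerXn2r => //; rewrite nnegrE ?normr_ge0//.
  by rewrite ler0c.
Qed.

End MaxModulusSquare.

(** * The maximum principle on the disk *)

Section MaxModulus.
Variable R : realType.
Local Notation C := R[i].
Implicit Types (f g : C -> C) (z w : C) (e K M : R).

Lemma cnorm_sqr z : cnorm z ^+ 2 = re z ^+ 2 + im z ^+ 2.
Proof. by apply: (@complexI R); rewrite rmorphXn /= cnormE -add_Re2_Im2. Qed.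

Lemma cnormM z w : cnorm (z * w) = cnorm z * cnorm w.
Proof. by apply: (@complexI R); rewrite rmorphM /= !cnormE normrM. Qed.

Lemma cnormX z n : cnorm (z ^+ n) = cnorm z ^+ n.
Proof. by apply: (@complexI R); rewrite rmorphXn /= !cnormE normrX. Qed.

Lemma cnorm_lt1 z : (`|z| < 1) = (cnorm z < 1).
Proof. by rewrite -cnormE -(rmorph1 (real_complex R)) ltcR. Qed.

Lemma insq_near (L : R) z w : insq (re z - L) (im z - L) (2 * L) w ->
  `|w - z| <= (2 * L)%:C%C.
Proof.
move=> [/andP[a1 a2] /andP[b1 b2]]; rewrite mulr_natl mulr2n.
by apply: norm_le_ReIm; case: w a1 a2 b1 b2 => a b /=;
  case: z => p q /= a1 a2 b1 b2; rewrite ler_norml; apply/andP; split; lra.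
Qed.

(* At an almost maximal point [z] of [|g w| (1 + ep |w|^2)], the analytic function
   [g w (1 + ep (2 z^* w - |z|^2))] has a strict maximum on a small square: the
   second factor is the tangent of the first one at [z]. *)
Lemma max_modulus g M K : 0 <= M ->
  (forall z, `|z| < 1 -> cdiff g z) -> (forall z, `|z| < 1 -> `|g z| <= K%:C%C) ->
  (forall e, 0 < e -> exists2 r, r < 1 & forall z, r%:C%C < `|z| -> `|z| < 1 ->
     `|g z| <= (M + e)%:C%C) ->
  forall z, `|z| < 1 -> `|g z| <= M%:C%C.
Proof.
move=> M0 dg gK gM z1 z1D; rewrite -cnormE lecR leNgt; apply/negP => Mlt.
set s := cnorm (g z1) in Mlt.
(* Thirds, because near the circle [|g| <= M + d = s - 2 d] and the weight, with [ep * s <= d],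
   costs at most one more [d]; thus [Phi <= s - d < m] there. *)
pose d := (s - M) / 3; have d0 : 0 < d by rewrite divr_gt0// subr_gt0.
have sd : M + d = s - 2 * d by rewrite /d; field.
have s0 : 0 < s by apply: le_lt_trans Mlt.
have [r r1 hr] := gM d d0.
pose r' := Num.max r 0.
have r'1 : r' < 1 by rewrite gt_max r1 ltr01.
have r'0 : 0 <= r' by rewrite le_max lexx orbT.
pose ep := Num.min (1 / 2) (d / s).
have ep0 : 0 < ep by rewrite lt_min; apply/andP; split; rewrite divr_gt0.
have ep2 : ep <= 1 / 2 by rewrite ge_min lexx.
have eps : ep * s <= d by rewrite -ler_pdivlMr// ge_min lexx orbT.
pose Phi z := cnorm (g z) * (1 + ep * cnorm z ^+ 2).
have one_ep z : `|z| < 1 -> 1 <= 1 + ep * cnorm z ^+ 2 <= 1 + ep.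
  rewrite cnorm_lt1 => zD; rewrite lerDl mulr_ge0 ?sqr_ge0 ?(ltW ep0)//=.
  by rewrite lerD2l ler_piMr ?(ltW ep0)// expr_le1 ?cnorm_ge0// (ltW zD).
have far z : r' < cnorm z -> `|z| < 1 -> Phi z <= s - d.
  move=> rz zD; have /andP[h1 h2] := one_ep z zD.
  have gz : cnorm (g z) <= s - 2 * d.
    rewrite -sd -lecR cnormE; apply: hr => //.
    by rewrite -cnormE ltcR; apply: le_lt_trans rz; rewrite le_max lexx.
  have := cnorm_ge0 (g z); rewrite /Phi => g0.
  apply: (@le_trans _ _ ((s - 2 * d) * (1 + ep))).
    by apply: ler_pM => //; lra.
  nra.
pose A := [set Phi z | z in [set z | `|z| < 1]].
have Aub : has_ubound A.
  exists (K * (1 + ep)) => _ [z zD <-].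
  have /andP[h1 h2] := one_ep z zD; apply: ler_pM => //; rewrite ?cnorm_ge0//; first by lra.
  by rewrite -lecR cnormE; apply: gK.
have A0 : A !=set0 by exists (Phi z1), z1.
pose m := sup A.
have Am z : `|z| < 1 -> Phi z <= m by move=> zD; apply: ub_le_sup => //; exists z.
have sm : s <= m.
  apply: le_trans (Am z1 z1D); have /andP[h1 h2] := one_ep z1 z1D.
  by rewrite /Phi -/s ler_peMr// (ltW s0).
(* The almost maximal point will satisfy [|z| <= r'], and the square of half-side [L] around it lies
   within [2 L] of it, hence in the disk. *)
pose L := (1 - r') / 4; have L0 : 0 < L by rewrite divr_gt0// subr_gt0.
have Lr : r' + 2 * L < 1 by rewrite /L; lra.
(* The squared modulus of the tangent factor falls short of [(1 + ep |w|^2)^2] by at least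
   [k |w - z|^2]; [c] is the resulting relative loss on the border of the square, where
   [|w - z| >= L] and [|w| < 1]. *)
pose k := 2 * ep - 2 * ep ^+ 2.
have k0 : 0 < k by rewrite /k; nra.
pose c := k * L ^+ 2 / (1 + ep) ^+ 2.
have e1 : 0 < 1 + ep by lra.
have c0 : 0 < c by rewrite divr_gt0 ?exprn_gt0// mulr_gt0// exprn_gt0.
have m0 : 0 < m by apply: lt_le_trans sm.
(* Maximal up to half the loss: [(1 - c / 2)^2 > 1 - c] will contradict the bound [m^2 (1 - c)]
   obtained from the square. *)
have : Num.max (m * (1 - c / 2)) (s - d) < m.
  rewrite gt_max; apply/andP; split; last by lra.
  by rewrite gtr_pMr// gtrBl divr_gt0.
move=> /(sup_gt A0)[_ [z zD <-]]; rewrite gt_max => /andP[z1' z2].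
have zr : cnorm z <= r'.
  by rewrite leNgt; apply/negP => /far/(_ zD); rewrite leNgt z2.
have c1 : c <= 1.
  rewrite ler_pdivrMr ?exprn_gt0// mul1r.
  have : L ^+ 2 <= 1 by rewrite expr_le1 ?(ltW L0)//; rewrite /L; lra.
  have := sqr_ge0 L; rewrite /k; nra.
have contra : Phi z ^+ 2 <= m ^+ 2 * (1 - c).
  pose F w := (g w * (1 + ep%:C%C * (2 * z^* * w - z * z^*))) ^+ 2.
  have Fz : cnorm (F z) = Phi z ^+ 2.
    rewrite /F cnormX cnormM /Phi; congr ((_ * _) ^+ 2).
    rewrite (_ : 1 + _ = (1 + ep * cnorm z ^+ 2)%:C%C).
      apply: (@complexI R); rewrite cnormE ger0_norm// ler0c addr_ge0// mulr_ge0 ?sqr_ge0//.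
      exact: ltW.
    rewrite rmorphD rmorphM rmorphXn /= cnormE normCK rmorph1.
    by congr (_ + _ * _); ring.
  have m2 : 0 <= m ^+ 2 * (1 - c) by rewrite mulr_ge0 ?sqr_ge0// subr_ge0.
  rewrite -Fz -lecR cnormE; case zE : z => [p q]; rewrite -zE.
  have zpq : z = Complex (re z) (im z) by case: (z).
  have near w : insq (re z - L) (im z - L) (2 * L) w -> `|w| < 1.
    move=> /insq_near wz; rewrite -[w](subrK z).
    apply: le_lt_trans (ler_normD _ _) _.
    apply: (@le_lt_trans _ _ (2 * L + r')%:C%C).
      by rewrite rmorphD lerD//= -cnormE lecR.
    by rewrite -(rmorph1 (real_complex R)) ltcR addrC.
  rewrite {1}zpq; apply: (@weak_max _ F (re z) (im z) L) => // w.
    move=> /near wD; apply: cdiffX; apply: cdiffM; first exact: dg.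
    apply: cdiffD; first exact: cdiff_cst.
    apply: cdiffM; first exact: cdiff_cst.
    apply: cdiffB; last exact: cdiff_cst.
    by apply: cdiffM; [exact: cdiff_cst|exact: cdiff_id].
  move=> wb; have wD := near _ wb.1.
  have /andP[w1 w2] := one_ep w wD.
  have Lw := bdsq_center L0 wb; rewrite -zpq -cnormE lecR in Lw.
  rewrite -cnormE lecR /F cnormX cnormM exprMn.
  have key : cnorm (1 + ep%:C%C * (2 * z^* * w - z * z^*)) ^+ 2 <=
     (1 + ep * cnorm w ^+ 2) ^+ 2 - k * cnorm (w - z) ^+ 2.
    have z2le : cnorm z ^+ 2 <= 1 by rewrite expr_le1 ?cnorm_ge0//; apply: ltW; rewrite -cnorm_lt1.
    rewrite !cnorm_sqr in z2le *; rewrite /k.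
    clear - ep0 z2le; case: z z2le => p q; case: w => a b /= z2le.
    rewrite -subr_ge0.
    (* Here [H = |w - z|^2] and [T = |w|^2 - |z|^2]; the difference of the two sides is a sum of
       terms that are nonnegative because [|z| <= 1]. *)
    pose H := (a - p) ^+ 2 + (b - q) ^+ 2.
    pose T := 2 * (p * (a - p) + q * (b - q)) + H.
    rewrite [leRHS](_ : _ = 2 * ep ^+ 2 * (1 - (p ^+ 2 + q ^+ 2)) * H + (ep * T) ^+ 2).
      have e0 := sqr_ge0 ep; apply: addr_ge0 (sqr_ge0 _).
      apply: mulr_ge0; last by rewrite addr_ge0 ?sqr_ge0.
      by apply: mulr_ge0; [exact: mulr_ge0|rewrite subr_ge0].
    by rewrite /T /H; ring.
  apply: (@le_trans _ _ (Phi w ^+ 2 * (1 - c))); last first.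
    rewrite ler_wpM2r ?subr_ge0// ler_sqr ?nnegrE ?Am// ?(ltW m0)//.
    by rewrite mulr_ge0 ?cnorm_ge0// (le_trans ler01).
  apply: (@le_trans _ _ (cnorm (g w) ^+ 2 * ((1 + ep * cnorm w ^+ 2) ^+ 2 - k * L ^+ 2))).
    rewrite ler_wpM2l ?sqr_ge0//; apply: le_trans key _; rewrite lerD2l lerN2.
    by rewrite ler_wpM2l ?(ltW k0)// ler_sqr ?nnegrE ?cnorm_ge0// (ltW L0).
  have -> : Phi w ^+ 2 * (1 - c) =
      cnorm (g w) ^+ 2 * ((1 + ep * cnorm w ^+ 2) ^+ 2 * (1 - c)).
    by rewrite /Phi; clear; ring.
  rewrite ler_wpM2l ?sqr_ge0//.
  rewrite mulrBr mulr1 lerD2l lerN2 /c mulrA ler_pdivrMr ?exprn_gt0//.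
  have kL : 0 <= k * L ^+ 2 by apply: mulr_ge0; [exact: ltW|exact: sqr_ge0].
  rewrite [leLHS]mulrC ler_wpM2l//.
  by rewrite ler_sqr ?nnegrE ?(ltW e1)// (le_trans ler01).
have : (m * (1 - c / 2)) ^+ 2 < Phi z ^+ 2.
  by rewrite ltr_sqr ?nnegrE ?mulr_ge0 ?(ltW m0) ?cnorm_ge0//; [lra|have /andP[+ _] := one_ep z zD; lra].
move=> /lt_le_trans/(_ contra).
have := sqr_ge0 (m * c); nra.
Qed.

End MaxModulus.

(** * Finitely many exceptional points *)

Section ExceptionalPoints.
Variable R : realType.
Local Notation C := R[i].
Implicit Types (f g : C -> C) (z w : C) (e K M : R) (E : seq C).

(** Squared factors, so that the product with a bounded function has derivative 0 at each point of
    [E]; simple factors would only make it Lipschitz there. *)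
Definition vanish E z : C := \prod_(x <- E) (z - x) ^+ 2.

Lemma vanish_eq0 E z : (vanish E z == 0) = (z \in E).
Proof.
rewrite prodf_seq_eq0; apply/hasP/idP => [[x xE]|zE].
  by rewrite /= sqrf_eq0 subr_eq0 => /eqP->.
by exists z => //=; rewrite subrr expr0n.
Qed.

Lemma norm_vanish_le E z : `|z| < 1 -> (forall x, x \in E -> `|x| < 1) ->
  `|vanish E z| <= 4%:R ^+ size E.
Proof.
move=> zD; rewrite /vanish; elim: E => [|x E IH] ED.
  by rewrite big_nil normr1 expr0.
rewrite big_cons normrM /= [leRHS]exprS ler_pM//; last first.
  by apply: IH => y yE; apply: ED; rewrite inE yE orbT.
have xD := ED x (mem_head _ _).
have -> : 4 = 2 ^+ 2 :> C by rewrite expr2; ring.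
rewrite normrX lerXn2r ?nnegrE//; apply: le_trans (ler_normB _ _) _.
by have -> : 2 = 1 + 1 :> C by []; rewrite lerD// ltW.
Qed.

(* [vanish E * g ^ n] is differentiable at the points of [E] as well, whatever the
   values of [g] there; let [n] tend to infinity. *)
Lemma max_modulus_except g E M K : 0 <= M ->
  (forall x, x \in E -> `|x| < 1) ->
  (forall z, `|z| < 1 -> z \notin E -> cdiff g z) ->
  (forall z, `|z| < 1 -> z \notin E -> `|g z| <= K%:C%C) ->
  (forall e, 0 < e -> exists2 r, r < 1 & forall z, r%:C%C < `|z| -> `|z| < 1 ->
     z \notin E -> `|g z| <= (M + e)%:C%C) ->
  forall z, `|z| < 1 -> z \notin E -> `|g z| <= M%:C%C.
Proof.
move=> M0 ED dg gK gM z zD zE; rewrite -cnormE lecR; apply/ler_addgt0Pr => e e0.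
have Me : 0 < M + e by rewrite ltr_wpDl.
have K0 : 0 <= K by rewrite -ler0c (le_trans (normr_ge0 (g z))) ?gK.
have P0 : 0 < cnorm (vanish E z) by rewrite -ltcR cnormE normr_gt0 vanish_eq0.
have [k k0 [kE kE']] : exists2 k : R, 0 <= k &
    (forall w, `|w| < 1 -> `|vanish E w| <= k%:C%C) /\
    (forall w x, `|w| < 1 -> x \in E -> `|vanish (rem x E) w| <= k%:C%C).
  exists (4 ^+ size E); first by rewrite exprn_ge0.
  rewrite rmorphXn /= (rmorph_nat (real_complex R)).
  split=> [w wD|w x wD xE]; first exact: norm_vanish_le.
  apply: le_trans (norm_vanish_le wD _) _ => [y /mem_rem/ED//|].
  by rewrite size_rem// ler_weXn2l ?ler1n// leq_pred.
have [r r1 hr] := gM e e0.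
apply: (@le_of_expr _ _ _ (k / cnorm (vanish E z))); [exact: cnorm_ge0|exact: ltW|].
move=> n; rewrite mulrAC ler_pdivlMr// -cnormX mulrC -cnormM -lecR cnormE.
pose H w := vanish E w * g w ^+ n.
have bnd w B : 0 <= B -> `|w| < 1 -> (w \notin E -> `|g w| <= B%:C%C) -> `|H w| <= (k * B ^+ n)%:C%C.
  move=> B0 wD gB; have [wE|wE] := boolP (w \in E).
    rewrite /H (eqP (_ : vanish E w == 0)) ?vanish_eq0// mul0r normr0 ler0c.
    by rewrite mulr_ge0 ?exprn_ge0.
  rewrite normrM rmorphM rmorphXn /= ler_pM ?kE// normrX.
  by apply: lerXn2r; rewrite ?nnegrE ?normr_ge0 ?ler0c ?gB.
apply: (@max_modulus _ H _ (k * K ^+ n)) => //.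
- by rewrite mulr_ge0 ?exprn_ge0// ltW.
- move=> w wD; have [wE|wE] := boolP (w \in E); last first.
    apply: cdiffM; last by apply: cdiffX; apply: dg.
    apply: cdiff_prod => x; apply: cdiffX; apply: cdiffB; [exact: cdiff_id|exact: cdiff_cst].
  exists 0 => e' e'0; pose B := k * K ^+ n + 1.
  have B0 : 0 < B by rewrite ltr_wpDl// mulr_ge0// exprn_ge0.
  have wD' : 0 < 1 - cnorm w by rewrite subr_gt0 -cnorm_lt1.
  exists (Num.min (1 - cnorm w) (e' / B)) => [|v vw].
    by rewrite lt_min wD' divr_gt0.
  have vw1 : cnorm (v - w) < 1 - cnorm w.
    by rewrite -ltcR cnormE (lt_le_trans vw)// lecR ge_min lexx.
  have vw2 : cnorm (v - w) <= e' / B.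
    by rewrite -lecR cnormE (le_trans (ltW vw))// lecR ge_min lexx orbT.
  have vD : `|v| < 1.
    rewrite -[v](subrK w); apply: le_lt_trans (ler_normD _ _) _.
    by rewrite -!cnormE -rmorphD -(rmorph1 (real_complex R)) ltcR; lra.
  rewrite mul0r subr0 (_ : H w = 0) ?subr0; last first.
    by rewrite /H (eqP (_ : vanish E w == 0)) ?vanish_eq0// mul0r.
  have [vE|vE] := boolP (v \in E).
    rewrite /H (eqP (_ : vanish E v == 0)) ?vanish_eq0// mul0r normr0.
    by rewrite mulr_ge0// ler0c ltW.
  have -> : H v = (v - w) * ((v - w) * (vanish (rem w E) v * g v ^+ n)).
    by rewrite /H /vanish (perm_big _ (perm_to_rem wE)) big_cons /=; ring.
  rewrite normrM mulrC ler_wpM2r//.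
  apply: (@le_trans _ _ (e' / B * B)%:C%C); last by rewrite mulfVK ?gt_eqF.
  rewrite normrM rmorphM ler_pM//; first by rewrite -cnormE lecR.
  apply: (@le_trans _ _ (k * K ^+ n)%:C%C); last by rewrite lecR lerDl.
  rewrite normrM rmorphM rmorphXn /= ler_pM//.
    exact: kE'.
  by rewrite normrX; apply: lerXn2r; rewrite ?nnegrE ?normr_ge0 ?ler0c ?gK.
- by move=> w wD; apply: bnd => // wE; exact: gK.
- move=> e' e'0; exists r => // w rw wD.
  apply: (@le_trans _ _ (k * (M + e) ^+ n)%:C%C); last by rewrite lecR lerDl ltW.
  by apply: bnd => // [|wE]; [exact: ltW|exact: hr].
Qed.

End ExceptionalPoints.

(** * Pick's theorem *)

Section Pick.
Variable R : realType.
Local Notation C := R[i].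
Implicit Types (f g : C -> C) (z w : C) (E : seq C).

Lemma mobius_sqr (x y : C) :
  `|1 - x * y^*| ^+ 2 - `|x - y| ^+ 2 = (1 - `|x| ^+ 2) * (1 - `|y| ^+ 2).
Proof. by rewrite !normCK !rmorphB rmorphM rmorph1 /= conjCK; ring. Qed.

Lemma mobius_le (x y : C) : `|x| <= 1 -> `|y| <= 1 -> `|x - y| <= `|1 - x * y^*|.
Proof.
move=> x1 y1; rewrite -ler_sqr ?nnegrE// -subr_ge0 mobius_sqr.
by rewrite mulr_ge0// subr_ge0 expr_le1.
Qed.

Lemma norm_1subM_ge (x y : C) : `|x| <= 1 -> 1 - `|y| <= `|1 - x * y^*|.
Proof.
move=> x1; apply: le_trans (lerB_dist _ _); rewrite normr1 lerD2l lerN2.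
by rewrite normrM norm_conjC ler_piMl.
Qed.

(** The radius comes from [1 - |b|^2 = (1 - |z|^2) (1 - |a|^2) / |1 - z conj(a)|^2], with
    denominator at least [(1 - |a|)^2]: it makes the right side at most [d], that is
    [|b|^2 >= 1 / (1 + e)^2]. *)
Lemma bfactor_boundary (a : C) : `|a| < 1 -> forall e : R, 0 < e ->
  exists2 r : R, r < 1 & forall z, r%:C%C < `|z| -> `|z| < 1 ->
     1 <= (1 + e)%:C%C * `|bfactor a z|.
Proof.
move=> aD e e0; pose x := cnorm a.
have x0 : 0 <= x := cnorm_ge0 a.
have x1 : x < 1 by rewrite -cnorm_lt1.
pose d := 1 - ((1 + e) ^+ 2)^-1.
have d0 : 0 < d.
  by rewrite subr_gt0 invf_lt1 ?exprn_gt0 ?addr_gt0// exprn_egt1//; lra.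
exists (1 - d * (1 - x) ^+ 2 / 2).
  by rewrite gtrBl divr_gt0// mulr_gt0// exprn_gt0// subr_gt0.
move=> z; rewrite -!cnormE ltcR => rz; rewrite cnormE cnorm_lt1 => zD.
rewrite -rmorphM -(rmorph1 (real_complex R)) lecR.
have za : 1 - x <= cnorm (1 - z * a^*).
  rewrite -lecR rmorphB rmorph1 /= !cnormE norm_1subM_ge// -cnormE.
  by rewrite -(rmorph1 (real_complex R)) lecR ltW.
have za0 : 0 < cnorm (1 - z * a^*) by apply: lt_le_trans za; rewrite subr_gt0.
have bE : cnorm (bfactor a z) ^+ 2 =
    1 - (1 - cnorm z ^+ 2) * (1 - x ^+ 2) / cnorm (1 - z * a^*) ^+ 2.
  have -> : cnorm (bfactor a z) = cnorm (z - a) / cnorm (1 - z * a^*).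
    by apply: (@complexI R); rewrite rmorphM fmorphV /= !cnormE normrM normfV.
  have : cnorm (1 - z * a^*) ^+ 2 - cnorm (z - a) ^+ 2 = (1 - cnorm z ^+ 2) * (1 - x ^+ 2).
    apply: (@complexI R); rewrite rmorphM !rmorphB !rmorphXn !rmorph1 /= !cnormE.
    exact: mobius_sqr.
  by move=> <-; field; rewrite gt_eqF.
rewrite -ler_sqr ?nnegrE ?mulr_ge0 ?cnorm_ge0//; last by lra.
rewrite expr1n exprMn bE -ler_pdivrMl; last by rewrite exprn_gt0// addr_gt0.
rewrite mulr1 lerBrDr -lerBrDl -/d.
rewrite ler_pdivrMr ?exprn_gt0//.
apply: (@le_trans _ _ (d * (1 - x) ^+ 2)); last first.
  by rewrite ler_wpM2l ?(ltW d0)// ler_sqr ?nnegrE ?cnorm_ge0// subr_ge0 ltW.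
have z0 := cnorm_ge0 z.
apply: (@le_trans _ _ (1 - cnorm z ^+ 2)); last by nra.
by rewrite ler_piMr// ?subr_ge0 ?expr_le1// ?(ltW zD)// lerBlDr lerDl sqr_ge0.
Qed.

(** Schwarz's lemma by the maximum principle. Instead of removing the singularity of the quotient at
    [a], the point joins the exceptional set; near the circle the divisor has modulus close to 1. *)
Lemma schur_step g E a : (forall x, x \in E -> `|x| < 1) -> `|a| < 1 -> a \notin E ->
  (forall z, `|z| < 1 -> z \notin E -> cdiff g z) ->
  (forall z, `|z| < 1 -> z \notin E -> `|g z| <= 1) -> `|g a| < 1 ->
  (forall z, `|z| < 1 -> z \notin a :: E -> cdiff (mobius_quot g a) z) /\
  (forall z, `|z| < 1 -> z \notin a :: E -> `|mobius_quot g a z| <= 1).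
Proof.
move=> ED aD aE dg g1 ga.
have dq z : `|z| < 1 -> z \notin a :: E -> cdiff (mobius_quot g a) z.
  move=> zD; rewrite inE negb_or => /andP[za zE].
  have dgz := dg z zD zE.
  apply: cdiff_div; first exact: bfactor_neq0.
    apply: cdiff_div; first by apply: norm_lt1_neq => //; exact: g1.
      by apply: cdiffB => //; exact: cdiff_cst.
    by apply: cdiffB; [exact: cdiff_cst|apply: cdiffM => //; exact: cdiff_cst].
  apply: cdiff_div; first by apply: disk_conj_neq1 => //; exact: ltW.
    by apply: cdiffB; [exact: cdiff_id|exact: cdiff_cst].
  apply: cdiffB; first exact: cdiff_cst.
  by apply: cdiffM; [exact: cdiff_id|exact: cdiff_cst].
split=> // z zD zE.
have mle w : `|w| < 1 -> w \notin E -> `|(g w - g a) / (1 - g w * (g a)^*)| <= 1.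
  move=> wD wE; have h := norm_lt1_neq (g1 _ wD wE) ga.
  by rewrite normrM normfV ler_pdivrMr ?normr_gt0// mul1r mobius_le ?g1.
have [K1 K10 [d d0 dP]] := cdiff_lipschitz (dg a aD aE).
pose eta := 1 - cnorm (g a).
have eta0 : 0 < eta by rewrite subr_gt0 -cnorm_lt1.
have one_le2 w : `|w| < 1 -> `|1 - w * a^*| <= 2%:R%:C%C.
  move=> wD; apply: le_trans (ler_normB _ _) _.
  rewrite (rmorph_nat (real_complex R)) normr1 (natrD _ 1 1) lerD2l normrM norm_conjC.
  by rewrite mulr_ile1// ltW.
have -> : 1 = 1%:C%C :> C by rewrite rmorph1.
have bnE w : `|w| < 1 -> w != a -> `|(bfactor a w)^-1| = `|1 - w * a^*| / `|w - a|.
  by move=> wD wa; rewrite /bfactor invfM invrK normrM normfV mulrC.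
(* Two regimes for the crude bound: within [d] of [a] the Lipschitz estimate compensates the zero of
   the Blaschke factor, and farther away that factor is bounded below. *)
apply: (@max_modulus_except _ (mobius_quot g a) (a :: E) 1
  (K1 / eta * 2 + 2 / d)) => //.
- by move=> x; rewrite inE => /predU1P[->//|/ED].
- move=> w wD; rewrite inE negb_or => /andP[wa wE].
  have wa0 : 0 < cnorm (w - a) by rewrite -ltcR cnormE normr_gt0 subr_eq0.
  have [wd|dw] := ltP (cnorm (w - a)) d.
    apply: (@le_trans _ _ (K1 / eta * 2)%:C%C); last first.
      by rewrite lecR lerDl divr_ge0// ltW.
    rewrite /mobius_quot !normrM bnE//.
    have h1 : `|g w - g a| <= K1%:C%C * `|w - a| by apply: dP; rewrite -cnormE ltcR.
    have h2 : eta%:C%C <= `|1 - g w * (g a)^*|.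
      by rewrite /eta rmorphB rmorph1 /= cnormE norm_1subM_ge// g1.
    move: h1 h2 (one_le2 w wD); rewrite normfV -!cnormE -!fmorphV -!rmorphM !lecR => h1 h2 h3.
    apply: (@le_trans _ _ ((K1 * cnorm (w - a)) / eta * (2 / cnorm (w - a)))).
      apply: ler_pM; rewrite ?mulr_ge0 ?invr_ge0 ?cnorm_ge0//.
        apply: ler_pM; rewrite ?invr_ge0 ?cnorm_ge0// lef_pV2// posrE.
        exact: lt_le_trans h2.
      by rewrite ler_wpM2r// invr_ge0 ltW.
    rewrite le_eqVlt; apply/orP; left; apply/eqP; field.
    by rewrite !gt_eqF.
  apply: (@le_trans _ _ (2 / d)%:C%C); last first.
    by rewrite lecR lerDr mulr_ge0 ?divr_ge0 // ltW.
  rewrite /mobius_quot normrM bnE// -[leRHS]mul1r ler_pM ?mle// ?divr_ge0//.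
  move: (one_le2 w wD); rewrite -!cnormE -fmorphV -rmorphM !lecR => h3.
  by apply: ler_pM; rewrite ?invr_ge0 ?cnorm_ge0// lef_pV2// posrE.
- move=> e e0; have [r r1 rP] := bfactor_boundary aD e0.
  exists r => // w rw wD; rewrite inE negb_or => /andP[wa wE].
  have b0 : 0 < `|bfactor a w| by rewrite normr_gt0 bfactor_neq0.
  rewrite normrM normfV ler_pdivrMr//; apply: le_trans (rP _ rw wD).
  exact: mle.
Qed.

Lemma psd_limit (X Y : C) : 0 <= X ->
  (forall t : R, 0 < t < 1 -> 0 <= (1 - t%:C%C ^+ 2) * X + t%:C%C ^+ 2 * Y) -> 0 <= Y.
Proof.
case: X => x x'; rewrite lecE /= => /andP[/eqP -> x0] h.
have hh t : 0 < t < 1 -> im Y = 0 /\ 0 <= (1 - t ^+ 2) * x + t ^+ 2 * re Y.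
  move=> t01; have := h t t01; case: (Y) => y y'; rewrite -rmorphXn.
  rewrite lecE /= !(mul0r, mulr0, addr0, add0r, oppr0, subr0) => /andP[/eqP h1 h2]; split=> //.
  apply/eqP; move/eqP: h1; rewrite mulf_eq0 sqrf_eq0 => /orP[/eqP t0|//].
  by move: t01; rewrite t0 ltxx.
have [Y0 _] : im Y = 0 /\ 0 <= (1 - (1/2) ^+ 2) * x + (1/2) ^+ 2 * re Y.
  by apply: hh; lra.
rewrite lecE /= Y0 eqxx /=.
(* For [t = 1 - e'] with [e' <= 1 / 2], one has [t^2 >= 1 / 4] and [1 - t^2 <= 2 e'], so
   [y >= - 8 x e']; the [+ 1] keeps the constant positive. *)
apply: (@le_of_le_addM _ _ _ (8 * x + 1)) => [|e e0]; first by lra.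
pose e' := Num.min e (1 / 2).
have e'0 : 0 < e' by rewrite lt_min e0 divr_gt0.
have e'1 : e' <= 1 / 2 by rewrite ge_min lexx orbT.
have e'e : e' <= e by rewrite ge_min lexx.
have [|_] := hh (1 - e'); first by apply/andP; split; lra.
set t := 1 - e'; set y := re Y => h1.
have t2 : 1 / 4 <= t ^+ 2 by rewrite /t; nra.
have t3 : 1 - t ^+ 2 <= 2 * e' by rewrite /t; nra.
have h2 : 0 <= 2 * e' * x + t ^+ 2 * y by nra.
apply: (@le_trans _ _ (y + 8 * x * e')); last by nra.
have [y0|y0] := leP 0 y; first by rewrite addr_ge0// mulr_ge0 ?(ltW e'0)// mulr_ge0.
nra.
Qed.

(* The Schur algorithm: each step adds its node to the exceptional set [E]; the
   function is multiplied by [t < 1] so that a step is always possible. *)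
Lemma pick_psd s g E c : (forall x, x \in E -> `|x| < 1) ->
  (forall z, `|z| < 1 -> z \notin E -> cdiff g z) ->
  (forall z, `|z| < 1 -> z \notin E -> `|g z| <= 1) ->
  uniq s -> (forall z, z \in s -> `|z| < 1 /\ z \notin E) ->
  0 <= form s (pick g) c.
Proof.
elim: s g E c => [|a s IH] g E c ED dg g1; first by rewrite /form big_nil.
move=> /= /andP[aNs us] sD.
have [aD aE] := sD a (mem_head _ _).
have sD' z : z \in s -> `|z| < 1 /\ z \notin E by move=> zs; apply: sD; rewrite inE zs orbT.
apply: (@psd_limit (form (a :: s) (@szego _) c)).
  by apply: psd_szego => /=; [rewrite aNs us|move=> z /sD[]].
move=> t /andP[t0 t1]; pose gt z := t%:C%C * g z.
have nt : `|t%:C%C| = t%:C%C :> C by rewrite ger0_norm// ler0c ltW.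
have gt1 z : `|z| < 1 -> z \notin E -> `|gt z| < 1.
  move=> zD zE; rewrite normrM nt; apply: (@le_lt_trans _ _ t%:C%C).
    by rewrite ler_piMr ?g1// ler0c ltW.
  by rewrite -(rmorph1 (real_complex R)) ltcR.
(* The Pick kernel of [t g] is a convex combination of the Szego kernel and the Pick kernel of [g],
   so positivity for all [t < 1] passes to [g]. *)
have -> : (1 - t%:C%C ^+ 2) * form (a :: s) (@szego _) c +
    t%:C%C ^+ 2 * form (a :: s) (pick g) c = form (a :: s) (pick gt) c.
  rewrite -!formZ -formD; apply: eq_form => // z w _ _.
  rewrite /szego /pick /gt rmorphM /= (_ : t%:C%C^* = t%:C%C); first by ring.
  by apply/CrealP; rewrite ger0_real// ler0c ltW.
have gta := gt1 a aD aE.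
have Ka := pick_gt0 gta aD.
rewrite form_schur_compl ?gt_eqF//; last exact: pick_herm; last by move=> *; exact: pick_herm.
apply: addr_ge0; first by apply: divr_ge0; [exact: exprn_ge0|exact: ltW].
have dgt z : `|z| < 1 -> z \notin E -> cdiff gt z.
  by move=> zD zE; apply: cdiffM; [exact: cdiff_cst|exact: dg].
have [dq q1] := schur_step ED aD aE dgt (fun z zD zE => ltW (gt1 z zD zE)) gta.
pose u z := (1 - gt z * (gt a)^*) * bfactor a z.
rewrite (eq_form (c' := c) (K' := fun z w => (1 - `|gt a| ^+ 2)^-1 *
    (u z * (u w)^* * pick (mobius_quot gt a) z w)))//; last first.
  move=> z w zs ws; have [zD zE] := sD' z zs; have [wD wE] := sD' w ws.
  rewrite schur_compl_pick ?(ltW (gt1 _ _ _))//.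
    by apply: contraNneq aNs => <-.
  by apply: contraNneq aNs => <-.
rewrite formZ form_scale mulr_ge0 ?invr_ge0 ?subr_ge0 ?expr_le1 ?(ltW gta)//.
apply: (IH _ (a :: E)) => //.
  by move=> x; rewrite inE => /predU1P[->//|/ED].
move=> z zs; have [zD zE] := sD' z zs; split=> //.
rewrite inE negb_or zE andbT.
by apply: contraNneq aNs => <-.
Qed.

End Pick.

(** * Holomorphy recovered from a positive Pick kernel *)

Section PickImpliesHolomorphic.
Variable R : realType.
Local Notation C := R[i].
Implicit Types (f g q : C -> C) (z w a : C).

(* Halving excludes the degenerate case [|g a| = 1] of a Schur step at [a]. *)
Lemma psd_pick_half (D : C -> Prop) g : (forall z, D z -> disk z) ->
  psd_kernel D (pick g) -> psd_kernel D (pick (fun z => 2^-1 * g z)).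
Proof.
move=> DD psdg s c us sD.
have := @psd_szego C s c us (fun z zs => DD z (sD z zs)); have := psdg s c us sD.
set X := form s (pick g) c; set Y := form s (@szego C) c => X0 Y0.
suff -> : form s (pick (fun z => 2^-1 * g z)) c = (1 - 2^-1 ^+ 2) * Y + 2^-1 ^+ 2 * X.
  have i4 : (2^-1 : C) ^+ 2 <= 1 by rewrite expr_le1 ?invr_ge0// invf_le1// ler1n.
  by rewrite addr_ge0// mulr_ge0 ?exprn_ge0 ?invr_ge0// subr_ge0.
rewrite -!formZ -formD; apply: eq_form => // z w _ _.
rewrite /szego /pick rmorphM fmorphV /= conjC_nat; ring.
Qed.

(** The Schwarz-Pick estimate from a Schur step at [w], which requires no regularity and so applies
    on a punctured disk. One factor 2 of the constant undoes the halving, the other bounds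
    [|1 - p z * conj(p w)|]. *)
Lemma psd_pick_lipschitz (D : C -> Prop) q z w : (forall z, D z -> disk z) ->
  psd_kernel D (pick q) -> D z -> D w ->
  `|q z - q w| <= 4%:R / (1 - `|w|) * `|z - w|.
Proof.
move=> DD psdq Dz Dw.
have w1 : 0 < 1 - `|w| by rewrite subr_gt0; exact: DD.
have [->|zw] := eqVneq z w; first by rewrite !subrr normr0 mulr0.
pose p z := 2^-1 * q z.
have psdp : psd_kernel D (pick p) by exact: psd_pick_half.
have ple v : D v -> `|p v| < 1.
  move=> Dv; rewrite normrM normfV normr_nat -ltr_pdivlMl ?invr_gt0// mulr1 invrK.
  by apply: le_lt_trans (psd_pick_le1 DD psdq Dv) _; rewrite ltr1n.
have psdm := psd_mobius_quot DD psdp Dw (ple _ Dw).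
have : `|mobius_quot p w z| <= 1.
  apply: (psd_pick_le1 (D := fun v => D v /\ v <> w)) psdm _ => [v [/DD]//|].
  by split => //; exact/eqP.
have n1 := norm_lt1_neq (ltW (ple _ Dz)) (ple _ Dw).
have b0 := bfactor_neq0 (DD _ Dw) (DD _ Dz) zw.
rewrite /mobius_quot normrM normfV ler_pdivrMr ?normr_gt0// mul1r.
rewrite normrM normfV ler_pdivrMr ?normr_gt0// => h.
have -> : q z - q w = 2%:R * (p z - p w) by rewrite /p -mulrBr mulrA mulfV ?mul1r ?pnatr_eq0.
rewrite normrM normr_nat.
have -> : 4%:R / (1 - `|w|) * `|z - w| = 2%:R * ((`|z - w| / (1 - `|w|)) * 2%:R) :> C.
  by field; rewrite gt_eqF.
rewrite ler_wpM2l//; apply: le_trans h _; apply: ler_pM => //.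
  rewrite /bfactor normrM normfV ler_wpM2l// lef_pV2 ?posrE//.
    by apply: norm_1subM_ge; exact/ltW/DD.
  by rewrite normr_gt0 disk_conj_neq1//; [exact: DD|exact/ltW/DD].
apply: le_trans (ler_normB _ _) _; rewrite normr1 (natrD _ 1 1) lerD2l.
by rewrite normrM norm_conjC mulr_ile1// ltW// ple.
Qed.

(* McShane's formula: the infimal convolution extends a Lipschitz function to [a]. *)
Lemma lipschitz_extend (X : C -> Prop) (h : C -> R) a (k : R) z0 : 0 <= k -> X z0 ->
  (forall z w, X z -> X w -> h z <= h w + k * cnorm (z - w)) ->
  exists l, forall z, X z -> `|h z - l| <= k * cnorm (z - a).
Proof.
move=> k0 Xz0 hk.
pose A := [set h w - k * cnorm (w - a) | w in [set w | X w]].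
have tri z w : cnorm (z - w) <= cnorm (z - a) + cnorm (w - a).
  rewrite -lecR rmorphD /= !cnormE [`|w - a|]distrC.
  exact: ler_distD.
have ubA z : X z -> ubound A (h z + k * cnorm (z - a)).
  move=> Xz _ [w /= Xw <-]; rewrite lerBlDr; apply: le_trans (hk w z Xw Xz) _.
  by rewrite -addrA lerD2l -mulrDr ler_wpM2l// [leRHS]addrC tri.
exists (sup A) => z Xz; rewrite ler_norml; apply/andP; split.
  rewrite lerBrDr addrC lerBlDr; apply: ge_sup; first by exists (h z0 - k * cnorm (z0 - a)), z0.
  exact: ubA.
rewrite lerBlDr addrC -lerBlDr; apply: ub_le_sup; last by exists z.
by exists (h z0 + k * cnorm (z0 - a)); exact: ubA.
Qed.

Lemma cnorm_re z : `|re z| <= cnorm z.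
Proof.
rewrite -[leRHS]ger0_norm ?cnorm_ge0// -ler_sqr ?nnegrE// -!normrX cnorm_sqr.
by rewrite !ger0_norm ?addr_ge0 ?sqr_ge0// lerDl sqr_ge0.
Qed.

Lemma cnorm_im z : `|im z| <= cnorm z.
Proof.
rewrite -[leRHS]ger0_norm ?cnorm_ge0// -ler_sqr ?nnegrE// -!normrX cnorm_sqr.
by rewrite !ger0_norm ?addr_ge0 ?sqr_ge0// lerDr sqr_ge0.
Qed.

Lemma re_sub z w : re (z - w) = re z - re w.
Proof. by case: z; case: w. Qed.

Lemma im_sub z w : im (z - w) = im z - im w.
Proof. by case: z; case: w. Qed.

Lemma lipschitz_extendC (X : C -> Prop) (h : C -> C) a (k : R) z0 : 0 <= k -> X z0 ->
  (forall z w, X z -> X w -> `|h z - h w| <= k%:C%C * `|z - w|) ->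
  exists l, forall z, X z -> `|h z - l| <= (2 * k)%:C%C * `|z - a|.
Proof.
move=> k0 Xz0 hk.
have hk' z w : X z -> X w -> cnorm (h z - h w) <= k * cnorm (z - w).
  by move=> Xz Xw; rewrite -lecR rmorphM /= !cnormE; exact: hk.
have [|l1 h1] := @lipschitz_extend X (fun z => re (h z)) a k z0 k0 Xz0.
  move=> z w Xz Xw; rewrite -lerBlDl -re_sub.
  by apply: le_trans (hk' z w Xz Xw); apply: le_trans (cnorm_re _); exact: ler_norm.
have [|l2 h2] := @lipschitz_extend X (fun z => im (h z)) a k z0 k0 Xz0.
  move=> z w Xz Xw; rewrite -lerBlDl -im_sub.
  by apply: le_trans (hk' z w Xz Xw); apply: le_trans (cnorm_im _); exact: ler_norm.
exists (Complex l1 l2) => z Xz; rewrite -[`|z - a|]cnormE -rmorphM /=.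
rewrite (_ : 2 * k * _ = k * cnorm (z - a) + k * cnorm (z - a)); last by ring.
by apply: norm_le_ReIm; rewrite ?re_sub ?im_sub; [exact: h1|exact: h2].
Qed.

(** Caratheodory's criterion: the Schur transform [q] of the halved function has a positive Pick
    kernel off [a], hence is Lipschitz near [a] and extends there by [l]. Then [q' z * (z - a)] is
    differentiable at [a], and the inverse Moebius map recovers [g]. *)
Lemma psd_pick_cdiff f a : psd_kernel (@disk C) (pick f) -> `|a| < 1 -> cdiff f a.
Proof.
move=> psdf aD; pose g z := 2^-1 * f z.
have psdg : psd_kernel (@disk C) (pick g) by exact: psd_pick_half.
have g2 z : `|z| < 1 -> `|g z| <= 2^-1.
  move=> zD; rewrite normrM normfV normr_nat ler_piMr ?invr_ge0//.
  exact: (psd_pick_le1 (fun _ => id) psdf).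
have half1 : (2^-1 : C) < 1 by rewrite invf_lt1// ltr1n.
have ga := le_lt_trans (g2 a aD) half1.
pose q := mobius_quot g a.
have psdq := psd_mobius_quot (fun _ => id) psdg aD ga.
have r0 : 0 < 1 - cnorm a by rewrite subr_gt0 -cnorm_lt1.
(* Within [r] of [a] one has [|w| <= 1 - r], so the Lipschitz constant [4 / (1 - |w|)] is at most
   [4 / r]. *)
pose r := (1 - cnorm a) / 2.
have rp : 0 < r by rewrite divr_gt0.
pose X z := cnorm (z - a) < r /\ z <> a.
have XD z : cnorm (z - a) < r -> cnorm z <= 1 - r.
  move=> zr; apply: (@le_trans _ _ (cnorm (z - a) + cnorm a)).
    by rewrite -lecR rmorphD /= !cnormE -{1}[z](subrK a) ler_normD.
  by move: zr; rewrite /r; lra.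
have XD' z : cnorm (z - a) < r -> `|z| < 1.
  by move=> /XD h; rewrite cnorm_lt1; apply: le_lt_trans h _; rewrite gtrBl.
pose z0 := a + (r / 2)%:C%C.
have Xz0 : X z0.
  split.
    rewrite /z0 addrC addKr -ltcR cnormE ger0_norm ?ler0c ?ltcR; last by rewrite divr_ge0// ltW.
    by rewrite gtr_pMr// invf_lt1// ltr1n.
  move=> /eqP; rewrite /z0 -[X in _ == X]addr0 (inj_eq (addrI _)).
  by rewrite -(rmorph0 (real_complex R)) (inj_eq (@complexI R)) gt_eqF// divr_gt0.
have [|z w [zr za] [wr wa]|l hl] := @lipschitz_extendC X q a (4 / r) z0 _ Xz0.
- by rewrite divr_ge0// ltW.
- have Dz : disk z /\ z <> a by split => //; exact: XD'.
  have Dw : disk w /\ w <> a by split => //; exact: XD'.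
  apply: le_trans (psd_pick_lipschitz (fun v => @proj1 _ _) psdq Dz Dw) _.
  rewrite ler_wpM2r//.
  rewrite -[`|w|]cnormE -(rmorph1 (real_complex R)) -rmorphB -fmorphV.
  rewrite -(rmorph_nat (real_complex R)) -rmorphM lecR ler_wpM2l// lef_pV2 ?posrE//.
    by have := XD _ wr; lra.
  by have := XD _ wr; lra.
pose q' z := if z == a then l else q z.
have dq' : cdiff (fun z => q' z * (z - a)) a.
  exists l => e e0; exists (Num.min r (e / (2 * (4 / r)))) => [|w wlt].
    by rewrite lt_min rp !(divr_gt0, mulr_gt0).
  have /andP[wr we] : (cnorm (w - a) < r) && (cnorm (w - a) < e / (2 * (4 / r))).
    by rewrite -lt_min -ltcR cnormE.
  rewrite subrr mulr0 subr0 -mulrBl /q'.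
  have [->|wa] := eqVneq w a; first by rewrite !subrr !(normr0, mulr0, mul0r).
  rewrite normrM ler_wpM2r//; apply: le_trans (hl w _) _; first by split => //; exact/eqP.
  by rewrite -cnormE -rmorphM lecR mulrC -ler_pdivlMr ?ltW// mulr_gt0// divr_gt0.
have q1 w : cnorm (w - a) < r -> w != a -> `|q w| <= 1.
  move=> wr wa; apply: (@psd_pick_le1 _ (fun z => disk z /\ z <> a)) => [v []//||] //.
  by split; [exact: XD'|exact/eqP].
have b1 w : cnorm (w - a) < r -> `|bfactor a w| <= 1.
  move=> /XD' wD; have n := disk_conj_neq1 wD (ltW aD).
  rewrite /bfactor normrM normfV ler_pdivrMr ?normr_gt0// mul1r.
  by apply: mobius_le; exact: ltW.
have dg : cdiff g a.
  apply: (@eq_cdiff _ (fun z => (g a + q' z * (z - a) / (1 - z * a^*)) /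
     (1 + (g a)^* * (q' z * (z - a) / (1 - z * a^*)))) _ _ r) => //; last first.
    have dB : cdiff (fun z => q' z * (z - a) / (1 - z * a^*)) a.
      apply: cdiff_div => //; first by apply: disk_conj_neq1 => //; exact: ltW.
      apply: cdiffB; first exact: cdiff_cst.
      by apply: cdiffM; [exact: cdiff_id|exact: cdiff_cst].
    apply: cdiff_div; first by rewrite subrr mulr0 mul0r mulr0 addr0 oner_neq0.
      by apply: cdiffD => //; exact: cdiff_cst.
    by apply: cdiffD; [exact: cdiff_cst|apply: cdiffM => //; exact: cdiff_cst].
  move=> w; rewrite -cnormE ltcR => wr.
  have [->|wa] := eqVneq w a; first by rewrite subrr mulr0 mul0r mulr0 !addr0 divr1.
  have wD := XD' _ wr.
  have n1 : 1 - w * a^* != 0 by apply: disk_conj_neq1 => //; exact: ltW.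
  have n2 := norm_lt1_neq (le_trans (g2 w wD) (ltW half1)) ga.
  have b0 := bfactor_neq0 aD wD wa.
  have e1 : q' w * (w - a) / (1 - w * a^*) = (g w - g a) / (1 - g w * (g a)^*).
    by rewrite /q' (negbTE wa) -mulrA -/(bfactor a w) /q /mobius_quot mulfVK.
  have n3 : 1 - g a * (g a)^* != 0 by rewrite norm_lt1_neq// ltW.
  rewrite e1; field; rewrite n2 /=.
  have -> : 1 - g w * (g a)^* + (g a)^* * (g w - g a) = 1 - g a * (g a)^* by ring.
  exact: n3.
rewrite (_ : f = fun z => 2 * g z); first by apply: cdiffM => //; exact: cdiff_cst.
by apply/funext => z; rewrite /g mulrA mulfV ?mul1r ?pnatr_eq0.
Qed.

End PickImpliesHolomorphic.

(** * Interpolation on a finite set *)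

Section PuncturedExtension.
Local Open Scope sesquilinear_scope.
Variable R : realType.
Local Notation C := R[i].

Lemma ge0_limit (y : C) :
  (forall e : R, 0 < e -> exists2 x, 0 <= x & `|x - y| <= e%:C%C) -> 0 <= y.
Proof.
move=> h.
have hh e : 0 < e -> `|im y| <= e /\ - e <= re y.
  move=> /h[x]; rewrite lecE => /andP[/eqP x0 x1] xy.
  have {}xy : cnorm (x - y) <= e by rewrite -lecR cnormE.
  have := le_trans (cnorm_re _) xy; have := le_trans (cnorm_im _) xy.
  rewrite re_sub im_sub x0 sub0r normrN => ye; rewrite ler_norml => /andP[_ b].
  by split => //; move: x1 b => /=; lra.
rewrite lecE; apply/andP; split.
  rewrite -normr_le0; apply/ler_addgt0Pr => e /hh[+ _]; by rewrite add0r.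
by apply/ler_addgt0Pr => e /hh[_]; rewrite /= lerNl; lra.
Qed.

Definition cont (F : C -> C) (a : C) := forall e : R, 0 < e ->
  exists2 d : R, 0 < d & forall w, `|w - a| < d%:C%C -> `|F w - F a| <= e%:C%C.

Lemma contP (F : C -> C) a : cont F a <-> (F w : C^o) @[w --> (a : C^o)] --> (F a : C^o).
Proof.
split=> [h|].
  apply/(@cvgrPdist_le C C^o C^o (nbhs (a : C^o)) _ (F : C^o -> C^o) (F a : C^o)).
  move=> e e0; have [r r0 er] := gt0_realC e0; have [d d0 dP] := h r r0.
  apply/nbhs_ballP; exists d%:C%C; first by rewrite /= ltcR.
  by move=> w /= aw; rewrite distrC er; apply: dP; rewrite distrC.
move=> /(@cvgrPdist_le C C^o C^o (nbhs (a : C^o)) _ (F : C^o -> C^o) (F a : C^o)) h.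
move=> e e0; have := h e%:C%C; rewrite ltcR => /(_ e0)/nbhs_ballP[d /= d0 dP].
have [r r0 dr] := gt0_realC d0; exists r => // w aw.
by rewrite distrC; apply: dP; rewrite /= /ball /= distrC dr.
Qed.

Lemma contD F G a : cont F a -> cont G a -> cont (fun w => F w + G w) a.
Proof.
move=> /contP f /contP g; apply/contP.
exact: (@cvgD C C^o C^o (nbhs (a : C^o)) _ F G _ _ f g).
Qed.

Lemma contM F G a : cont F a -> cont G a -> cont (fun w => F w * G w) a.
Proof.
move=> /contP f /contP g; apply/contP.
exact: (@cvgM C C^o (nbhs (a : C^o)) _ F G _ _ f g).
Qed.

Lemma contV F a : F a != 0 -> cont F a -> cont (fun w => (F w)^-1) a.
Proof.
move=> F0 /contP f; apply/contP.
exact: (@cvgV C C^o (nbhs (a : C^o)) _ F _ F0 f).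
Qed.

Lemma cont_cst c a : cont (fun=> c) a.
Proof. by move=> e e0; exists 1 => // w _; rewrite subrr normr0 ler0c ltW. Qed.

Lemma cont_conj F a : cont F a -> cont (fun w => (F w)^*) a.
Proof.
move=> h e /h[d d0 dP]; exists d => // w /dP; by rewrite -rmorphB norm_conjC.
Qed.

Lemma cont_sum (I : eqType) (s : seq I) (F : I -> C -> C) a :
  (forall i, i \in s -> cont (F i) a) -> cont (fun w => \sum_(i <- s) F i w) a.
Proof.
elim: s => [|i s IH] cF.
  rewrite (_ : (fun w => _) = fun=> 0); first exact: cont_cst.
  by apply/funext => w; rewrite big_nil.
rewrite (_ : (fun w => _) = (fun w => F i w + \sum_(i <- s) F i w)).
  apply: contD; first by apply: cF; rewrite mem_head.
  by apply: IH => j js; apply: cF; rewrite inE js orbT.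
by apply/funext => w; rewrite big_cons.
Qed.

Lemma avoid_seq (a : C) (s : seq C) : a \notin s ->
  exists2 d : R, 0 < d & forall w, `|w - a| < d%:C%C -> w \notin s.
Proof.
elim: s => [|x s IH]; first by exists 1.
rewrite inE negb_or => /andP[ax /IH[d d0 dP]].
have xa : 0 < cnorm (x - a) by rewrite -ltcR cnormE normr_gt0 subr_eq0 eq_sym.
exists (Num.min d (cnorm (x - a))) => [|w wa]; first by rewrite lt_min d0.
rewrite inE negb_or; apply/andP; split.
  apply/eqP => wx; move: wa; rewrite wx -cnormE ltcR lt_min => /andP[_].
  by rewrite ltxx.
by apply: dP; apply: lt_le_trans wa _; rewrite lecR ge_min lexx.
Qed.

Lemma disk_nbhs (a : C) : `|a| < 1 ->
  exists2 d : R, 0 < d & forall w, `|w - a| < d%:C%C -> `|w| < 1.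
Proof.
rewrite cnorm_lt1 => aD; exists (1 - cnorm a); first by rewrite subr_gt0.
move=> w; rewrite rmorphB rmorph1 /= cnormE ltrBrDr; apply: le_lt_trans.
by rewrite -{1}[w](subrK a) ler_normD.
Qed.

(** A node at [a] is moved to a nearby [v] off the other nodes, with the same coefficient. The form
    sees [v] only through [K v v] and its pairings with fixed nodes, hence continuity on the
    diagonal and in each variable separately. *)
Lemma psd_extend K (a : C) : `|a| < 1 ->
  psd_kernel (fun z => `|z| < 1 /\ z <> a) K ->
  cont (fun w => K w w) a ->
  (forall z, `|z| < 1 -> cont (K z) a) ->
  (forall z, `|z| < 1 -> cont (fun w => K w z) a) ->
  psd_kernel (fun z => `|z| < 1) K.
Proof.
move=> aD psdK Kd Kl Kr s c us sD.
have [as_|aNs] := boolP (a \in s); last first.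
  by apply: psdK => // z zs; split; [exact: sD | move=> za; rewrite -za zs in aNs].
rewrite (perm_form _ _ (perm_to_rem as_)).
have us' := rem_uniq a us.
have aN : a \notin rem a s by rewrite (mem_rem_uniq _ us) inE eqxx.
have sD' z : z \in rem a s -> `|z| < 1 by move=> /mem_rem/sD.
move: (rem a s) us' aN sD' => {us sD as_} {}s us aN sD.
pose phi v := c a * (c a)^* * K v v
    + \sum_(w <- s) c a * (c w)^* * K v w
    + \sum_(z <- s) c z * (c a)^* * K z v + form s K c.
have cphi : cont phi a.
  apply: contD; last exact: cont_cst.
  apply: contD; last first.
    apply: cont_sum => z zs.
    by apply: contM; [exact: cont_cst|by apply: Kl; exact: sD].
  apply: contD; first by apply: contM => //; exact: cont_cst.
  apply: cont_sum => z zs.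
  by apply: contM; [exact: cont_cst|by apply: Kr; exact: sD].
rewrite form_cons -/(phi a); apply: ge0_limit => e e0.
have [d1 d10 h1] := cphi e e0.
have [d2 d20 h2] := avoid_seq aN.
have [d3 d30 h3] := disk_nbhs aD.
pose r := Num.min d1 (Num.min d2 d3) / 2.
have m0 : 0 < Num.min d1 (Num.min d2 d3) by rewrite !lt_min d10 d20.
have r0 : 0 < r by rewrite divr_gt0.
pose v := a + r%:C%C.
have va : v != a.
  rewrite /v -[X in _ != X]addr0 (inj_eq (addrI _)) -(rmorph0 (real_complex R)).
  by rewrite (inj_eq (@complexI R)) gt_eqF.
have vE : `|v - a| = r%:C%C by rewrite /v addrC addKr ger0_norm// ler0c ltW.
have : r < Num.min d1 (Num.min d2 d3) by rewrite gtr_pMr// invf_lt1// ltr1n.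
rewrite !lt_min => /andP[r1 /andP[r2 r3]].
have vs : v \notin s by apply: h2; rewrite vE ltcR.
have vD : `|v| < 1 by apply: h3; rewrite vE ltcR.
exists (phi v); last by apply: h1; rewrite vE ltcR.
pose c' z := if z == v then c a else c z.
have cv : c' v = c a by rewrite /c' eqxx.
have := psdK (v :: s) c'; rewrite form_cons !cv.
have cE z : z \in s -> c' z = c z.
  by move=> zs; rewrite /c'; case: eqP => // zv; rewrite -zv zs in vs.
rewrite (eq_form (c' := c) (K' := K))//.
rewrite big_seq [X in _ + X + _]big_seq.
under eq_bigr => w ws do rewrite cE//.
under [X in _ + X + _]eq_bigr => w ws do rewrite cE//.
rewrite -!big_seq; apply; first by rewrite /= vs.
move=> z; rewrite inE => /predU1P[->|zs]; first by split => //; exact/eqP.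
by split; [exact: sD|move=> za; rewrite -za zs in aN].
Qed.

End PuncturedExtension.

(** * Comparison of Schur complements and removal of a zero *)

Section SchurComplementMonotonicity.
Local Open Scope sesquilinear_scope.
Variable C : numClosedFieldType.

(** A suitable coefficient at [a] makes the form of [K] equal to that of its complement; for this
    coefficient the form of [L] is smaller, yet still above that of its own complement since
    [L a a > 0]. *)
Lemma form_schur_mono (D : C -> Prop) a (s : seq C) K L c : D a ->
  (forall z, z \in s -> D z) -> uniq s -> a \notin s ->
  K a a != 0 -> 0 < L a a ->
  (forall z w, D z -> D w -> K z w = (K w z)^*) ->
  (forall z w, D z -> D w -> L z w = (L w z)^*) ->
  psd_kernel D (fun z w => K z w - L z w) ->
  form s (schur_compl L a) c <= form s (schur_compl K a) c.
Proof.
move=> Da sD us aNs Ka La Kh Lh psdKL.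
have sD' z : z \in s -> D z := sD z.
have [||c' c'E <-] := @form_schur_min C a s K c aNs Ka.
- by move=> z /sD' Dz; exact: Kh.
- exact: Kh.
have asD z : z \in a :: s -> D z by rewrite inE => /predU1P[->|/sD].
have : 0 <= form (a :: s) (fun z w => K z w - L z w) c' by apply: psdKL => //=; rewrite aNs.
rewrite (eq_form (c' := c') (K' := fun z w => K z w + (- 1) * L z w))//; last first.
  by move=> *; rewrite mulN1r.
rewrite formD formZ mulN1r subr_ge0; apply: le_trans.
rewrite form_schur_compl ?gt_eqF//; last exact: Lh; last by move=> z /sD' Dz; exact: Lh.
rewrite (eq_form (s := s) (c' := c) (K' := schur_compl L a))// lerDr.
by apply: divr_ge0; [exact: exprn_ge0|exact: ltW].
Qed.

Definition evalrow n (g : 'I_n -> {poly C}) z : 'rV[C]_n := \row_j (g j).[z].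

Lemma herm_formE n (E : 'M[C]_n) (u v : 'rV_n) : E^t* = E ->
  (u *m E *m v^t*) 0 0 = ((v *m E *m u^t*) 0 0)^*.
Proof.
move=> Eh; transitivity (((v *m E *m u^t*)^t*) 0 0); last by rewrite !mxE.
by rewrite !trmxC_mul trmxCK Eh mulmxA.
Qed.

Lemma form_psdmx n (B : 'M[C]_n) (g : C -> 'rV[C]_n) s c :
  form s (fun z w => (g z *m B *m (g w)^t*) 0 0) c =
  ((\sum_(z <- s) c z *: g z) *m B *m (\sum_(z <- s) c z *: g z)^t*) 0 0.
Proof.
rewrite /form !mulmx_suml summxE; apply: eq_bigr => z _.
rewrite linear_sum /= map_mx_sum mulmx_sumr summxE; apply: eq_bigr => w _.
rewrite linearZ /= map_mxZ -!scalemxAl -scalemxAr !mxE.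
by rewrite mulrA.
Qed.

(** Positivity says that [Q], helped by a correction of finite rank, dominates [d]. At a zero of [Q]
    the correction alone has to dominate, which spends one unit of the rank of [E] when [d] has no
    zero. *)
Definition zero_count_kernel n (E : 'M[C]_n) (g : 'I_n -> {poly C}) (d Q : {poly C}) z w :=
  Q.[z] * Q.[w]^* * szego z w + (evalrow g z *m E *m (evalrow g w)^t*) 0 0
  - d.[z] * d.[w]^* * szego z w.

(* The Schur complement at a zero [a] lowers the rank of [E] by one; the remaining
   inequality is divisible by [(z - a) (w - a)^*]. *)
Lemma zero_count_step n (E : 'M[C]_n) (g : 'I_n -> {poly C}) (d Q1 : {poly C}) a :
  E^t* = E -> disk a -> (forall z, disk z -> d.[z] != 0) ->
  psd_kernel (@disk C) (zero_count_kernel E g d (('X - a%:P) * Q1)) ->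
  exists (E' : 'M[C]_n) (g' : 'I_n -> {poly C}),
    [/\ E'^t* = E', (\rank E' < \rank E)%N &
      psd_kernel (fun z => disk z /\ z <> a)
        (zero_count_kernel E' g' d ((1 - (a^*)%:P * 'X) * Q1))].
Proof.
move=> Eh aD d0 psdN; pose Q := ('X - a%:P) * Q1.
have QE : Q = ('X - a%:P) * Q1 by [].
pose H z w := (evalrow g z *m E *m (evalrow g w)^t*) 0 0.
have Hh z w : H z w = (H w z)^* by exact: herm_formE.
pose M z w := Q.[z] * Q.[w]^* * szego z w + H z w.
pose L z w := d.[z] * d.[w]^* * szego z w.
have Qa : Q.[a] = 0 by rewrite QE hornerM hornerXsubC subrr mul0r.
have Maz z : M a z = H a z by rewrite /M Qa !mul0r add0r.
have Mza z : M z a = H z a by rewrite /M Qa conjC0 mulr0 mul0r add0r.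
have La : 0 < L a a.
  rewrite /L mulr_gt0 ?szego_gt0// -normCK exprn_gt0// normr_gt0 d0//.
have Mh z w : M z w = (M w z)^*.
  by rewrite /M rmorphD !rmorphM /= conjCK -szego_herm -Hh [Q.[z] * _]mulrC.
have Lh z w : L z w = (L w z)^*.
  by rewrite /L !rmorphM /= conjCK -szego_herm [d.[z] * _]mulrC.
have psdML : psd_kernel (@disk C) (fun z w => M z w - L z w) by [].
have Haa : 0 < H a a.
  have := psdML [:: a] (fun=> 1) isT.
  rewrite /form !big_seq1 conjC1 !mul1r Maz subr_ge0 => h.
  by apply: lt_le_trans La _; apply: h => z; rewrite inE => /eqP->.
pose u := evalrow g a.
(* The matrix of the Schur complement of [H] at [a]. It annihilates [u] whereas [E] does not, so the
   rank drops. *)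
pose E' := E - (H a a)^-1 *: (E *m u^t* *m (u *m E)).
have HE (x y : 'rV[C]_n) : (x *m E' *m y^t*) 0 0 = (x *m E *m y^t*) 0 0 -
    (x *m E *m u^t*) 0 0 * (u *m E *m y^t*) 0 0 / H a a.
  rewrite /E' mulmxBr mulmxBl -scalemxAr -scalemxAl mxE [X in _ + X]mxE [X in _ - X]mxE.
  congr (_ - _); rewrite mulrC; congr (_ / _).
  rewrite !mulmxA -(mulmxA (x *m E *m u^t*)) -(mulmxA (x *m E *m u^t*)).
  by rewrite [LHS]mxE big_ord1.
have Haa_conj : (H a a)^* = H a a by rewrite -Hh.
have E'h : E'^t* = E'.
  rewrite /E' linearB linearZ /= map_mxB map_mxZ fmorphV /= Haa_conj Eh.
  by rewrite !trmxC_mul trmxCK Eh.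
have E'u : E' *m u^t* = 0.
  apply/eqP; rewrite /E' mulmxBl -scalemxAl -(mulmxA (E *m u^t*)).
  have -> : u *m E *m u^t* = (H a a)%:M by rewrite [LHS]mx11_scalar.
  by rewrite mul_mx_scalar scalerA mulVf ?scale1r ?subrr// gt_eqF.
have uE' : u *m E' = 0.
  by rewrite -[LHS]trmxCK trmxC_mul E'h E'u trmx0 map_mx0.
have rankE : (\rank E' < \rank E)%N.
  apply: rank_ltmx; rewrite ltmxE; apply/andP; split.
    have -> : E' = (1%:M - (H a a)^-1 *: (E *m u^t* *m u)) *m E.
      by rewrite mulmxBl mul1mx -scalemxAl /E' !mulmxA.
    exact: submxMl.
  apply/negP => /submxP[X EX].
  have : H a a = 0 by rewrite /H EX -!mulmxA E'u !mulmx0 mxE.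
  by move/eqP; rewrite gt_eqF.
clearbody E'.
pose rho : {poly C} := 1 - (a^*)%:P * 'X.
have rhoE z : rho.[z] = 1 - z * a^* by rewrite !hornerE mulrC.
(* As [E'] kills the evaluation at [a], the value at [a] can be subtracted from each [g j], which
   makes it divisible by [X - a]. *)
pose g1 j := (g j - (g j).[a]%:P) %/ ('X - a%:P).
have g1E j : g j = g1 j * ('X - a%:P) + (g j).[a]%:P.
  rewrite /g1 divpK ?subrK// dvdp_XsubCl /root hornerD hornerN hornerC subrr//.
pose g2 j := rho * g1 j.
have evE z : z - a != 0 -> 1 - z * a^* != 0 ->
    evalrow g2 z *m E' = ((1 - z * a^*) / (z - a)) *: (evalrow g z *m E').
  move=> za n1; have -> : evalrow g z = (z - a) *: evalrow g1 z + u.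
    apply/rowP => j; rewrite !mxE {1}g1E hornerD hornerM hornerXsubC hornerC.
    by rewrite mulrC.
  rewrite mulmxDl uE' addr0 -scalemxAl scalerA mulfVK// scalemxAl.
  congr (_ *m _); apply/rowP => j; by rewrite !mxE hornerM rhoE.
exists E', g2; split => //.
move=> s c us sD.
have sD' z : z \in s -> disk z by move=> /sD[].
have aNs : a \notin s by apply/negP => /sD[_].
have n1 z : z \in s -> 1 - z * a^* != 0.
  by move=> zs; apply: disk_conj_neq1; [exact: sD'|exact: ltW].
have n2 z : z \in s -> z - a != 0.
  by move=> /sD[_ /eqP]; rewrite subr_eq0.
(* The inverse of [bfactor a]: this rescaling turns the Schur complement of [L] back into [L], and
   the factor [X - a] of [Q] into [1 - conj(a) X]. *)
pose v z := (1 - z * a^*) / (z - a).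
have := form_schur_mono (fun z => c z * v z) aD sD' us aNs _ La
   (fun z w _ _ => Mh z w) (fun z w _ _ => Lh z w) psdML.
rewrite Maz gt_eqF// => /(_ isT); rewrite -subr_ge0 -mulN1r -formZ -formD.
rewrite -form_scale; congr (0 <= _); apply: eq_form => // z w zs ws.
have HE' : (evalrow g z *m E' *m (evalrow g w)^t*) 0 0 =
  H z w - H z a * H a w / H a a := HE _ _.
rewrite {1}/schur_compl Maz Mza Maz /M.
have -> : schur_compl L a z w =
   d.[z] * d.[w]^* * (bfactor a z * (bfactor a w)^* * szego z w).
  rewrite -(schur_compl_szego aD (sD' z zs) (sD' w ws)).
  rewrite /schur_compl /L; field.
  by rewrite gt_eqF ?szego_gt0// conjC_eq0 d0.
have g2E : (evalrow g2 z *m E' *m (evalrow g2 w)^t*) 0 0 =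
    v z * (v w)^* * (H z w - H z a * H a w / H a a).
  rewrite evE ?n1 ?n2// -scalemxAl mxE -HE' -mulrA; congr (_ * _).
  by rewrite herm_formE// evE ?n1 ?n2// -scalemxAl mxE rmorphM /= -herm_formE.
rewrite /zero_count_kernel g2E -/rho !hornerM !rhoE !hornerXsubC /v /bfactor.
move: (H z w) (H z a * H a w / H a a) (szego z w) => h1 h2 A.
have m1 := n1 z zs; have m2 := n1 w ws; have m3 := n2 z zs; have m4 := n2 w ws.
have m2' : 1 - w^* * a != 0.
  by move: m2; rewrite -conjC_eq0 rmorphB rmorphM /= conjC1 conjCK.
have m4' : w^* - a^* != 0 by rewrite -rmorphB conjC_eq0.
rewrite !(rmorphM, fmorphV, rmorphB) /= ?conjC1 ?conjCK.
by field; do ?[apply/andP; split].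
Qed.

End SchurComplementMonotonicity.

(** * Zeros in the disk, counted with multiplicity *)

Section CountingZeros.
Local Open Scope sesquilinear_scope.
Variable R : realType.
Local Notation C := R[i].

Lemma cont_id (a : C) : cont id a.
Proof. by move=> e e0; exists e => // w /ltW. Qed.

Lemma cont_horner_comp (p : {poly C}) F (a : C) : cont F a -> cont (fun w => p.[F w]) a.
Proof.
move=> cF; elim/poly_ind: p => [|p c IH].
  rewrite (_ : (fun w => _) = fun=> 0); first exact: cont_cst.
  by apply/funext => w; rewrite horner0.
rewrite (_ : (fun w => _) = fun w => p.[F w] * F w + c).
  by apply: contD; [exact: contM|exact: cont_cst].
by apply/funext => w; rewrite hornerMXaddC.
Qed.

Lemma cont_zero_count_kernel n (E : 'M[C]_n) (g : 'I_n -> {poly C}) (d Q : {poly C}) F G (a : C) :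
  cont F a -> cont G a -> 1 - F a * (G a)^* != 0 ->
  cont (fun w => zero_count_kernel E g d Q (F w) (G w)) a.
Proof.
move=> cF cG FG.
have cA : cont (fun w => szego (F w) (G w)) a.
  apply: contV => //; apply: contD; first exact: cont_cst.
  rewrite (_ : (fun w => _) = fun w => (-1) * (F w * (G w)^*)).
    by apply: contM; [exact: cont_cst|apply: contM => //; exact: cont_conj].
  by apply/funext => w; rewrite mulN1r.
have cP (p : {poly C}) : cont (fun w => p.[F w] * p.[G w]^* * szego (F w) (G w)) a.
  apply: contM => //; apply: contM; first exact: cont_horner_comp.
  by apply: cont_conj; exact: cont_horner_comp.
rewrite /zero_count_kernel; apply: contD; last first.
  rewrite (_ : (fun w => _) = fun w => (-1) * (d.[F w] * d.[G w]^* * szego (F w) (G w))).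
    by apply: contM => //; exact: cont_cst.
  by apply/funext => w; rewrite mulN1r.
apply: contD => //.
rewrite (_ : (fun w => _) = fun w => \sum_(j <- index_enum 'I_n)
    (\sum_(i <- index_enum 'I_n) (g i).[F w] * E i j) * ((g j).[G w])^*).
  apply: cont_sum => j _; apply: contM; last by apply: cont_conj; exact: cont_horner_comp.
  apply: cont_sum => i _; apply: contM; last exact: cont_cst.
  exact: cont_horner_comp.
apply/funext => w; rewrite !mxE; apply: eq_bigr => j _; rewrite !mxE.
by congr (_ * _); apply: eq_bigr => i _; rewrite !mxE.
Qed.

(** Removing [a] leaves positivity off [a] only; continuity restores it there, so a repeated zero
    can be removed again and multiplicities are counted. *)
Lemma zero_count n (E : 'M[C]_n) (g : 'I_n -> {poly C}) (d Q : {poly C}) (zs : seq C) :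
  E^t* = E -> (forall a, a \in zs -> `|a| < 1) ->
  (forall z, `|z| < 1 -> d.[z] != 0) ->
  psd_kernel (fun z => `|z| < 1) (zero_count_kernel E g d Q) ->
  \prod_(a <- zs) ('X - a%:P) %| Q -> (size zs <= \rank E)%N.
Proof.
elim: zs n E g Q => [//|a zs IH] n E g Q Eh zsD d0 psdN.
rewrite big_cons => /dvdpP[Q' QE].
have aD : `|a| < 1 by apply: zsD; rewrite mem_head.
pose Q1 := Q' * \prod_(a <- zs) ('X - a%:P).
have {}QE : Q = ('X - a%:P) * Q1 by rewrite QE /Q1; ring.
rewrite QE in psdN; have [E' [g' [E'h rankE psdE']]] := zero_count_step Eh aD d0 psdN.
apply: leq_trans rankE; rewrite /= ltnS.
refine (IH n E' g' ((1 - (a^*)%:P * 'X) * Q1) E'h _ d0 _ _).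
- by move=> b bz; apply: zsD; rewrite inE bz orbT.
- apply: (psd_extend aD psdE').
  + apply: (cont_zero_count_kernel _ _ _ _ (cont_id _) (cont_id _)).
    by apply: disk_conj_neq1 => //; exact: ltW.
  + move=> z zD; apply: (cont_zero_count_kernel _ _ _ _ (cont_cst _ _) (cont_id _)).
    by apply: disk_conj_neq1 => //; exact: ltW.
  + move=> z zD; apply: (cont_zero_count_kernel _ _ _ _ (cont_id _) (cont_cst _ _)).
    by apply: disk_conj_neq1 => //; exact: ltW.
- by rewrite /Q1; apply: dvdp_mull; apply: dvdp_mull; exact: dvdpp.
Qed.

End CountingZeros.

(** * The Nevanlinna-Pick interpolant *)

Section Interpolant.
Local Open Scope sesquilinear_scope.
Variables (C : numClosedFieldType) (n : nat) (z s : 'I_n -> C).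
Hypothesis zD : forall i, disk (z i).

Definition pick_mx : 'M[C]_n :=
  \matrix_(i, j) ((1 - s i * (s j)^*) / (1 - z i * (z j)^*)).

Hypothesis Pu : pick_mx \in unitmx.

(* [pnum / den] and [qden / den] are the entries of the second column of the
   Nevanlinna-Pick resolvent matrix
   [I - (1 - x) G(x) P^-1 G(1)^* J], normalised at the boundary point 1. *)
Definition lin_den (a : C) : {poly C} := 1 - (a^*)%:P * 'X.
Definition den : {poly C} := \prod_j lin_den (z j).
Definition den' j : {poly C} := \prod_(k | k != j) lin_den (z k).
Definition coefs : 'cV[C]_n := invmx pick_mx *m \col_i (s i / (1 - z i)).
Definition coef_at j := coefs j 0.
Definition pnum : {poly C} := \sum_j (coef_at j)%:P * ((1 - 'X) * den' j).
Definition qden : {poly C} := den + \sum_j ((s j)^* * coef_at j)%:P * ((1 - 'X) * den' j).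
Definition gpol j : {poly C} := (coef_at j * (1 - (z j)^*))%:P * den' j.

Lemma lin_denE a x : (lin_den a).[x] = 1 - x * a^*.
Proof. by rewrite /lin_den !hornerE mulrC. Qed.

Lemma den_neq0 x : `|x| <= 1 -> den.[x] != 0.
Proof.
move=> xD; rewrite horner_prod prodf_seq_neq0; apply/allP => j _ /=.
rewrite lin_denE -conjC_eq0 rmorphB rmorphM /= conjC1 conjCK mulrC.
exact: disk_conj_neq1.
Qed.

Lemma den1_neq0 x j : `|x| <= 1 -> 1 - x * (z j)^* != 0.
Proof.
move=> xD; rewrite -conjC_eq0 rmorphB rmorphM /= conjC1 conjCK mulrC.
exact: disk_conj_neq1.
Qed.

Lemma den'E x j : `|x| <= 1 -> (den' j).[x] = den.[x] / (1 - x * (z j)^*).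
Proof.
move=> xD; rewrite /den (bigD1 j)//= hornerM lin_denE mulrAC mulfV ?mul1r//.
exact: den1_neq0.
Qed.

Lemma one_subXE x : (1 - 'X : {poly C}).[x] = 1 - x.
Proof. by rewrite !hornerE. Qed.

Lemma pnumE x : `|x| <= 1 ->
  pnum.[x] = den.[x] * \sum_j coef_at j * ((1 - x) / (1 - x * (z j)^*)).
Proof.
move=> xD; rewrite /pnum horner_sum mulr_sumr; apply: eq_bigr => j _.
by rewrite hornerCM hornerM den'E// one_subXE; ring.
Qed.

Lemma qdenE x : `|x| <= 1 -> qden.[x] = den.[x] *
  (1 + \sum_j (s j)^* * coef_at j * ((1 - x) / (1 - x * (z j)^*))).
Proof.
move=> xD; rewrite /qden hornerD horner_sum mulrDr mulr1 mulr_sumr.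
congr (_ + _); apply: eq_bigr => j _.
by rewrite hornerCM hornerM den'E// one_subXE; ring.
Qed.

Lemma gpolE x j : `|x| <= 1 -> (gpol j).[x] =
  den.[x] * (coef_at j * ((1 - (z j)^*) / (1 - x * (z j)^*))).
Proof. by move=> xD; rewrite /gpol hornerCM den'E//; ring. Qed.

Lemma zn1 i : 1 - z i != 0.
Proof.
rewrite subr_eq0; apply/eqP => zi; have := zD i.
by rewrite /disk -zi normr1 ltxx.
Qed.

Lemma coefs_eq i : \sum_j pick_mx i j * coef_at j = s i / (1 - z i).
Proof.
have : pick_mx *m coefs = \col_i (s i / (1 - z i)) by rewrite mulKVmx.
move/matrixP/(_ i 0); by rewrite [LHS]mxE [RHS]mxE.
Qed.

Lemma pick_mx_herm i j : (pick_mx i j)^* = pick_mx j i.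
Proof.
rewrite !mxE rmorphM fmorphV !rmorphB !rmorphM /= conjC1 !conjCK.
by rewrite [(s i)^* * _]mulrC [(z i)^* * _]mulrC.
Qed.

Lemma coefs_eq_conj j : \sum_i pick_mx i j * (coef_at i)^* = (s j)^* / (1 - (z j)^*).
Proof.
have := congr1 (fun x => x^*) (coefs_eq j); rewrite rmorph_sum rmorphM fmorphV rmorphB /= conjC1 => <-.
by apply: eq_bigr => i _; rewrite rmorphM /= pick_mx_herm.
Qed.

(** Multiplied by [1 - z i], row [i] of the linear system defining [coefs] is this equality without
    the common factor [den]. *)
Lemma interpolation i : pnum.[z i] = s i * qden.[z i].
Proof.
have ziD := ltW (zD i).
rewrite pnumE// qdenE// mulrCA; congr (_ * _).
rewrite mulrDr mulr1; apply/eqP; rewrite -subr_eq mulr_sumr -sumrB; apply/eqP.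
have si : s i = (\sum_j pick_mx i j * coef_at j) * (1 - z i).
  by rewrite coefs_eq mulfVK ?zn1.
rewrite [RHS]si mulr_suml; apply: eq_bigr => j _.
by rewrite [pick_mx i j]mxE; field; rewrite den1_neq0.
Qed.

(* Makes [pnum / qden] bounded by 1 near the circle, and bounds the number of zeros
   of [qden] in the disk by the number of negative squares of [pick_mx]. *)
Lemma pick_identity x y : disk x -> disk y ->
  qden.[x] * (qden.[y])^* - pnum.[x] * (pnum.[y])^* =
  den.[x] * (den.[y])^* +
  (1 - x * y^*) * (evalrow gpol x *m pick_mx^T *m (evalrow gpol y)^t*) 0 0.
Proof.
move=> xD yD.
pose al x j := (1 - x) / (1 - x * (z j)^*).
pose h x j := (1 - (z j)^*) / (1 - x * (z j)^*).
have quad : (evalrow gpol x *m pick_mx^T *m (evalrow gpol y)^t*) 0 0 =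
   den.[x] * (den.[y])^* * \sum_j \sum_i
      coef_at j * h x j * (pick_mx i j * (coef_at i * h y i)^*).
  rewrite mulr_sumr; under [RHS]eq_bigr => j _ do rewrite mulr_sumr.
  rewrite [RHS]exchange_big [LHS]mxE /=; apply: eq_bigr => i _.
  rewrite [X in X * _]mxE mulr_suml; apply: eq_bigr => j _.
  rewrite [evalrow _ _ _ _]mxE [_^T _ _]mxE [_ i 0]mxE [_^T _ _]mxE [evalrow _ _ _ _]mxE.
  by rewrite !gpolE ?(ltW xD) ?(ltW yD)// rmorphM /=; rewrite /h; ring.
rewrite quad !pnumE ?qdenE ?(ltW xD) ?(ltW yD)//.
set S := \sum_j \sum_i _.
pose T1 := \sum_j (s j)^* * coef_at j * al x j.
pose T2 := \sum_j (s j)^* * coef_at j * al y j.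
pose U1 := \sum_j coef_at j * al x j.
pose U2 := \sum_j coef_at j * al y j.
rewrite -/T1 -/T2 -/U1 -/U2.
(* The single sums [T1] and [T2] become double sums through the linear system for [coefs]; the
   identity then holds term by term. *)
suff key : U1 * U2^* - T1 * T2^* = T1 + T2^* - (1 - x * y^*) * S.
  have T2c : (1 + T2)^* = 1 + T2^* by rewrite rmorphD /= conjC1.
  rewrite 2!rmorphM /= T2c.
  transitivity (den.[x] * den.[y]^* * (1 + T1 + T2^* - (U1 * U2^* - T1 * T2^*))); first by ring.
  by rewrite key; ring.
rewrite /U1 /U2 /T1 /T2 !rmorph_sum /= !big_distrlr /= -sumrB.
have T1E : \sum_j (s j)^* * coef_at j * al x j =
    \sum_j \sum_i coef_at j * al x j * (1 - (z j)^*) * (pick_mx i j * (coef_at i)^*).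
  apply: eq_bigr => j _; rewrite -mulr_sumr coefs_eq_conj.
  have zj : 1 - (z j)^* != 0 by rewrite -conjC1 -rmorphB conjC_eq0 zn1.
  by field.
have T2E : \sum_i ((s i)^* * coef_at i * al y i)^* =
    \sum_j \sum_i (coef_at i)^* * (al y i)^* * (1 - z i) * (pick_mx i j * coef_at j).
  rewrite exchange_big /=; apply: eq_bigr => i _; rewrite -mulr_sumr coefs_eq.
  have -> : ((s i)^* * coef_at i * al y i)^* = s i * (coef_at i)^* * (al y i)^*.
    by rewrite rmorphM /= [X in X * _]rmorphM /= conjCK.
  by move: ((al y i)^*) => b; field; rewrite zn1.
rewrite T1E T2E -big_split /= mulr_sumr -sumrB; apply: eq_bigr => j _.
rewrite -[LHS]sumrB -big_split /= mulr_sumr -[RHS]sumrB; apply: eq_bigr => i _.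
have d1 := den1_neq0 j (ltW xD); have d2 := den1_neq0 i (ltW yD).
have d2' : 1 - y^* * z i != 0.
  by move: d2; rewrite -conjC_eq0 rmorphB rmorphM /= conjC1 conjCK.
have d3 := den1_neq0 j (ltW (zD i)).
rewrite /al /h [pick_mx i j]mxE !(rmorphM, fmorphV, rmorphB) /= ?conjC1 ?conjCK.
by field; do ?[apply/andP; split].
Qed.

End Interpolant.

(** * Finite interpolation with [k] zeros *)

Section FiniteInterpolation.
Local Open Scope sesquilinear_scope.
Variable R : realType.
Local Notation C := R[i].

Definition bdd (h : C -> C) := exists K : R, forall x, `|x| < 1 -> `|h x| <= K%:C%C.

Lemma bdd_cst c : bdd (fun=> c).
Proof. by exists (cnorm c) => x _; rewrite cnormE. Qed.

Lemma bddD f g : bdd f -> bdd g -> bdd (fun x => f x + g x).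
Proof.
move=> [K1 h1] [K2 h2]; exists (K1 + K2) => x xD; rewrite rmorphD.
by apply: le_trans (ler_normD _ _) _; rewrite lerD ?h1 ?h2.
Qed.

Lemma bddM f g : bdd f -> bdd g -> bdd (fun x => f x * g x).
Proof.
move=> [K1 h1] [K2 h2]; exists (K1 * K2) => x xD; rewrite rmorphM normrM.
by rewrite ler_pM ?h1 ?h2.
Qed.

Lemma bdd_conj f : bdd f -> bdd (fun x => (f x)^*).
Proof. by move=> [K h]; exists K => x xD; rewrite norm_conjC h. Qed.

Lemma bdd_sum (I : Type) (s : seq I) (F : I -> C -> C) :
  (forall i, bdd (F i)) -> bdd (fun x => \sum_(i <- s) F i x).
Proof.
move=> bF; elim: s => [|i s IH].
  by exists 0 => x _; rewrite big_nil normr0.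
have [K hK] := bddD (bF i) IH; exists K => x xD; rewrite big_cons; exact: hK.
Qed.

Lemma bdd_horner (p : {poly C}) : bdd (horner p).
Proof.
elim/poly_ind: p => [|p c IH]; first by exists 0 => x _; rewrite horner0 normr0.
have bx : bdd id by exists 1 => x /ltW; rewrite rmorph1.
have [K hK] := bddD (bddM IH bx) (bdd_cst c).
by exists K => x xD; rewrite hornerMXaddC; exact: hK.
Qed.

Lemma bfactor_le1 (a x : C) : `|a| < 1 -> `|x| < 1 -> `|bfactor a x| <= 1.
Proof.
move=> aD xD; have n : 1 - x * a^* != 0 by apply: disk_conj_neq1 => //; exact: ltW.
by rewrite normrM normfV ler_pdivrMr ?normr_gt0// mul1r mobius_le// ltW.
Qed.

Lemma norm_prod_ge (I : eqType) (s : seq I) (F : I -> C) (c : C) : 0 <= c ->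
  (forall i, i \in s -> c <= `|F i|) -> c ^+ size s <= `|\prod_(i <- s) F i|.
Proof.
move=> c0; elim: s => [|i s IH] cF; first by rewrite big_nil normr1.
rewrite big_cons normrM exprS ler_pM ?exprn_ge0//; first by apply: cF; rewrite mem_head.
by apply: IH => j js; apply: cF; rewrite inE js orbT.
Qed.

Lemma norm_prod_le1 (I : eqType) (s : seq I) (F : I -> C) :
  (forall i, i \in s -> `|F i| <= 1) -> `|\prod_(i <- s) F i| <= 1.
Proof.
elim: s => [|i s IH] cF; first by rewrite big_nil normr1.
rewrite big_cons normrM mulr_ile1//; first by apply: cF; rewrite mem_head.
by apply: IH => j js; apply: cF; rewrite inE js orbT.
Qed.

Lemma psdmx_tr n (B : 'M[C]_n) : psdmx B -> psdmx B^T.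
Proof.
move=> psdB x; have := psdB (map_mx Num.conj x); congr (0 <= _).
rewrite !mxE; under eq_bigr => j _ do rewrite !mxE mulr_suml.
under [RHS]eq_bigr => j _ do rewrite !mxE mulr_suml.
rewrite exchange_big /=; apply: eq_bigr => i _; apply: eq_bigr => j _.
by rewrite !mxE conjCK; ring.
Qed.

Lemma psdmxD n (A B : 'M[C]_n) : psdmx A -> psdmx B -> psdmx (A + B).
Proof. by move=> pA pB x; rewrite mulmxDr mulmxDl mxE addr_ge0. Qed.

Lemma finite_interpolation n k (z s : 'I_n -> C) (G : 'M[C]_(n, k)) :
  (forall i, disk (z i)) -> pick_mx z s \in unitmx ->
  psdmx (pick_mx z s + G *m G^t*) ->
  exists (f : C -> C) (a : seq C), [/\ size a = k, forall x, x \in a -> disk x,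
    psd_kernel (@disk C) (pick f) &
    forall i, f (z i) = \prod_(b <- a) bfactor b (z i) * s i].
Proof.
move=> zD Pu psdP.
pose p := pnum z s; pose q := qden z s; pose d := den z; pose g := gpol z s.
pose P := pick_mx z s.
pose E := (G *m G^t*)^T.
have Eh : E^t* = E.
  apply/matrixP => i j; rewrite !mxE rmorph_sum; apply: eq_bigr => h _.
  by rewrite !mxE rmorphM /= conjCK mulrC.
have rE : (\rank E <= k)%N.
  by rewrite mxrank_tr; apply: leq_trans (mxrankM_maxl _ _) (rank_leq_col _).
have ident x y : disk x -> disk y -> q.[x] * (q.[y])^* - p.[x] * (p.[y])^* =
  d.[x] * (d.[y])^* + (1 - x * y^*) * (evalrow g x *m P^T *m (evalrow g y)^t*) 0 0.
  by move=> xD yD; exact: pick_identity.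
have d0 x : `|x| < 1 -> d.[x] != 0 by move=> /ltW; exact: den_neq0.
(* By [ident] this kernel is the Szego kernel scaled by [p] plus the form of [P^T + E], and both are
   positive. *)
have psdN : psd_kernel (@disk C) (zero_count_kernel E g d q).
  move=> t c ut tD.
  rewrite (eq_form (c' := c) (K' := fun x y => p.[x] * (p.[y])^* * szego x y +
     (evalrow g x *m (P^T + E) *m (evalrow g y)^t*) 0 0))//.
    rewrite formD form_scale addr_ge0 ?psd_szego// form_psdmx /E -linearD /=.
    exact: psdmx_tr.
  move=> x y xt yt; rewrite /zero_count_kernel mulmxDr mulmxDl [X in _ = _ + X]mxE.
  have n1 : 1 - x * y^* != 0.
    by apply: disk_conj_neq1; [exact: tD|exact/ltW/tD].
  have := ident x y (tD x xt) (tD y yt).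
  move: (((evalrow g x *m P^T) *m (evalrow g y)^t*) 0 0) => A.
  move=> e; rewrite (_ : q.[x] * q.[y]^* = p.[x] * p.[y]^* + (d.[x] * d.[y]^* + (1 - x * y^*) * A)).
    by rewrite /szego; field.
  by rewrite -e addrC subrK.
(* The normalisation at 1, where all the factors [1 - x] vanish, excludes [q = 0]. *)
have q1 : q.[1] = d.[1].
  by rewrite /q qdenE ?normr1// subrr big1 ?addr0 ?mulr1// => j _; rewrite mul0r mulr0.
have qN0 : q != 0.
  by apply/eqP => q0; move: q1; rewrite q0 horner0 => /esym/eqP; rewrite (negbTE (den_neq0 _ _))// normr1.
have [rs qE] := closed_field_poly_normal q.
set l := lead_coef q in qE.
have l0 : l != 0 by rewrite lead_coef_eq0.
pose zs := [seq r <- rs | `|r| < 1]; pose ws := [seq r <- rs | ~~ (`|r| < 1)].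
have rsE : \prod_(r <- rs) ('X - r%:P) =
    \prod_(r <- zs) ('X - r%:P) * \prod_(r <- ws) ('X - r%:P) :> {poly C}.
  by rewrite /zs /ws (bigID (fun r => `|r| < 1)) /= !big_filter.
have zsD x : x \in zs -> disk x by rewrite mem_filter => /andP[].
have wsN x : x \in ws -> 1 <= `|x|.
  by rewrite mem_filter real_ltNge ?normr_real// negbK => /andP[].
have szs : (size zs <= k)%N.
  apply: leq_trans rE; apply: (zero_count Eh zsD d0 psdN).
  by rewrite qE rsE dvdpZr// dvdp_mulr.
(* This many zeros at 0 complete the list to length exactly [k]. *)
pose m := (k - size zs)%N.
(* This is [q] with its zeros in the disk reflected across the circle: [x - r] becomes
   [1 - x conj(r)], which is zero-free in the disk, and [q = W * B] there. *)
pose W x := l * (\prod_(r <- ws) (x - r) * \prod_(r <- zs) (1 - x * r^*)).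
pose B x := \prod_(r <- zs) bfactor r x.
have Wge x (c : C) : 0 <= c -> `|x| <= 1 - c -> `|l| * c ^+ size rs <= `|W x|.
  move=> c0 xc; rewrite normrM ler_wpM2l//.
  have -> : size rs = (size ws + size zs)%N.
    by rewrite !size_filter addnC count_predC.
  rewrite exprD normrM ler_pM ?exprn_ge0//; apply: norm_prod_ge => // r rz.
    rewrite distrC; apply: le_trans (lerB_dist _ _).
    by rewrite lerBrDr; apply: le_trans (wsN r rz); rewrite -lerBrDl.
  apply: le_trans (lerB_dist _ _); rewrite normr1 lerBrDr -lerBrDl.
  apply: le_trans xc; rewrite normrM norm_conjC ler_piMr//; exact/ltW/zsD.
have W0 x : `|x| < 1 -> W x != 0.
  move=> xD; rewrite -normr_gt0.
  apply: lt_le_trans (Wge x (1 - `|x|) _ _); rewrite ?subKr ?subr_ge0 ?(ltW xD)//.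
  by rewrite mulr_gt0 ?normr_gt0// exprn_gt0// subr_gt0.
have qWB x : `|x| < 1 -> q.[x] = W x * B x.
  move=> xD; rewrite qE hornerZ rsE hornerM !horner_prod.
  have e (us : seq C) : \prod_(r <- us) ('X - r%:P).[x] = \prod_(r <- us) (x - r).
    by apply: eq_bigr => r _; rewrite hornerXsubC.
  have eB : \prod_(r <- zs) (x - r) = \prod_(r <- zs) (1 - x * r^*) * B x.
    rewrite /B -big_split /=; apply: eq_big_seq => r rz.
    by rewrite /bfactor mulrC mulfVK//; apply: disk_conj_neq1 => //; exact/ltW/zsD.
  by rewrite !e eB /W; ring.
pose f x := x ^+ m * p.[x] / W x.
exists f, (zs ++ nseq m 0); split.
- by rewrite size_cat size_nseq subnKC.
- by move=> x; rewrite mem_cat => /orP[/zsD//|/nseqP[-> _]]; rewrite /disk normr0.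
- have [C0 hC0] : bdd (fun x => (evalrow g x *m P^T *m (evalrow g x)^t*) 0 0).
    have [K hK] := @bdd_sum _ (index_enum 'I_n) (fun j x =>
      (\sum_(i <- index_enum 'I_n) (g i).[x] * P^T i j) * ((g j).[x])^*)
       (fun j => bddM (bdd_sum _ (fun i => bddM (bdd_horner (g i)) (bdd_cst (P^T i j))))
          (bdd_conj (bdd_horner (g j)))).
    exists K => x xD; apply: le_trans (hK x xD).
    rewrite le_eqVlt; apply/orP; left; apply/eqP; congr (`|_|).
    rewrite [LHS]mxE; apply: eq_bigr => j _.
    rewrite [X in X * _]mxE [X in _ * X]mxE [_^T _ _]mxE [evalrow _ _ _ _]mxE; congr (_ * _).
    by apply: eq_bigr => i _; rewrite [evalrow _ _ _ _]mxE.
  have [Kp hKp] := bdd_horner p.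
  have [dl dl0 hdl] : exists2 dl : R, 0 < dl & forall x, `|x| < 1 -> dl%:C%C <= `|d.[x]|.
    exists (\prod_j (1 - cnorm (z j))).
      by apply: prodr_gt0 => j _; rewrite subr_gt0 -cnorm_lt1; exact: zD.
    move=> x xD; rewrite /d /den horner_prod rmorph_prod normr_prod.
    apply: ler_prod => j _; rewrite lin_denE rmorphB rmorph1 /= cnormE norm_1subM_ge ?(ltW xD)// andbT.
    by rewrite subr_ge0; exact/ltW/zD.
  (* [C0] bounds the quadratic form and [dl] bounds [|den|] below; beyond this radius
     [(1 - |x|^2) (|C0| + 1) <= dl^2], so the diagonal of [ident] gives [|p| <= |q|]. *)
  pose r := 1 - dl ^+ 2 / (2 * (`|C0| + 1)).
  have C10 : 0 < 2 * (`|C0| + 1) by rewrite mulr_gt0// ltr_wpDl.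
  have r1 : r < 1 by rewrite gtrBl divr_gt0// exprn_gt0.
  have near x : r%:C%C < `|x| -> `|x| < 1 -> `|p.[x]| <= `|q.[x]|.
    move=> rx xD; set u := (evalrow g x *m P^T *m (evalrow g x)^t*) 0 0.
    have PTh : (P^T)^t* = P^T.
      by apply/matrixP => i j; rewrite [LHS]mxE [_^T _ _]mxE [_^T _ _]mxE pick_mx_herm [RHS]mxE.
    have uR : u \is Num.real by rewrite CrealE -herm_formE.
    have := ident x x xD xD; rewrite -/u -[u]RRe_real// -!normCK.
    have := hC0 x xD; rewrite -/u -[u]RRe_real// => uC0.
    have {uC0}uC0 : `|re u| <= C0.
      by move: uC0; rewrite normc_def /= expr0n addr0 sqrtr_sqr lecR.
    rewrite -!cnormE -!rmorphXn -(rmorph1 (real_complex R)) -!rmorphB -rmorphM -rmorphD.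
    move=> /(@complexI R) e; rewrite lecR -ler_sqr ?nnegrE ?cnorm_ge0// -subr_ge0 e.
    have h1 : dl ^+ 2 <= cnorm d.[x] ^+ 2.
      by rewrite ler_sqr ?nnegrE ?cnorm_ge0 ?(ltW dl0)// -lecR cnormE hdl.
    have x1 : cnorm x < 1 by rewrite -cnorm_lt1.
    have x0 := cnorm_ge0 x.
    have rx' : r < cnorm x by rewrite -ltcR cnormE.
    have h2 : (1 - cnorm x ^+ 2) * (`|C0| + 1) <= dl ^+ 2.
      apply: (@le_trans _ _ ((1 - r) * (2 * (`|C0| + 1)))); last first.
        by rewrite subKr mulfVK// gt_eqF.
      rewrite mulrA ler_wpM2r ?addr_ge0// {rx xD e h1 uC0}.
      by move: (cnorm x) r r1 rx' x1 x0 => y r' *; nra.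
    have h3 : - (`|C0| + 1) <= re u.
      rewrite lerNl; apply: le_trans (ler_norm _) _; rewrite normrN.
      by apply: le_trans uC0 _; apply: le_trans (ler_norm _) _; rewrite lerDl.
    have h4 : 0 <= 1 - cnorm x ^+ 2 by rewrite subr_ge0 expr_le1// ltW.
    have := ler_wpM2l h4 h3; rewrite mulrN => h5.
    by rewrite addrC -lerBlDr sub0r; apply: le_trans h5; rewrite lerN2 (le_trans h2).
  have fnear x : r%:C%C < `|x| -> `|x| < 1 -> `|f x| <= 1.
    move=> rx xD; have W0x := W0 x xD.
    rewrite normrM normfV ler_pdivrMr ?normr_gt0// mul1r normrM normrX.
    apply: (@le_trans _ _ `|p.[x]|); first by rewrite ler_piMl// exprn_ile1 ?normr_ge0 ?(ltW xD).
    apply: le_trans (near x rx xD) _; rewrite qWB// normrM ler_piMr//.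
    by apply: norm_prod_le1 => b bz; apply: bfactor_le1 => //; exact: zsD.
  have fc x : `|x| < 1 -> cdiff f x.
    move=> xD; apply: cdiff_div; first exact: W0.
      by apply: cdiffM; [apply: cdiffX; exact: cdiff_id|exact: cdiff_horner].
    apply: cdiffM; first exact: cdiff_cst.
    apply: cdiffM; apply: cdiff_prod => b; apply: cdiffB; try exact: cdiff_cst.
      exact: cdiff_id.
    by apply: cdiffM; [exact: cdiff_id|exact: cdiff_cst].
  have f1 x : `|x| < 1 -> `|f x| <= 1.
    rewrite (_ : 1 = 1%:C%C) ?rmorph1//.
    (* Up to radius [r], [Wge] with [c = 1 - r] bounds [f]; the [+ 1] covers the remaining ring,
       where [|f| <= 1]. *)
    pose Kf := Kp / (cnorm l * (1 - r) ^+ size rs) + 1.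
    have cl0 : 0 < cnorm l * (1 - r) ^+ size rs.
      by rewrite mulr_gt0 ?exprn_gt0 ?subr_gt0// -ltcR cnormE normr_gt0.
    have Kp0 : 0 <= Kp.
      by rewrite -ler0c (le_trans (normr_ge0 p.[0]))// hKp// normr0.
    apply: (@max_modulus _ f 1 Kf) => // [y yD|e e0]; last first.
      exists r => // y ry yD; apply: le_trans (fnear y ry yD) _.
      by rewrite -(rmorph1 (real_complex R)) lecR lerDl ltW.
    have [ry|yr] := ltP r (cnorm y).
      apply: le_trans (fnear y _ yD) _; first by rewrite -cnormE ltcR.
      by rewrite -(rmorph1 (real_complex R)) lecR lerDr divr_ge0// ltW.
    apply: (@le_trans _ _ (Kp / (cnorm l * (1 - r) ^+ size rs))%:C%C); last first.
      by rewrite lecR lerDl.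
    have Wy : cnorm l * (1 - r) ^+ size rs <= cnorm (W y).
      rewrite -lecR rmorphM rmorphXn /= !cnormE; apply: Wge.
        by rewrite ler0c subr_ge0 ltW.
      by rewrite -cnormE -(rmorph1 (real_complex R)) -rmorphB lecR subKr.
    rewrite normrM normfV normrM -!cnormE -fmorphV -!rmorphM lecR.
    apply: ler_pM; rewrite ?mulr_ge0 ?invr_ge0 ?cnorm_ge0//.
      rewrite -lecR rmorphM /= !cnormE normrX.
      apply: le_trans (hKp y yD); rewrite ler_piMl// exprn_ile1 ?normr_ge0 ?(ltW yD)//.
    by rewrite lef_pV2// posrE (lt_le_trans cl0).
  move=> t c ut tD; apply: (@pick_psd _ t f [::] c) => // [x xD _|x xD _|x xt].
  + exact: fc.
  + exact: f1.
  + by split => //; exact: tD.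
- move=> i; rewrite big_cat /= -/(B (z i)) /f /p interpolation// -/q qWB; last exact: zD.
  rewrite big_nseq; have -> : iter m ( *%R (bfactor 0 (z i))) 1 = z i ^+ m.
    rewrite /bfactor subr0 conjC0 mulr0 subr0 divr1.
    by elim: (m) => [|m' IH]; rewrite ?expr0//= IH exprS.
  by field; rewrite W0//; exact: zD.
Qed.

End FiniteInterpolation.

(** * Kernel matrices and the perturbation to an invertible one *)

Section NegativeEigenvalues.
Local Open Scope sesquilinear_scope.
Variable R : realType.
Local Notation C := R[i].

Lemma sum_undup n (z : 'I_n -> C) (x : 'I_n -> C) (F : C -> C) :
  \sum_(y <- undup [seq z i | i <- enum 'I_n]) (\sum_(i | z i == y) x i) * F y =
  \sum_i x i * F (z i).
Proof.
under eq_bigr => y _ do rewrite big_mkcond mulr_suml /=.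
rewrite exchange_big /=; apply: eq_bigr => i _.
have zi : z i \in undup [seq z i | i <- enum 'I_n].
  by rewrite mem_undup; apply: map_f; rewrite mem_enum.
rewrite (bigD1_seq (z i) zi) ?undup_uniq//= eqxx.
by rewrite big1 ?addr0// => y yz; rewrite eq_sym (negbTE yz) mul0r.
Qed.

(** Reconciles kernel matrices, whose nodes may repeat, with forms over duplicate-free lists:
    coefficients at equal nodes are added. *)
Lemma form_undup n (z : 'I_n -> C) (x : 'rV_n) K :
  form (undup [seq z i | i <- enum 'I_n]) K (fun y => \sum_(i | z i == y) x 0 i) =
  (x *m (\matrix_(i, j) K (z i) (z j)) *m x^t*) 0 0.
Proof.
rewrite /form; set u := undup _.
under eq_bigr => y _.
  rewrite (eq_bigr (fun w => (\sum_(i | z i == y) x 0 i) *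
     ((\sum_(i | z i == w) (x 0 i)^*) * K y w))); last first.
    by move=> w _; rewrite rmorph_sum mulrA.
  rewrite -mulr_sumr (sum_undup z (fun i => (x 0 i)^*)).
  over.
rewrite (sum_undup z (x 0) (fun y => \sum_j (x 0 j)^* * K y (z j))) [RHS]mxE.
under [RHS]eq_bigr => j _ do rewrite !mxE mulr_suml.
rewrite [RHS]exchange_big /=; apply: eq_bigr => i _; rewrite mulr_sumr.
by apply: eq_bigr => j _; rewrite !mxE; ring.
Qed.

Lemma undup_disk n (z : 'I_n -> C) (D : C -> Prop) : (forall i, D (z i)) ->
  forall y, y \in undup [seq z i | i <- enum 'I_n] -> D y.
Proof. by move=> zD y; rewrite mem_undup => /mapP[i _ ->]. Qed.

Lemma kernel_mxE S n (z : 'I_n -> C) :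
  kernel_mx (schur_kernel S) z = pick_mx z (S \o z).
Proof. by apply/matrixP => i j; rewrite !mxE. Qed.

Lemma num_neg_leP n k (A : 'M[C]_n) : A^t* = A ->
  (num_neg_eigenvalues A <= k)%N <-> exists G : 'M[C]_(n, k), psdmx (A + G *m G^t*).
Proof.
move=> Ah; apply: count_neg_eigenvaluesP.
  by apply/is_hermitianmxP; rewrite expr0 scale1r Ah.
rewrite /eigenvalues; case: closed_field_poly_normal => r /= rE.
by rewrite [LHS]rE (monicP (char_poly_monic A)) scale1r.
Qed.

Lemma pick_mx_hermT n (z s : 'I_n -> C) : (pick_mx z s)^t* = pick_mx z s.
Proof. by apply/matrixP => i j; rewrite [LHS]mxE [_^T _ _]mxE pick_mx_herm. Qed.

Lemma num_neg_le_kernel_mx k (D : C -> Prop) S n (z : 'I_n -> C) :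
  neg_squares_le k D (pick S) -> (forall i, D (z i)) ->
  (num_neg_eigenvalues (kernel_mx (schur_kernel S) z) <= k)%N.
Proof.
move=> neg zD; rewrite kernel_mxE; apply/num_neg_leP; first exact: pick_mx_hermT.
have [G Gpos] := neg _ (undup_uniq _) (undup_disk zD).
exists (\matrix_(i, l) G l (z i)) => x.
have := Gpos (fun y => \sum_(i | z i == y) x 0 i).
rewrite -formD form_undup.
set M1 := \matrix_(i, j) _; set M2 := pick_mx _ _ + _.
have -> // : M1 = M2.
apply/matrixP => i j; rewrite /M1 /M2 !mxE; congr (_ + _).
by apply: eq_bigr => l _; rewrite !mxE.
Qed.

Definition szego_mx n (z : 'I_n -> C) : 'M[C]_n := \matrix_(i, j) szego (z i) (z j).

Lemma szego_psdmx n (z : 'I_n -> C) : (forall i, disk (z i)) -> psdmx (szego_mx z).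
Proof.
move=> zD x; rewrite -form_undup; apply: psd_szego; first exact: undup_uniq.
exact: undup_disk.
Qed.

Lemma szego_unitmx n (z : 'I_n -> C) : injective z -> (forall i, disk (z i)) ->
  szego_mx z \in unitmx.
Proof.
move=> zinj zD; rewrite -row_free_unit -kermx_eq0; apply/negPn/negP.
case/rowV0Pn => x /sub_kermxP x0 /rV0Pn[i xi].
have := @form_szego_gt0 C (undup [seq z i | i <- enum 'I_n])
  (fun y => \sum_(i | z i == y) x 0 i) (undup_uniq _) (undup_disk zD).
rewrite form_undup -/(szego_mx z) x0 mul0mx mxE ltxx => H; apply/negP: isT; apply: H.
exists (z i); first by rewrite mem_undup map_f ?mem_enum.
by rewrite (big_pred1 i)// => j /=; rewrite (inj_eq zinj).
Qed.

(** The [size p] candidates [t = 1 - e / (k + 2)] have distinct squares, too many to be all roots.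
    The shift by 2 keeps [t] above [1 - e], and [e <= 1] keeps it positive. *)
Lemma exists_nonroot (p : {poly C}) (e : R) : p != 0 -> 0 < e <= 1 ->
  exists t : R, [/\ 1 - e < t, 0 < t, t < 1 & p.[(t ^+ 2)%:C%C] != 0].
Proof.
move=> p0 /andP[e0 e1]; pose t k : R := 1 - e / k.+2%:R.
have tk k : [/\ 1 - e < t k, 0 < t k & t k < 1].
  have k2 : (0 : R) < k.+2%:R by [].
  have h1 : e / k.+2%:R < e by rewrite gtr_pMr// invf_lt1// ltr1n.
  have h2 : 0 < e / k.+2%:R by rewrite divr_gt0.
  rewrite /t; move: (e / _) h1 h2 => w h1 h2; split; lra.
apply: contrapT => H.
pose ts := [seq (t k ^+ 2)%:C%C | k <- iota 0 (size p)].
have : (size ts < size p)%N.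
  apply: max_poly_roots => //.
    apply/allP => x /mapP[k _ ->]; apply/negPn/negP => pk; apply: H.
    by have [? ? ?] := tk k; exists (t k).
  rewrite map_inj_uniq ?iota_uniq// => k j /(@complexI R) /eqP.
  have [_ tk0 _] := tk k; have [_ tj0 _] := tk j.
  rewrite eqrXn2 ?ltW// => /eqP /(congr1 (fun x => 1 - x)); rewrite !subKr.
  move=> /(mulfI (lt0r_neq0 e0)) /invr_inj /eqP; rewrite eqr_nat.
  by move=> /eqP [].
by rewrite size_map size_iota ltnn.
Qed.

(** The scaled Pick matrix is [szego_mx z - t^2 M], and its determinant is a polynomial in [t^2]
    that is nonzero at 0. *)
Lemma scaled_unitmx n (z s : 'I_n -> C) (e : R) : injective z ->
  (forall i, disk (z i)) -> 0 < e <= 1 -> exists t : R,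
  [/\ 1 - e < t, 0 < t, t < 1 & pick_mx z (fun i => t%:C%C * s i) \in unitmx].
Proof.
move=> zinj zD e01.
pose M : 'M[C]_n := \matrix_(i, j) (s i * (s j)^* * szego (z i) (z j)).
pose N : 'M[{poly C}]_n := map_mx polyC (szego_mx z) - 'X *: map_mx polyC M.
have NE x : (\det N).[x] = \det (szego_mx z - x *: M).
  rewrite -[LHS]/(horner_eval x (\det N)) -det_map_mx; congr (\det _).
  apply/matrixP => i j; rewrite !mxE /= /horner_eval.
  by rewrite hornerD hornerN hornerM hornerX !hornerC.
have [|t [t1 t2 t3 t4]] := @exists_nonroot (\det N) e _ e01.
  apply/eqP => N0; have := NE 0; rewrite N0 horner0 scale0r subr0 => /esym/eqP.
  have := szego_unitmx zinj zD; rewrite unitmxE unitfE; by move=> /negbTE->.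
exists t; split => //; rewrite unitmxE unitfE.
rewrite (_ : pick_mx _ _ = szego_mx z - (t ^+ 2)%:C%C *: M) -?NE//.
apply/matrixP => i j; rewrite !mxE /szego rmorphM rmorphXn /=.
rewrite (_ : (t%:C%C)^* = t%:C%C); first by ring.
by apply/CrealP; rewrite ger0_real// ler0c ltW.
Qed.

Lemma scaled_interpolation k (Omega : set C) S (e : R) (u : seq C) :
  Omega `<=` unit_disk R -> 0 < e <= 1 ->
  (forall n (z : 'I_n -> C), (1 <= n)%N -> (forall i, Omega (z i)) ->
    (num_neg_eigenvalues (kernel_mx (schur_kernel S) z) <= k)%N) ->
  uniq u -> u != [::] -> (forall x, x \in u -> Omega x) ->
  exists (t : R) (f : C -> C) (a : seq C), [/\ 1 - e < t /\ t < 1, size a = k,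
     forall x, x \in a -> disk x, psd_kernel (@disk C) (pick f) &
     forall x, x \in u -> f x = \prod_(b <- a) bfactor b x * (t%:C%C * S x)].
Proof.
move=> OD e01 hneg us u0 uO.
pose z (i : 'I_(size u)) := nth 0 u i.
have zO i : Omega (z i) by apply: uO; rewrite mem_nth.
have zD i : disk (z i) by apply: OD.
have zinj : injective z.
  by move=> i j /eqP; rewrite nth_uniq// => /eqP /val_inj.
have n1 : (1 <= size u)%N by rewrite lt0n size_eq0.
have := hneg _ z n1 zO; rewrite kernel_mxE.
move=> /(num_neg_leP _ (pick_mx_hermT _ _))[G psdG].
have [t [t1 t2 t3 tu]] := scaled_unitmx (S \o z) zinj zD e01.
have tc : (t%:C%C)^* = t%:C%C :> C by apply/CrealP; rewrite ger0_real// ler0c ltW.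
have psdt : psdmx (pick_mx z (fun i => t%:C%C * (S \o z) i) + (t%:C%C *: G) *m (t%:C%C *: G)^t*).
  (* A nonnegative combination of two positive matrices, with [t G] having as many columns as [G]:
     scaling creates no negative square. *)
  have -> : pick_mx z (fun i => t%:C%C * (S \o z) i) + (t%:C%C *: G) *m (t%:C%C *: G)^t* =
     (1 - t%:C%C ^+ 2) *: szego_mx z + t%:C%C ^+ 2 *: (pick_mx z (S \o z) + G *m G^t*).
    have Gt : (t%:C%C *: G)^t* = t%:C%C *: G^t*.
      by apply/matrixP => i j; rewrite !mxE rmorphM /= tc.
    rewrite Gt -scalemxAl -scalemxAr scalerA -expr2 scalerDr addrA.
    congr (_ + _); apply/matrixP => i j; rewrite !mxE /szego rmorphM /= tc; ring.
  apply: psdmxD => x; rewrite -scalemxAr -scalemxAl mxE mulr_ge0//.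
  - by rewrite -rmorphXn -(rmorph1 (real_complex R)) -rmorphB ler0c subr_ge0 expr_le1// ltW.
  - exact: szego_psdmx.
  - by rewrite -rmorphXn ler0c exprn_ge0// ltW.
have [f [a [sa aD psdf fE]]] := finite_interpolation zD tu psdt.
exists t, f, a; split => // x xu.
have xi : (index x u < size u)%N by rewrite index_mem.
by have := fE (Ordinal xi); rewrite /z /= nth_index.
Qed.

End NegativeEigenvalues.

(** * Ultrafilter limits *)

Section Ultralimit.
Variables (R : realType) (I : Type) (U : set_system I).
Hypothesis UU : UltraFilter U.
Local Notation C := R[i].
Implicit Types (h g : I -> C) (l : C).

Local Instance U_proper : ProperFilter U := @ultra_proper _ _ UU.

Definition ulim h l := forall e : R, 0 < e -> U [set i | `|h i - l| <= e%:C%C].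

Lemma ulimP h l : ulim h l <-> (h i : C^o) @[i --> U] --> (l : C^o).
Proof.
split=> [H|].
  apply/(@cvgrPdist_le C C^o I U _ (h : I -> C^o) (l : C^o)) => e e0.
  have [r r0 er] := gt0_realC e0; apply: filterS (H r r0) => i /=.
  by rewrite distrC er.
move=> /(@cvgrPdist_le C C^o I U _ (h : I -> C^o) (l : C^o)) H e e0.
have := H e%:C%C; rewrite ltcR => /(_ e0); apply: filterS => i /=.
by rewrite distrC.
Qed.

Lemma ulimD h g l m : ulim h l -> ulim g m -> ulim (fun i => h i + g i) (l + m).
Proof.
by move=> /ulimP H /ulimP G; apply/ulimP; exact: (@cvgD C C^o I U _ h g l m H G).
Qed.

Lemma ulimM h g l m : ulim h l -> ulim g m -> ulim (fun i => h i * g i) (l * m).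
Proof.
by move=> /ulimP H /ulimP G; apply/ulimP; exact: (@cvgM C I U _ h g l m H G).
Qed.

Lemma ulim_cst l : ulim (fun=> l) l.
Proof.
by move=> e e0; apply: filterS (@filterT _ U _) => i _ /=; rewrite subrr normr0 ler0c ltW.
Qed.

Lemma ulim_conj h l : ulim h l -> ulim (fun i => (h i)^*) l^*.
Proof.
by move=> H e /H; apply: filterS => i /=; rewrite -rmorphB norm_conjC.
Qed.

Lemma ulimB h g l m : ulim h l -> ulim g m -> ulim (fun i => h i - g i) (l - m).
Proof.
by move=> /ulimP H /ulimP G; apply/ulimP; exact: (@cvgB C C^o I U _ h g l m H G).
Qed.

Lemma ulim_sum (J : Type) (s : seq J) (F : J -> I -> C) (L : J -> C) :
  (forall j, ulim (F j) (L j)) ->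
  ulim (fun i => \sum_(j <- s) F j i) (\sum_(j <- s) L j).
Proof.
move=> FL; elim: s => [|j s IH].
  rewrite big_nil (_ : (fun i => _) = fun=> 0); first exact: ulim_cst.
  by apply/funext => i; rewrite big_nil.
rewrite big_cons (_ : (fun i => _) = fun i => F j i + \sum_(j <- s) F j i).
  exact: ulimD.
by apply/funext => i; rewrite big_cons.
Qed.

Lemma ulim_prod (J : Type) (s : seq J) (F : J -> I -> C) (L : J -> C) :
  (forall j, ulim (F j) (L j)) ->
  ulim (fun i => \prod_(j <- s) F j i) (\prod_(j <- s) L j).
Proof.
move=> FL; elim: s => [|j s IH].
  rewrite big_nil (_ : (fun i => _) = fun=> 1); first exact: ulim_cst.
  by apply/funext => i; rewrite big_nil.
rewrite big_cons (_ : (fun i => _) = fun i => F j i * \prod_(j <- s) F j i).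
  exact: ulimM.
by apply/funext => i; rewrite big_cons.
Qed.

Lemma ulim_form (s : seq C) (K : I -> C -> C -> C) (L : C -> C -> C) c :
  (forall z w, z \in s -> w \in s -> ulim (fun i => K i z w) (L z w)) ->
  ulim (fun i => form s (K i) c) (form s L c).
Proof.
move=> KL; pose K' i z w := if (z \in s) && (w \in s) then K i z w else L z w.
have -> : (fun i => form s (K i) c) = (fun i => form s (K' i) c).
  by apply/funext => i; apply: eq_form => // z w zs ws; rewrite /K' zs ws.
apply: ulim_sum => z; apply: ulim_sum => w; apply: ulimM; first exact: ulim_cst.
rewrite /K'; case: (boolP ((z \in s) && (w \in s))) => [/andP[zs ws]|_].
  exact: KL.
exact: ulim_cst.
Qed.

Lemma ulim_ge0 h l : (forall i, 0 <= h i) -> ulim h l -> 0 <= l.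
Proof.
move=> h0 hl; apply: ge0_limit => e e0.
by have [j hj] := filter_ex (hl e e0); exists (h j).
Qed.

Lemma ulim_unique h g l m : ulim h l -> ulim g m -> U [set i | h i = g i] -> l = m.
Proof.
move=> hl gm hg; apply/eqP; rewrite -subr_eq0 -normr_eq0 -cnormE.
rewrite -(rmorph0 (real_complex R)) (inj_eq (@complexI R)) eq_le cnorm_ge0 andbT.
apply/ler_addgt0Pr => e e0; rewrite add0r.
have e2 : 0 < e / 2 by rewrite divr_gt0.
have [i [[/= h1 h2] h3]] := filter_ex (@filterI _ U _ _ _ (@filterI _ U _ _ _ (hl _ e2) (gm _ e2)) hg).
rewrite -lecR cnormE [e]splitr rmorphD /=.
rewrite -(subrKA (h i)); apply: le_trans (ler_normD _ _) _; apply: lerD.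
  by rewrite distrC.
by rewrite h3.
Qed.

(** The limit is the supremum of the eventual lower bounds. A number above it is not an eventual
    lower bound, so by the ultrafilter property [h] is eventually below it. *)
Lemma ulim_real (h : I -> R) (B : R) : (forall i, `|h i| <= B) ->
  exists l : R, forall e : R, 0 < e -> U [set i | `|h i - l| <= e].
Proof.
move=> hB; pose A := [set x | U [set i | x <= h i]].
have A0 : A !=set0.
  exists (- B); apply: filterS (@filterT _ U _) => i _ /=.
  by have := hB i; rewrite ler_norml => /andP[].
have Aub : ubound A B.
  move=> x /filter_ex[i /= xi]; apply: le_trans xi _.
  by have := hB i; rewrite ler_norml => /andP[].
exists (sup A) => e e0.
have h1 : U [set i | sup A - e <= h i].
  have : sup A - e < sup A by rewrite gtrBl.
  move=> /(sup_gt A0)[x Ax xe]; apply: filterS Ax => i /=.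
  by apply: le_trans; exact: ltW.
have h2 : U (~` [set i | sup A + e <= h i]).
  case: (in_ultra_setVsetC [set i | sup A + e <= h i] UU) => [H|]; last by [].
  have : sup A + e <= sup A by apply: ub_le_sup => //; exists B.
  by rewrite gerDl leNgt e0.
apply: filterS (@filterI _ U _ _ _ h1 h2) => i [/= k1 /negP]; rewrite -ltNge => k2.
by rewrite ler_distl k1 ltW.
Qed.

Lemma ulim_bounded h (B : R) : (forall i, `|h i| <= B%:C%C) ->
  exists2 l, `|l| <= B%:C%C & ulim h l.
Proof.
move=> hB.
have hB' i : cnorm (h i) <= B by rewrite -lecR cnormE.
have [l1 h1] := @ulim_real (fun i => re (h i)) B (fun i => le_trans (cnorm_re _) (hB' i)).
have [l2 h2] := @ulim_real (fun i => im (h i)) B (fun i => le_trans (cnorm_im _) (hB' i)).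
have hl : ulim h (Complex l1 l2).
  move=> e e0; have e2 : 0 < e / 2 by rewrite divr_gt0.
  apply: filterS (@filterI _ U _ _ _ (h1 _ e2) (h2 _ e2)) => i [/= k1 k2].
  by rewrite [e]splitr; apply: norm_le_ReIm; rewrite ?re_sub ?im_sub.
exists (Complex l1 l2) => //; rewrite -cnormE lecR; apply/ler_addgt0Pr => e e0.
have [i /= hi] := filter_ex (hl e e0).
rewrite -lecR rmorphD /= cnormE -[X in `|X|](subKr (h i)).
apply: le_trans (ler_normB _ _) _; apply: lerD => //.
Qed.

End Ultralimit.

(** * The two directions of the theorem *)

Section Factorization.
Variable R : realType.
Local Notation C := R[i].

Lemma bfactor_boundary_const (a x : C) : `|a| = 1 -> `|x| < 1 -> bfactor a x = - a.
Proof.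
move=> a1 xD; have aa : a * a^* = 1 by rewrite -normCK a1 expr1n.
have n : 1 - x * a^* != 0 by apply: disk_conj_neq1 => //; rewrite a1.
apply: (mulIf n); rewrite mulfVK// mulNr mulrBr mulr1 mulrCA aa mulr1 opprB.
by [].
Qed.

Lemma schur_class_psd (f : C -> C) : schur_class f -> psd_kernel (@disk C) (pick f).
Proof.
move=> [fh f1] s c us sD; apply: (@pick_psd _ s f [::] c) => // [x xD _|x xD _|x xs].
- exact/derivable_cdiff/fh.
- exact: f1.
- by split => //; exact: sD.
Qed.

(** An index is a finite node set with a level that drives [t] to 1. Larger node sets and higher
    levels generate a proper filter, because union and maximum meet any two requirements. *)
Lemma finite_index_ultrafilter (Omega : set C) : Omega !=set0 ->
  exists U : set_system (seq C * nat), UltraFilter U /\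
    forall (x : C) (k : nat), Omega x ->
      U [set i | [/\ uniq i.1, forall y, y \in i.1 -> Omega y, x \in i.1 & (k <= i.2)%N]].
Proof.
move=> [x0 Ox0].
pose D (s : seq C) := forall y, y \in s -> Omega y.
pose B (j : seq C * nat) : set (seq C * nat) :=
  [set i | [/\ uniq i.1, D i.1, forall y, y \in j.1 -> y \in i.1 & (j.2 <= i.2)%N]].
have FF : Filter (filter_from [set j | D j.1] B).
  apply: filter_from_filter; first by exists ([::], 0%N).
  move=> j1 j2 D1 D2; exists (j1.1 ++ j2.1, maxn j1.2 j2.2).
    by move=> y /=; rewrite mem_cat => /orP[/D1|/D2].
  move=> i [/= u Di sub]; rewrite geq_max => /andP[k1 k2].
  by split; split => // y yj; apply: sub; rewrite mem_cat yj ?orbT.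
have PF : ProperFilter (filter_from [set j | D j.1] B).
  apply: filter_from_proper => j Dj; exists (undup j.1, j.2); split => //=.
  - exact: undup_uniq.
  - by move=> y; rewrite mem_undup; exact: Dj.
  - by move=> y; rewrite mem_undup.
have [U [UU sub]] := ultraFilterLemma PF.
exists U; split => // x k Ox; apply: sub; exists ([:: x], k).
  by move=> y /=; rewrite inE => /eqP->.
move=> i [/= u Di h1 h2]; split => //; apply: h1; exact: mem_head.
Qed.

Lemma factorization_exists (Omega : set C) (S : C -> C) (k : nat) :
  Omega `<=` unit_disk R -> has_negative_squares Omega (schur_kernel S) k ->
  exists f B : C -> C, [/\ schur_class f, blaschke_product k B
    & forall z, Omega z -> f z = B z * S z].
Proof.
move=> OD [_ hneg [n [z [n1 zO _]]]].
have O0 : Omega !=set0 by exists (z (Ordinal n1)).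
have [U [UU Ubase]] := finite_index_ultrafilter O0.
have [x0 Ox0] := O0.
have approx (i : seq C * nat) : exists p : R * (C -> C) * seq C,
    [/\ `|p.1.1| <= 1, size p.2 = k, forall x, x \in p.2 -> disk x,
      psd_kernel (@disk C) (pick p.1.2) &
      uniq i.1 -> (forall y, y \in i.1 -> Omega y) -> i.1 != [::] ->
      1 - i.2.+1%:R^-1 < p.1.1 /\ p.1.1 < 1 /\
      forall x, x \in i.1 -> p.1.2 x = \prod_(b <- p.2) bfactor b x * (p.1.1%:C%C * S x)].
  have [[u [uO i0]]|N] := pselect (uniq i.1 /\ (forall y, y \in i.1 -> Omega y) /\ i.1 != [::]).
    have e01 : 0 < (i.2.+1%:R^-1 : R) <= 1 by rewrite invr_gt0 ltr0n/= invf_le1 ?ler1n.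
    have [t [f [a [[t1 t2] sa aD psdf fE]]]] := scaled_interpolation OD e01 hneg u i0 uO.
    exists (t, f, a); split => //=.
    have : 0 < t by apply: le_lt_trans t1; rewrite subr_ge0; case/andP: e01.
    by move=> t0; rewrite ger0_norm ltW.
  (* Default for an unusable node set: the choice is total, and bounds, degree and positivity must
     hold at every index for the limits to exist. *)
  exists (0, (fun=> 0), nseq k 0); split => /=.
  - by rewrite normr0.
  - by rewrite size_nseq.
  - by move=> x /nseqP[-> _]; rewrite /disk normr0.
  - move=> s c us sD; rewrite (eq_form (c' := c) (K' := @szego C))// ?psd_szego//.
    by move=> y w _ _; rewrite /pick mul0r subr0 mul1r.
  - by move=> u uO i0; case: N.
have [p pP] := choice approx.
pose F i := (p i).1.2; pose tau i := (p i).1.1; pose A i := (p i).2.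
have psdF i : psd_kernel (@disk C) (pick (F i)) by have [] := pP i.
have Ai j i : `|nth 0 (A i) j| <= 1.
  have [_ _ aD _ _] := pP i; have [ja|ja] := ltnP j (size (A i)).
    by apply/ltW/aD; rewrite mem_nth.
  by rewrite nth_default// normr0.
have one : (1 : C) = 1%:C%C by rewrite rmorph1.
have limF x : exists l : C, `|x| < 1 -> `|l| <= 1 /\ ulim U (fun i => F i x) l.
  have [xD|] := boolP (`|x| < 1); last by exists 0.
  have [|l l1 hl] := @ulim_bounded R _ U UU (fun i => F i x) 1.
    by move=> i; rewrite -one; exact: psd_pick_le1 (fun _ => id) (psdF i) xD.
  by exists l => _; rewrite one.
have [f fP] := choice limF.
have limA (j : 'I_k) : exists l : C, `|l| <= 1 /\ ulim U (fun i => nth 0 (A i) j) l.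
  have [|l l1 hl] := @ulim_bounded R _ U UU (fun i => nth 0 (A i) j) 1.
    by move=> i; rewrite -one.
  by exists l; rewrite one.
have [al alP] := choice limA.
have limtau : ulim U (fun i => (tau i)%:C%C) 1.
  move=> e e0; have [m me] : exists m, m.+1%:R^-1 < e.
    exists (Num.truncn e^-1); rewrite invf_plt ?posrE//; exact: truncnS_gt.
  apply: filterS (Ubase x0 m Ox0) => i [/= u uO xi mi].
  have [_ _ _ _] := pP i; case => //; first by apply: contraTneq xi => ->.
  move=> t1 [t2 _]; rewrite distrC one -rmorphB ger0_norm ?ler0c ?subr_ge0 ?(ltW t2)//.
  have h : i.2.+1%:R^-1 <= m.+1%:R^-1 :> R by rewrite lef_pV2 ?posrE ?ltr0n// ler_nat.
  by rewrite lecR; move: (i.2.+1%:R^-1) (m.+1%:R^-1) t1 me h; rewrite -/(tau i) => *; lra.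
have psdf : psd_kernel (@disk C) (pick f).
  move=> s c us sD; apply: (@ulim_ge0 R _ U UU (fun i => form s (pick (F i)) c)).
    by move=> i; exact: psdF.
  apply: ulim_form => y w /sD yD /sD wD; have [_ hy] := fP y yD; have [_ hw] := fP w wD.
  apply: ulimM; last exact: ulim_cst.
  by apply: ulimB; [exact: ulim_cst|apply: ulimM => //; exact: ulim_conj].
have fE x : Omega x -> f x = \prod_(j < k) bfactor (al j) x * S x.
  move=> Ox; have xD : `|x| < 1 := OD _ Ox.
  have n0 (j : 'I_k) : 1 - x * (al j)^* != 0.
    by apply: disk_conj_neq1 => //; have [] := alP j.
  (* Cleared of denominators, the equation involves only sums, products and conjugates, which pass
     to the ultralimit. *)
  have : f x * \prod_(j < k) (1 - x * (al j)^*) = \prod_(j < k) (x - al j) * (1 * S x).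
    apply: (@ulim_unique R _ U UU
      (fun i => F i x * \prod_(j < k) (1 - x * (nth 0 (A i) j)^*))
      (fun i => \prod_(j < k) (x - nth 0 (A i) j) * ((tau i)%:C%C * S x))).
    - have [_ hx] := fP x xD; apply: ulimM => //; apply: ulim_prod => j.
      apply: ulimB; first exact: ulim_cst.
      by apply: ulimM; [exact: ulim_cst|apply: ulim_conj; have [] := alP j].
    - apply: ulimM; last by apply: ulimM => //; exact: ulim_cst.
      by apply: ulim_prod => j; apply: ulimB; [exact: ulim_cst|have [] := alP j].
    - apply: filterS (Ubase x 0%N Ox) => i [/= u uO xi _].
      have [_ sa aD _] := pP i; case => //; first by apply: contraTneq xi => ->.
      move=> _ [_ /(_ x xi)]; rewrite -/(F i) -/(tau i) -/(A i) => ->.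
      rewrite (big_nth 0) big_mkord sa mulrAC -big_split /=; congr (_ * _).
      apply: eq_bigr => j _; rewrite /bfactor mulfVK//.
      by apply: disk_conj_neq1.
  rewrite mul1r => /(canRL (mulfK _)) ->; last first.
    by rewrite prodf_seq_neq0; apply/allP => j _ /=.
  by rewrite mulrAC -prodf_div.
(* The factors whose zeros escape to the circle are unimodular constants; they are
   moved to [f] and replaced by factors [x]. *)
pose al' j := if `|al j| < 1 then al j else 0.
pose corr x := \prod_(j < k) (if `|al j| < 1 then 1 else x / (- al j)).
have al1 j : ~~ (`|al j| < 1) -> `|al j| = 1.
  have [l1 _] := alP j => N; apply/eqP; rewrite eq_le l1 /=.
  by move: N; rewrite -real_leNgt// normr_real.
exists (fun x => f x * corr x), (fun x => \prod_(j < k) bfactor (al' j) x); split.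
- split => x xD.
    apply: cdiff_derivable; apply: cdiffM; first exact: psd_pick_cdiff.
    apply: cdiff_prod => j; case: (`|al j| < 1); first exact: cdiff_cst.
    by apply: cdiffM; [exact: cdiff_id|exact: cdiff_cst].
  rewrite normrM mulr_ile1//; first by have [] := fP x xD.
  apply: norm_prod_le1 => j _; case: ifPn => [_|/al1 aj]; first by rewrite normr1.
  by rewrite normrM normfV normrN aj divr1 ltW.
- exists 1, al'; split => [|j|x xD]; first by rewrite normr1.
    by rewrite /al'; case: ifPn => // _; rewrite /unit_disk /= normr0.
  by rewrite mul1r.
- move=> x Ox; have xD : `|x| < 1 := OD _ Ox.
  rewrite fE// mulrAC; congr (_ * _); rewrite /corr -big_split /=.
  apply: eq_bigr => j _; rewrite /al'; case: ifPn => [_|/al1 aj]; first by rewrite mulr1.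
  have a0 : al j != 0 by rewrite -normr_eq0 aj oner_neq0.
  rewrite bfactor_boundary_const// /bfactor conjC0 mulr0 !subr0 divr1.
  by field.
Qed.

Lemma factorization_negative_squares (Omega : set C) (S f B : C -> C) (k : nat) :
  Omega `<=` unit_disk R -> Omega !=set0 -> schur_class f -> blaschke_product k B ->
  (forall z, Omega z -> f z = B z * S z) ->
  exists2 k' : nat, (k' <= k)%N & has_negative_squares Omega (schur_kernel S) k'.
Proof.
move=> OD [x0 Ox0] fS [gamma [a [g1 aD BE]]] fBS.
have neg : neg_squares_le k Omega (pick S).
  have -> : k = size [seq a j | j <- enum 'I_k] by rewrite size_map size_enum_ord.
  apply: (@neg_squares_le_blaschke _ _ Omega f S gamma) => //.
  - by move=> b /mapP[j _ ->]; exact: aD.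
  - by move=> s c us sO; apply: schur_class_psd => // z /sO /OD.
  - move=> z Oz; rewrite fBS// BE; last exact: OD.
    by rewrite big_map big_enum.
have hle n (z : 'I_n -> C) : (forall i, Omega (z i)) ->
    (num_neg_eigenvalues (kernel_mx (schur_kernel S) z) <= k)%N.
  exact: num_neg_le_kernel_mx.
(* The required [k'] is the largest count attained: all counts are at most [k], and the node [x0]
   provides one. *)
pose P m := `[< exists n (z : 'I_n -> C), [/\ (1 <= n)%N, forall i, Omega (z i) &
   num_neg_eigenvalues (kernel_mx (schur_kernel S) z) = m] >].
have P0 : exists m, P m.
  exists (num_neg_eigenvalues (kernel_mx (schur_kernel S) (fun _ : 'I_1 => x0))).
  by apply/asboolP; exists 1%N, (fun=> x0).
have Pk m : P m -> (m <= k)%N by move=> /asboolP[n [z [_ zO <-]]]; exact: hle.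
have [m /asboolP Pm mmax] := ex_maxnP P0 Pk.
exists m; first by apply: Pk; apply/asboolP.
split => //.
- by move=> zeta z _ _; exact: (pick_herm S z zeta).
- by move=> n z n1 zO; apply: mmax; apply/asboolP; exists n, z.
Qed.

End Factorization.

Theorem theorem3p2 (R : realType) (Omega : set R[i]) (S : R[i] -> R[i])
    (kappa : nat) (hOmega : Omega `<=` unit_disk R) :
  (has_negative_squares Omega (schur_kernel S) kappa ->
     exists f B : R[i] -> R[i],
       [/\ schur_class f,
           blaschke_product kappa B
         & forall z, Omega z -> f z = B z * S z])
  /\
  (Omega !=set0 ->
   (exists f B : R[i] -> R[i],
       [/\ schur_class f,
           blaschke_product kappa B
         & forall z, Omega z -> f z = B z * S z]) ->
   exists2 kappa' : nat, (kappa' <= kappa)%N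
     & has_negative_squares Omega (schur_kernel S) kappa').
Proof.
split=> [|O0 [f [B [fS BB fBS]]]]; first exact: factorization_exists.
exact: factorization_negative_squares fBS.
Qed.
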